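(* For each random variable $Y$ with values in $\mathbb R_+=(0,\infty)$ there is a distributionally stable conservative ergodic measure preserving transformation $(X,\mathcal B,m,T)$ with ergodic limit $Y$ and with $1$-regularly varying $Y$-distributional return sequence $a(n)=a_{n,Y}(T)$, and there is a set $\Omega\in\mathcal B$ with $m(\Omega)=1$, such that for all sufficiently large $n\ge1$, $$m\big(\Omega\cap[S_n(1_\Omega)\ge x\,a(n)]\big)\le 2\,\mathrm{Prob}(Y\ge x)\qquad\forall\ x>1 .$$
   Context: $\mathbb R_+=(0,\infty)$. Measure preserving transformations act on $\sigma$-finite measure spaces $(X,\mathcal B,m)$ (possibly infinite). For measurable $f\ge 0$, $S_n(f)=S_n^{(T)}(f)=\sum_{k=1}^n f\circ T^k$. Strong distributional convergence: measurable $F_n:X\to[0,\infty]$ converge strongly in distribution to a random variable $Y$ if for every probability measure $Q$ on $(X,\mathcal B)$ with $Q\ll m$, $\int_X g(F_n)\,dQ\to E(g(Y))$ for every bounded continuous $g$. A conservative ergodic measure preserving transformation $(X,\mathcal B,m,T)$ is distributionally stable with ergodic limit $Y$ (a random variable on $(0,\infty)$) if there are constants $a(n)>0$ such that for every $f\in L^1(m)$, $f\ge0$, $\frac{S_n(f)}{a(n)}\to Y\int_X f\,dm$ strongly in distribution. The sequence $a(n)=a_{n,Y}(T)$ is determined up to asymptotic equality and is called the $Y$-distributional return sequence. A function $a:\mathbb R_+\to\mathbb R_+$ is $1$-regularly varying if $a(xt)/a(t)\to x$ as $t\to\infty$ for every $x>0$; a sequence is $1$-regularly varying if it is the restriction to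 $\mathbb N$ of such a function. *)

(* Defs.v *)
From HB Require Import structures.
From mathcomp Require Import all_boot all_order all_algebra.
From mathcomp Require Import all_classical all_reals all_analysis.

Set Implicit Arguments.
Unset Strict Implicit.
Unset Printing Implicit Defensive.

Import Order.TTheory GRing.Theory Num.Theory.
Import numFieldNormedType.Exports.

Local Open Scope classical_set_scope.
Local Open Scope ring_scope.

Section Transformations.
Context {d : measure_display} {X : measurableType d} {R : realType}.
Implicit Types (m : {measure set X -> \bar R}) (T : X -> X).

Definition measure_preserving m T : Prop :=
  measurable_fun setT T /\
  (forall A : set X, measurable A -> m (T @^-1` A) = m A).

Definition wandering T (W : set X) : Prop :=
  measurable W /\ trivIset setT (fun n : nat => iter n T @^-1` W).

Definition conservative m T : Prop :=
  forall W : set X, wandering T W -> m W = 0%E.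

Definition ergodic m T : Prop :=
  forall A : set X, measurable A -> T @^-1` A = A ->
    m A = 0%E \/ m (~` A) = 0%E.

(* The sum starts at k = 1: f itself (k = 0) is not included. *)
Definition ergodic_sum T (f : X -> \bar R) (n : nat) (x : X) : \bar R :=
  (\sum_(1 <= k < n.+1) f (iter k T x))%E.

(* F n takes values in [0, +oo], so the test functions g are the bounded
   continuous functions on [0, +oo] with the topology of \bar R; the values of
   g at negative arguments are irrelevant. *)
Definition strong_distr_cvg m (F : nat -> X -> \bar R)
    {d' : measure_display} {Om : measurableType d'} (P : probability Om R)
    (Z : Om -> \bar R) : Prop :=
  forall Q : probability X R, Q `<< m ->
  forall g : \bar R -> R,
    [bounded g y | y in [set y : \bar R | (0 <= y)%E]] ->
    {within [set y : \bar R | (0 <= y)%E], continuous g} ->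
    (\int[Q]_x (g (F n x))%:E)%E @[n --> \oo] --> ('E_P[fun w => g (Z w)])%E.

Definition distr_return_sequence m T
    {d' : measure_display} {Om : measurableType d'} (P : probability Om R)
    (Y : Om -> R) (a : nat -> R) : Prop :=
  (forall n, (0 < n)%N -> 0 < a n) /\
  (forall f : X -> \bar R, m.-integrable setT f -> (forall x, (0 <= f x)%E) ->
     strong_distr_cvg m (fun n x => (ergodic_sum T f n x * ((a n)^-1)%:E)%E)
       P (fun w => ((Y w)%:E * \int[m]_x f x)%E)).

Definition distributionally_stable m T
    {d' : measure_display} {Om : measurableType d'} (P : probability Om R)
    (Y : Om -> R) : Prop :=
  exists a : nat -> R, distr_return_sequence m T P Y a.

End Transformations.

(* A function (0, +oo) -> (0, +oo) is encoded as a function on R, of which only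
   the values at positive arguments matter. *)
Definition regularly_varying1 {R : realType} (a : R -> R) : Prop :=
  (forall t, 0 < t -> 0 < a t) /\
  (forall x, 0 < x -> a (x * t) / a t @[t --> +oo] --> x).

Definition regularly_varying1_seq {R : realType} (a : nat -> R) : Prop :=
  exists2 b : R -> R, regularly_varying1 b &
    forall n, (0 < n)%N -> a n = b n%:R.

(* Main.v *)
Require Import Defs.
From HB Require Import structures.
From mathcomp Require Import all_boot all_order all_algebra.
From mathcomp Require Import all_classical all_reals all_analysis.
From mathcomp Require Import measurable_realfun.
From mathcomp Require Import zify ring lra.

Import Order.TTheory GRing.Theory Num.Theory.
Import numFieldNormedType.Exports.

Local Open Scope classical_set_scope.
Local Open Scope ring_scope.

Set Implicit Arguments.
Unset Strict Implicit.
Unset Printing Implicit Defensive.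

(** The transformation is a skyscraper over an odometer [tau] with its uniform
    measure. At every level [k] each point has a type [y], constant on the blocks
    of level [k] ([Q_k] consecutive points). A block of level [k+1] consists of
    [q_k] blocks of level [k]; the first [l_k] of them get as types the quantiles
    of a discretisation of the law of [Y], the others inherit the type of the
    large block. As [sum l_k / q_k] diverges, the law of the types is asymptotically
    that of [Y], and is asymptotically independent of every cylinder. As [l_k / q_k]
    tends to [0], a long window of points lies, with probability close to 1, where
    the type is constant.

    The return time [phi] is chosen, by one long wait per block, so that its sum
    over a block of level [k] and type [y] is about [Q_k B_k / y], where [B_k] tends
    to infinity slowly. So [N] points take time about [N B_k / y], and up to time [n]
    the base is visited about [y n / B_k] times. With [a(n)] close to [n / B_k] the
    ratio [S_n(1_Omega) / a(n)] therefore has nearly the law of [Y]; asymptotic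
    independence from cylinders upgrades this to strong convergence, and the mean
    ergodic theorem for the odometer replaces [1_Omega] by [f].

    For the tail bound, the types above 1 are discretised from below, so that the
    type of a block is [>= x] with probability at most [Prob (Y >= x)]. If
    [S_n >= x a(n)], a window of at most [x a(n)] points meets a type [>= x]; this
    type is that of the surrounding large block, or else of the next large block or
    of a resampled small block, and the last two cases together contribute at most
    another [Prob (Y >= x)]. *)

(** The obstacle is the tail bound: it has to hold for all [x > 1] at once when [n] is large, and
    convergence in distribution gives no such uniformity, least of all where Prob(Y >= x) is tiny.
    It is therefore obtained from inequalities without error term: a lower bound for the time of a
    window, valid at every point, whose losses are absorbed by a factor [1 + 10 / u_k] in a(n), and
    an exact comparison of the tails of the types with those of Y.

    With [u = u_k], about [k^(1/6)], the exponents in [l_k = u^3] and [q_k = 16 u^9] serve opposite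
    demands. A window of at least [u^4] blocks of level [k] is long against [u^3] resampled blocks
    in a row. A window of at most [u^5] blocks is so short against the [16 u^9] blocks in the next
    level that starting in the resampled part or crossing a boundary has probability at most
    [1 / (2 l_k)]. The grid for the types has [u^2] points of mesh [1 / u]; [u^3] quantiles resolve
    each threshold up to [u^-3], which leaves a total error of order [1 / u]. *)

(** * Sums of periodic sequences *)

Lemma sumr_nat_shift (V : nmodType) (g : nat -> V) a b :
  \sum_(a <= i < a + b) g i = \sum_(0 <= i < b) g (a + i)%N.
Proof.
rewrite -{1}[a]add0n big_addn addKn.
by apply: eq_bigr => i _; rewrite addnC.
Qed.

Section periodic_sums.
Context (Q : nat).

Lemma sumr_shift_mod (V : nmodType) (g : nat -> V) s :
  \sum_(0 <= d < Q) g ((s + d) %% Q)%N = \sum_(0 <= d < Q) g d.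
Proof.
elim: s => [|s IH].
  rewrite !big_nat; apply: eq_bigr => d /andP[_ dQ].
  by rewrite add0n modn_small.
rewrite -IH; case: Q => [|q']; first by rewrite !big_geq.
rewrite [RHS]big_nat_recl// big_nat_recr//= addrC; congr (_ + _).
  by rewrite addn0 addSn -addnS modnDr.
by apply: eq_bigr => i _; rewrite addSnnS.
Qed.

Lemma sumr_mod_mul (V : nmodType) (g : nat -> V) s c :
  \sum_(0 <= d < c * Q) g ((s + d) %% Q)%N = (\sum_(0 <= d < Q) g d) *+ c.
Proof.
elim: c => [|c IH]; first by rewrite mul0n big_geq.
rewrite mulSn mulrSr addnC (@big_cat_nat _ _ _ (c * Q)) ?leq_addr//= IH; congr (_ + _).
rewrite sumr_nat_shift -[RHS](sumr_shift_mod g s); apply: eq_bigr => i _.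
by rewrite addnCA -modnDml modnMl.
Qed.

Local Open Scope nat_scope.

Lemma sum_mod_mul (g : nat -> nat) s c :
  \sum_(0 <= d < c * Q) g ((s + d) %% Q) = c * \sum_(0 <= d < Q) g d.
Proof.
have := sumr_mod_mul g s c; rewrite mulnC => ->.
by elim: c => [|c IH]; rewrite ?mul0n// mulrS mulSn IH.
Qed.

Lemma leq_sum_nat_widen (g : nat -> nat) M N : M <= N ->
  \sum_(0 <= d < M) g d <= \sum_(0 <= d < N) g d.
Proof. by move=> MN; rewrite [leqRHS](@big_cat_nat _ _ _ M)//= leq_addr. Qed.

Lemma sum_mod_le (g : nat -> nat) s N : 0 < Q ->
  \sum_(0 <= d < N) g ((s + d) %% Q) <= (N %/ Q).+1 * \sum_(0 <= d < Q) g d.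
Proof.
move=> Q0; rewrite -(sum_mod_mul g s); apply: leq_sum_nat_widen.
by rewrite ltnW// -ltn_divLR.
Qed.

End periodic_sums.

(** * Odometers and block types *)

Section odometer.
Local Open Scope nat_scope.
Context (q : nat -> nat) (q_gt0 : forall k, 0 < q k).
Implicit Types x : nat -> nat.

Definition Qn k := \prod_(i < k) q i.

Definition pos k x := \sum_(j < k) (x j %% q j) * Qn j.

(** Addition of one with carry: the carry reaches digit [k] when all lower digits are maximal.
    Points are arbitrary sequences of naturals of which only the residues modulo [q k] matter, so a
    digit never has to be reset to 0. *)
Definition tau x : nat -> nat :=
  fun k => if (pos k x).+1 == Qn k then (x k).+1 else x k.

Lemma Qn0 : Qn 0 = 1. Proof. by rewrite /Qn big_ord0. Qed.

Lemma QnS k : Qn k.+1 = q k * Qn k.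
Proof. by rewrite /Qn big_ord_recr/= mulnC. Qed.

Lemma Qn_gt0 k : 0 < Qn k.
Proof. by elim: k => [|k IH]; rewrite ?Qn0// QnS muln_gt0 q_gt0. Qed.

Lemma dvdn_Qn k n : k <= n -> Qn k %| Qn n.
Proof.
move/subnK <-; elim: (n - k) => [//|i IH].
by rewrite addSn QnS (dvdn_trans IH)// dvdn_mull.
Qed.

Lemma leq_Qn k n : k <= n -> Qn k <= Qn n.
Proof. by move=> kn; rewrite dvdn_leq ?Qn_gt0// dvdn_Qn. Qed.

Lemma pos0 x : pos 0 x = 0. Proof. by rewrite /pos big_ord0. Qed.

Lemma posS k x : pos k.+1 x = pos k x + (x k %% q k) * Qn k.
Proof. by rewrite /pos big_ord_recr. Qed.

Lemma pos_lt k x : pos k x < Qn k.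
Proof.
elim: k => [|k IH]; first by rewrite pos0 Qn0.
rewrite posS QnS; have := ltn_pmod (x k) (q_gt0 k); nia.
Qed.

Lemma pos_mod k n x : k <= n -> pos n x %% Qn k = pos k x.
Proof.
move/subnK <-; elim: (n - k) => [|i IH]; first by rewrite modn_small ?pos_lt.
rewrite addSn posS -modnDmr.
have /eqP -> : Qn k %| (x (i + k) %% q (i + k)) * Qn (i + k).
  by rewrite dvdn_mull// dvdn_Qn// leq_addl.
by rewrite addn0.
Qed.

Lemma pos_tau k x : pos k (tau x) = (pos k x).+1 %% Qn k.
Proof.
elim: k => [|k IH]; first by rewrite !pos0 Qn0.
rewrite posS IH {1}/tau posS QnS.
have := pos_lt k x; have := Qn_gt0 k; have := q_gt0 k.
case: eqP => [e|ne] q0 Q0 pQ.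
  rewrite e modnn add0n -addSn e -mulSn -muln_modl; congr (_ * _).
  by rewrite -[in RHS]addn1 modnDml addn1.
rewrite [in LHS]modn_small; last by lia.
by rewrite [RHS]modn_small//; have := ltn_pmod (x k) q0; nia.
Qed.

Lemma pos_iter k i x : pos k (iter i tau x) = (pos k x + i) %% Qn k.
Proof.
elim: i => [|i IH]; first by rewrite addn0 modn_small// pos_lt.
by rewrite iterS pos_tau IH -addn1 modnDml addn1 addnS.
Qed.

Definition dig k x := x k %% q k.

Lemma posSdig k x : pos k.+1 x = pos k x + dig k x * Qn k.
Proof. exact: posS. Qed.

Lemma digE k x : dig k x = pos k.+1 x %/ Qn k.
Proof. by rewrite posSdig addnC divnMDl ?Qn_gt0// divn_small ?pos_lt// addn0. Qed.

(** A carry leaves the digits below [k] only at the last position of a block of level [k]. *)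
Lemma dig_tau k j x : k <= j -> (pos k x).+1 < Qn k -> dig j (tau x) = dig j x.
Proof.
move=> kj kx; rewrite /dig /tau; case: eqP => // e; exfalso.
move: kx; rewrite -(pos_mod x kj).
have /dvdnP[c Qc] := dvdn_Qn kj.
have Qk := Qn_gt0 k; have : c > 0 by have := Qn_gt0 j; rewrite Qc; case: (c).
case: c Qc => // c Qc _.
have -> : pos j x = c * Qn k + (Qn k).-1 by move: e; rewrite Qc mulSn; lia.
by rewrite modnMDl modn_small; lia.
Qed.

Lemma dig_iter k j i x : k <= j -> pos k x + i < Qn k ->
  dig j (iter i tau x) = dig j x.
Proof.
move=> kj; elim: i => // i IH kx; rewrite iterS (@dig_tau k)//.
  by rewrite IH//; lia.
by rewrite pos_iter modn_small; lia.
Qed.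

Lemma dig_iter_Qn k d x : dig k (iter (d * Qn k) tau x) = (dig k x + d) %% q k.
Proof.
rewrite !digE pos_iter QnS divn_modl ?dvdn_mull// mulnK ?Qn_gt0//.
by rewrite addnC divnMDl ?Qn_gt0// addnC.
Qed.

End odometer.

Section eventual_value.
Context {T : Type}.

Definition evconst (s : nat -> T) := exists n0, forall n, (n0 <= n)%N -> s n = s n0.

(* The limit of an eventually constant sequence; junk otherwise. *)
Definition evval (s : nat -> T) : T :=
  s (xget 0%N [set n0 | forall n, (n0 <= n)%N -> s n = s n0]).

Lemma evvalP (s : nat -> T) : evconst s ->
  exists n0, forall n, (n0 <= n)%N -> s n = evval s.
Proof.
move=> [n0 h]; rewrite /evval; case: xgetP => [n1 e h1|/(_ n0)]; last by [].
by exists n1.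
Qed.

Lemma evval_eq (s : nat -> T) n0 a :
  (forall n, (n0 <= n)%N -> s n = a) -> evval s = a.
Proof.
move=> h; have [|n1 h1] := @evvalP s; first by exists n0 => n n0n; rewrite !h.
by rewrite -(h1 (maxn n0 n1)) ?leq_maxr// h// leq_maxl.
Qed.

End eventual_value.

Section types.
Context {T : Type} (q l : nat -> nat) (v : nat -> nat -> T) (t0 : T).
Hypothesis q_gt0 : forall k, (0 < q k)%N.
Implicit Types x : nat -> nat.

(* [t0] is the type of the points whose digits are never resampled, a null set
   when the resampling rates have a divergent sum. *)
Fixpoint ytr n k x : T :=
  if n is n'.+1 then
    if (dig q k x < l k)%N then v k (dig q k x) else ytr n' k.+1 x
  else t0.

Definition yty k x : T := evval (fun n => ytr n k x).

(** Once the depth passes the first resampled digit from [k] on, the value is fixed; without such a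
    digit it is always [t0]. *)
Lemma ytr_evconst k x : evconst (fun n => ytr n k x).
Proof.
have [[j kj jl]|nj] := pselect (exists2 j, (k <= j)%N & (dig q j x < l j)%N).
  exists (j - k).+1 => n; move: (j - k)%N (subnK kj) => i ij.
  elim: i k n ij {kj} => [|i IH] k [|n]//= ij.
    by rewrite add0n in ij; rewrite ij jl.
  rewrite ltnS => jn; case: ifP => // _.
  by rewrite (IH k.+1 n)// -ij addSnnS.
exists 0%N => n _ /=; elim: n k nj => //= n IH k nj.
case: ifP => [kl|_]; first by exfalso; apply: nj; exists k.
by apply: IH => -[j kj jl]; apply: nj; exists j => //; exact: ltnW.
Qed.

Lemma ytyS k x :
  yty k x = if (dig q k x < l k)%N then v k (dig q k x) else yty k.+1 x.
Proof.
have [n1 h1] := evvalP (ytr_evconst k x).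
have [n2 h2] := evvalP (ytr_evconst k.+1 x).
rewrite /yty -(h1 (maxn n1 n2).+1); last by rewrite leqW// leq_maxl.
by rewrite /= -(h2 (maxn n1 n2)) ?leq_maxr.
Qed.

Lemma yty_prop (P : T -> Prop) k x : P t0 ->
  (forall k d, (d < l k)%N -> P (v k d)) -> P (yty k x).
Proof.
move=> P0 Pv; have [n1 h1] := evvalP (ytr_evconst k x).
rewrite /yty -(h1 n1)//; elim: n1 k {h1} => //= n IH k.
by case: ifP => // /Pv.
Qed.

Lemma eq_yty k x x' : (forall j, (k <= j)%N -> dig q j x = dig q j x') ->
  yty k x = yty k x'.
Proof.
move=> e; rewrite /yty; congr evval; apply/funext => n.
elim: n k e => //= n IH k e; rewrite e//; case: ifP => // _.
by apply: IH => j kj; apply: e; exact: ltnW.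
Qed.

Lemma yty_iter k i x : (pos q k x + i < Qn q k)%N ->
  yty k (iter i (tau q) x) = yty k x.
Proof. by move=> h; apply: eq_yty => j kj; exact: (dig_iter q_gt0 kj h). Qed.

End types.

(** * The uniform measure of an odometer *)

(* [set0] makes the family closed under intersection. *)
Definition cyl (q : nat -> nat) : set (set (nat -> nat)) :=
  [set A | A = set0 \/ exists k p, A = [set x | pos q k x = p]].

Notation odo q := (g_sigma_algebraType (cyl q)).

Section odometer_space.
Context (q : nat -> nat).
Hypothesis q_gt0 : forall k, (0 < q k)%N.

(** Positions of a higher level refine those of a lower one, so two cylinders are nested or
    disjoint. *)
Lemma cyl_setI : setI_closed (cyl q).
Proof.
move=> A B [->|[k [p ->]]]; first by rewrite set0I; left.
move=> [->|[n [r ->]]]; first by rewrite setI0; left.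
wlog kn : k n p r / (k <= n)%N.
  by move=> W; have [|/ltnW] := leqP k n; [exact: W|rewrite setIC; exact: W].
have [e|ne] := eqVneq (r %% Qn q k)%N p.
- right; exists n, r; rewrite setIidr// => x /= xr.
  by rewrite -(pos_mod q_gt0 x kn) xr.
- left; rewrite -subset0 => x [/= xp xr]; move/eqP: ne; apply.
  by rewrite -xr pos_mod.
Qed.

(* Stands for measurability of functions with countable range, without choosing a
   sigma-algebra on [T]. *)
Definition dm (T : Type) (f : odo q -> T) :=
  forall V : set T, measurable (f @^-1` V).

Lemma dm_pos k : dm (pos q k).
Proof.
move=> V; have -> : pos q k @^-1` V = \bigcup_(p in V) [set x | pos q k x = p].
  by apply/seteqP; split => [x Vx|x [p Vp /= ->]//]; exists (pos q k x).
apply: (@bigcup_measurable _ (odo q)) => p _; apply: sub_sigma_algebra.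
by right; exists k, p.
Qed.

Lemma dm_comp (T U : Type) (h : T -> U) (f : odo q -> T) :
  dm f -> dm (fun x => h (f x)).
Proof. by move=> mf V; exact: (mf (h @^-1` V)). Qed.

Lemma dm_cst (T : Type) (a : T) : dm (fun=> a).
Proof.
move=> V; have [Va|Va] := pselect (V a).
- by rewrite (_ : _ @^-1` _ = setT); [exact: measurableT|apply/seteqP; split].
- by rewrite (_ : _ @^-1` _ = set0); [exact: measurable0|apply/seteqP; split].
Qed.

Lemma dm_bind (I : countType) (T : Type) (f : odo q -> I) (g : I -> odo q -> T) :
  dm f -> (forall i, dm (g i)) -> dm (fun x => g (f x) x).
Proof.
move=> mf mg V.
have -> : (fun x => g (f x) x) @^-1` V =
    \bigcup_n (if unpickle n is Some i then (f @^-1` [set i]) `&` (g i @^-1` V)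
               else set0).
  apply/seteqP; split => [x Vx|x [n _]]; last by case: unpickle => [i [/= <-]|].
  by exists (pickle (f x)) => //; rewrite pickleK.
apply: bigcupT_measurable => n; case: unpickle => [i|]; last exact: measurable0.
by apply: measurableI; [exact: mf|exact: mg].
Qed.

Lemma dm_pair (I : countType) (T : Type) (f : odo q -> I) (g : odo q -> T) :
  dm f -> dm g -> dm (fun x => (f x, g x)).
Proof.
by move=> mf mg; apply: (dm_bind (g := fun i x => (i, g x)) mf) => i; exact: dm_comp.
Qed.

Lemma dm_evval (T : Type) (s : nat -> odo q -> T) :
  (forall n, dm (s n)) -> (forall x, evconst (s ^~ x)) ->
  dm (fun x => evval (s ^~ x)).
Proof.
move=> ms es V.
have -> : (fun x => evval (s ^~ x)) @^-1` V =
    \bigcup_n \bigcap_(m in [set m | (n <= m)%N]) (s m @^-1` V).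
  apply/seteqP; split => [x Vx|x [n _ h] /=].
  - have [n h] := evvalP (es x); exists n => // m nm /=; rewrite h//.
  - have [n' h'] := evvalP (es x).
    rewrite -(h' (maxn n n')) ?leq_maxr//; apply: (h (maxn n n')) => /=.
    exact: leq_maxl.
apply: bigcup_measurable => n _; apply: bigcap_measurable => [|m _]; last exact: ms.
by exists n => /=.
Qed.

Lemma dm_if (T : Type) (b : odo q -> bool) (f g : odo q -> T) :
  dm b -> dm f -> dm g -> dm (fun x => if b x then f x else g x).
Proof.
move=> mb mf mg; apply: (dm_bind (g := fun b x => if b then f x else g x) mb).
by case.
Qed.

Lemma dm_sum (n : nat) (f : nat -> odo q -> nat) :
  (forall i, dm (f i)) -> dm (fun x => \sum_(0 <= i < n) f i x)%N.
Proof.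
move=> mf; elim: n => [|n IH].
  rewrite (_ : (fun _ => _) = fun=> 0%N); first exact: dm_cst.
  by apply/funext => x; rewrite big_geq.
rewrite (_ : (fun _ => _) =
  fun x => (fun ab => ab.1 + ab.2)%N (\sum_(0 <= i < n) f i x, f n x)%N).
  exact: (dm_comp (fun ab => ab.1 + ab.2)%N (dm_pair IH (mf n))).
by apply/funext => x; rewrite big_nat_recr.
Qed.

Lemma dm_measurable d (T : measurableType d) (f : odo q -> T) :
  dm f -> measurable_fun [set: odo q] f.
Proof. by move=> mf _ V _; rewrite setTI; exact: mf. Qed.

Lemma measurable_tau : measurable_fun [set: odo q] (tau q : odo q -> odo q).
Proof.
apply: (@measurability _ _ (odo q) (odo q) setT (tau q) (cyl q)) => //.
move=> _ [B [->|[k [p ->]]] <-]; first by rewrite preimage_set0 setI0; exact: measurable0.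
rewrite setTI (_ : _ @^-1` _ = pos q k @^-1` [set r | r.+1 %% Qn q k = p]%N).
  exact: dm_pos.
by apply/seteqP; split => x /=; rewrite pos_tau.
Qed.

Lemma measurable_iter_tau i :
  measurable_fun [set: odo q] (iter i (tau q) : odo q -> odo q).
Proof.
elim: i => [|i IH]; first exact: measurable_id.
exact: (measurableT_comp measurable_tau IH).
Qed.

Lemma dm_iter (T : Type) (f : odo q -> T) i : dm f -> dm (fun x => f (iter i (tau q) x)).
Proof.
move=> mf V; rewrite (_ : _ @^-1` _ = iter i (tau q) @^-1` (f @^-1` V))//.
by rewrite -[X in measurable X]setTI; apply: measurable_iter_tau.
Qed.

Lemma dm_dig k : dm (dig q k).
Proof.
rewrite (_ : dig q k = fun x => (fun p => p %/ Qn q k)%N (pos q k.+1 x)).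
  exact: (dm_comp (fun p => p %/ Qn q k)%N (dm_pos _)).
by apply/funext => x; rewrite digE.
Qed.

Lemma dm_yty (T : Type) l v (t0 : T) k : dm (yty q l v t0 k).
Proof.
apply: dm_evval; last by move=> x; exact: ytr_evconst.
move=> n; elim: n k => [|n IH] k /=; first exact: dm_cst.
apply: dm_if => //; last exact: (dm_comp (v k) (dm_dig _)).
exact: (dm_comp (fun d => d < l k)%N (dm_dig _)).
Qed.

End odometer_space.

Section odometer_measure.
Context (R : realType) (q : nat -> nat).
Hypothesis q_gt0 : forall k, (0 < q k)%N.

(** Modulo [q k] this is the digit of rank [k] of [r] in the Cantor expansion with bases [q 0],
    [q 1], and so on. The uniform measure is the image of Lebesgue measure on [0, 1). *)
Definition digits (r : R) : odo q := fun k => Num.truncn (r * (Qn q k.+1)%:R).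

(** A cylinder corresponds to an interval of length [1 / Qn q k]. Its index [i] has the digits of
    [p] in reverse order, since digit 0 is the leading one of [r] but the lowest one of [pos]. *)
Lemma digits_pos k p : (p < Qn q k)%N -> exists i : nat, (i < Qn q k)%N /\
  forall r : R, 0 <= r < 1 ->
    (pos q k (digits r) = p <-> i%:R <= r * (Qn q k)%:R < i.+1%:R).
Proof.
elim: k p => [|k IH] p.
  rewrite Qn0 ltnS leqn0 => /eqP ->; exists 0%N; split => // r r01.
  by rewrite pos0 mulr1.
rewrite QnS => pQ.
have Q0 := Qn_gt0 q_gt0 k.
have pQ0 : (p %% Qn q k < Qn q k)%N by rewrite ltn_pmod.
have dq : (p %/ Qn q k < q k)%N by rewrite ltn_divLR.
have [i [iQ h]] := IH _ pQ0.
set d := (p %/ Qn q k)%N in dq *.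
exists (i * q k + d)%N; split; first by nia.
move=> r r01; have {}h := h _ r01.
have rQ0 : 0 <= r * (Qn q k.+1)%:R by rewrite mulr_ge0//; case/andP: r01.
have := truncn_itv rQ0; set t := Num.truncn _ => tr.
have q0 := q_gt0 k.
have q0R : (0 < (q k)%:R :> R) by rewrite ltr0n.
have -> : pos q k.+1 (digits r) = p <->
    pos q k (digits r) = (p %% Qn q k)%N /\ (t %% q k)%N = d.
  have := pos_lt q_gt0 k (digits r).
  rewrite posS -/t [in X in X <-> _](divn_eq p (Qn q k)) -/d => lt; split.
  - move=> e; split.
      by move/(congr1 (modn^~ (Qn q k))): e; rewrite [in LHS]addnC !modnMDl modn_mod modn_small.
    by move/(congr1 (divn^~ (Qn q k))): e; rewrite [in LHS]addnC !divnMDl// divn_small// addn0 divn_small ?addn0.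
  - by move=> [-> ->]; rewrite addnC.
rewrite h; move: tr; rewrite QnS natrM => tr; split.
- move=> [ir td].
  have it1 : (i * q k < t.+1)%N.
    rewrite -(ltr_nat R) natrM; move: ir tr; nra.
  have it2 : (t < i.+1 * q k)%N.
    rewrite -(ltr_nat R) natrM; move: ir tr; nra.
  have -> : (i * q k + d)%N = t.
    rewrite (divn_eq t (q k)) td; congr (_ * _ + _)%N.
    by apply/eqP; rewrite eqn_leq leq_divRL// -[(t %/ _ <= _)%N]ltnS ltn_divLR// it2 andbT.
  by move: tr; rewrite mulrCA mulrA mulrAC.
- move=> ir.
  have td : t = (i * q k + d)%N.
    have t1 : (t < (i * q k + d).+1)%N by rewrite -(ltr_nat R); lra.
    have t2 : (i * q k + d < t.+1)%N by rewrite -(ltr_nat R); lra.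
    by move: t1 t2; rewrite !ltnS => t1 t2; apply/eqP; rewrite eqn_leq t1.
  split; last by rewrite td modnMDl modn_small.
  move: ir; rewrite natrD natrM -addn1 natrD natrD natrM => ir.
  have d0 : 0 <= d%:R :> R by [].
  have dq' : d%:R + 1 <= (q k)%:R :> R by rewrite natr1 ler_nat.
  rewrite -natr1; apply/andP; split; nra.
Qed.

Lemma measurable_digits : measurable_fun [set: R] digits.
Proof.
have mt k : forall V : set nat, measurable ((fun r : R => digits r k) @^-1` V).
  move=> V; have -> : (fun r => digits r k) @^-1` V =
      \bigcup_(t in V) [set r | digits r k = t].
    by apply/seteqP; split => [x Vx|x [t Vt /= ->]//]; exists (digits x k).
  apply: bigcup_measurable => t _.
  have mge s : measurable [set r : R | (s <= digits r k)%N].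
    case: s => [|s]; first by rewrite (_ : [set _ | _] = setT)//; apply/seteqP; split.
    rewrite (_ : [set _ | _] = `[s.+1%:R / (Qn q k.+1)%:R, +oo[%classic)//.
    apply/seteqP; split => r /=; rewrite /digits in_itv/= andbT.
      by rewrite ler_pdivrMr ?ltr0n ?Qn_gt0// truncn_gt_nat.
    by rewrite ler_pdivrMr ?ltr0n ?Qn_gt0// truncn_gt_nat.
  rewrite (_ : [set _ | _] = [set r | (t <= digits r k)%N] `\` [set r | (t < digits r k)%N]).
    exact: measurableD.
  by apply/seteqP; split => r /= => [->|[]]; lia.
have mp k : forall V : set nat, measurable ((fun r : R => pos q k (digits r)) @^-1` V).
  elim: k => [|k IH] V.
    rewrite (_ : (fun _ => _) = cst 0%N); last by apply/funext => r; rewrite pos0.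
    by rewrite preimage_cst; case: ifP.
  rewrite (_ : _ @^-1` _ = \bigcup_i ([set r | pos q k (digits r) = i] `&`
     [set r | V (i + (digits r k %% q k) * Qn q k)%N])).
    apply: bigcup_measurable => i _; apply: measurableI; first exact: (IH [set i]).
    exact: (mt k [set t | V (i + (t %% q k) * Qn q k)%N]).
  by apply/seteqP; split => [r|r [i _ [/= <-]]] /=; rewrite posS// => Vr; exists (pos q k (digits r)).
apply: (@measurability _ _ _ (odo q) setT digits (cyl q)) => //.
move=> _ [B [->|[k [p ->]]] <-]; first by rewrite preimage_set0 setI0; exact: measurable0.
by rewrite setTI; exact: (mp k [set p]).
Qed.

Definition omu (A : set (odo q)) : \bar R :=
  lebesgue_measure ([set r : R | 0 <= r < 1] `&` digits @^-1` A).

Lemma measurable_unit_itv : measurable [set r : R | 0 <= r < 1].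
Proof.
rewrite (_ : [set _ | _] = `[0, 1[%classic); first exact: measurable_itv.
by apply/seteqP; split => r /=; rewrite in_itv.
Qed.

Let omu0 : omu set0 = 0%E.
Proof. by rewrite /omu preimage_set0 setI0 measure0. Qed.

Let omu_ge0 A : (0 <= omu A)%E.
Proof. exact: measure_ge0. Qed.

Let mdA A : measurable A -> measurable ([set r : R | 0 <= r < 1] `&` digits @^-1` A).
Proof.
move=> mA; apply: measurableI; first exact: measurable_unit_itv.
by rewrite -[X in measurable X]setTI; exact: measurable_digits.
Qed.

Let omu_sigma_additive : semi_sigma_additive omu.
Proof.
move=> F mF tF mUF; rewrite /omu preimage_bigcup setI_bigcupr.
apply: measure_semi_sigma_additive.
- by move=> n; exact: mdA.
- apply/trivIsetP => /= i j _ _ ij; rewrite setIACA setIid -preimage_setI.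
  by move/trivIsetP : tF => /(_ _ _ _ _ ij) ->//; rewrite preimage_set0 setI0.
- by rewrite -setI_bigcupr -preimage_bigcup; exact: mdA.
Qed.

HB.instance Definition _ := isMeasure.Build _ _ _ omu omu0 omu_ge0 omu_sigma_additive.

Lemma omu_cyl k p : (p < Qn q k)%N ->
  omu [set x | pos q k x = p] = ((Qn q k)%:R^-1)%:E.
Proof.
move=> /digits_pos[i [iQ h]].
have Q0 : 0 < (Qn q k)%:R :> R by rewrite ltr0n Qn_gt0.
rewrite /omu (_ : _ `&` _ = `[i%:R / (Qn q k)%:R, i.+1%:R / (Qn q k)%:R[%classic).
  rewrite lebesgue_measure_itv/= lte_fin ltr_pM2r ?invr_gt0// ltr_nat ltnSn.
  by rewrite -EFinB -mulrBl -natrB// subSnn mul1r.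
apply/seteqP; split => r /=.
  by move=> [r01 /(h _ r01)]; rewrite in_itv/= ler_pdivrMr// ltr_pdivlMr.
rewrite in_itv/= ler_pdivrMr// ltr_pdivlMr// => ir.
have r01 : 0 <= r < 1.
  have i0 : 0 <= i%:R :> R by [].
  have iQ' : i.+1%:R <= (Qn q k)%:R :> R by rewrite ler_nat.
  apply/andP; split; nra.
by split => //; apply/(h _ r01).
Qed.

Let omu_setT : omu setT = 1%E.
Proof.
have := @omu_cyl 0 0; rewrite Qn0 invr1 => <-//.
by congr omu; apply/seteqP; split => x //= _; rewrite pos0.
Qed.

HB.instance Definition _ := Measure_isProbability.Build _ _ _ omu omu_setT.

Lemma odometer_probability : exists mu : probability (odo q) R,
  forall k p, (p < Qn q k)%N -> mu [set x | pos q k x = p] = ((Qn q k)%:R^-1)%:E.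
Proof. by exists omu => k p; exact: omu_cyl. Qed.

End odometer_measure.

(** * Ergodicity of the odometer *)

Lemma ge0_markov d (T : measurableType d) (R : realType) (mu : {measure set T -> \bar R})
    (F : T -> \bar R) (c s e : R) :
  measurable_fun setT F -> (forall x, 0 <= F x)%E -> (\int[mu]_x F x = c%:E)%E ->
  0 < s -> c <= s * e ->
  measurable [set x | (s%:E < F x)%E] /\ (mu [set x | (s%:E < F x)%E] <= e%:E)%E.
Proof.
move=> mF F0 Fc s0 ce.
have mE : measurable [set x | (s%:E < F x)%E].
  rewrite -[X in measurable X]setTI; exact: emeasurable_fun_o_infty.
split => //; rewrite -(@lee_pmul2l _ s%:E)// -EFinM.
apply: (@le_trans _ _ c%:E); last by rewrite lee_fin.
rewrite -Fc -[X in mu X]setIT -integral_indic// -ge0_integralZl_EFin//; last 2 first.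
- exact/measurable_EFinP.
- exact: ltW.
apply: ge0_le_integral => //.
- by move=> x _; rewrite -EFinM lee_fin mulr_ge0// ltW.
- by apply: measurable_funeM; exact/measurable_EFinP.
move=> x _; rewrite indicE; have [/set_mem h|_] := boolP (x \in _); last by rewrite mule0.
by rewrite mule1 ltW.
Qed.

Lemma ge0_le_abs_dist (R : realType) (h : \bar R) (r : R) : (0 <= h)%E ->
  (h <= r%:E + `|h - r%:E|)%E /\ (r%:E <= h + `|h - r%:E|)%E.
Proof.
case: h => [a| |]//= _; rewrite ?leey// -!EFinD !lee_fin.
by rewrite -!lerBlDl -(distrC r); split; rewrite ?ler_norm// distrC ler_norm.
Qed.

Section odometer_theory.
Context (R : realType) (q : nat -> nat).
Hypothesis q_gt0 : forall k, (0 < q k)%N.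
Context (mu : probability (odo q) R).
Hypothesis mu_cyl : forall k p, (p < Qn q k)%N ->
  mu [set x | pos q k x = p] = ((Qn q k)%:R^-1)%:E.

Local Notation tauq := (tau q : odo q -> odo q).
Local Notation tau_ i := (iter i (tau q) : odo q -> odo q).
Local Notation Q := (Qn q).

Lemma measurable_posP k p : measurable ([set x | pos q k x = p] : set (odo q)).
Proof. exact: (@dm_pos q k [set p]). Qed.

Let cylT : \bigcup_(k : nat) [set: odo q] = setT.
Proof. by apply/seteqP; split => // x _; exists 0%N. Qed.

Let cyl_setT : cyl q setT.
Proof. by right; exists 0%N, 0%N; apply/seteqP; split => // x _ /=; rewrite pos0. Qed.

Lemma odo_measure_unique (m1 m2 : {measure set (odo q) -> \bar R}) :
  (forall k p, m1 [set x | pos q k x = p] = m2 [set x | pos q k x = p]) ->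
  (m1 setT < +oo)%E -> forall A, measurable A -> m1 A = m2 A.
Proof.
move=> h m1oo; apply: (@measure_unique _ R (odo q) (cyl q) (fun=> setT) erefl
  (cyl_setI q_gt0) (fun=> cyl_setT) cylT m1 m2) => //.
by move=> B [->|[k [p ->]]]; rewrite ?measure0.
Qed.

(** The map permutes the cylinders of each level cyclically, and these have equal measure; agreement
    on cylinders suffices. *)
Lemma tau_preserving (A : set (odo q)) : measurable A -> mu (tauq @^-1` A) = mu A.
Proof.
move=> mA.
have mt : measurable_fun [set: odo q] tauq by exact: measurable_tau.
apply: (odo_measure_unique (m1 := pushforward mu tauq) _ _ mA); last first.
  by change (mu setT < +oo)%E; rewrite probability_setT ltry.
move=> k p.
  have Q0 := Qn_gt0 q_gt0 k.
  rewrite /pushforward; have [pQ|Qp] := ltnP p (Q k); last first.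
    congr (mu _); apply/seteqP; split => x /=; last by have := pos_lt q_gt0 k x; lia.
    by move=> xp; have := pos_lt q_gt0 k (tauq x); rewrite xp; lia.
  change (mu (tauq @^-1` [set x | pos q k x = p]) = mu [set x | pos q k x = p]).
  rewrite [in RHS]mu_cyl// -(@mu_cyl k ((p + (Q k).-1) %% Q k)%N) ?ltn_pmod//.
  congr (mu _); apply/seteqP; split => x /=; rewrite pos_tau// => e.
    rewrite -e modnDml addSnnS prednK// modnDr modn_small//.
    exact: pos_lt.
  by rewrite e -addn1 modnDml -addnA addn1 prednK// modnDr modn_small.
Qed.

Lemma iter_preserving i (A : set (odo q)) : measurable A -> mu (tau_ i @^-1` A) = mu A.
Proof.
elim: i A => [//|i IH] A mA.
rewrite (_ : _ @^-1` A = tau_ i @^-1` (tauq @^-1` A))//.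
rewrite IH ?tau_preserving//.
by rewrite -[X in measurable X]setTI; exact: measurable_tau.
Qed.

Local Open Scope ereal_scope.

Lemma integral_iter i (D : set (odo q)) (G : odo q -> \bar R) : measurable D ->
  measurable_fun [set: odo q] G -> (forall x, 0 <= G x) ->
  \int[mu]_(x in D) G x = \int[mu]_(x in tau_ i @^-1` D) G (iter i (tau q) x).
Proof.
move=> mD mG G0.
have mt : measurable_fun [set: odo q] (tau_ i) by exact: measurable_iter_tau.
rewrite -(@ge0_integral_pushforward _ _ _ _ _ _ mt mu D G)//; last first.
  exact: measurable_funTS.
by apply: eq_measure_integral => A mA _; exact/esym/iter_preserving.
Qed.

(** The cylinders of level [k] are the successive images of the base [pos q k x = 0]. Measure
    estimates thereby become counts over the positions of one block. *)
Lemma integral_unfold k (G : odo q -> \bar R) :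
  measurable_fun [set: odo q] G -> (forall x, 0 <= G x) ->
  \int[mu]_x G x =
  \int[mu]_(x in [set x | pos q k x = 0%N]) \sum_(0 <= p < Q k) G (iter p (tau q) x).
Proof.
move=> mG G0.
have Q0 := Qn_gt0 q_gt0 k.
rewrite ge0_integral_sum//; last 2 first.
- exact: measurable_posP.
- move=> p; apply: measurable_funTS; apply: (measurableT_comp mG).
  exact: measurable_iter_tau.
have -> : \int[mu]_x G x = \sum_(0 <= p < Q k) \int[mu]_(x in [set x | pos q k x = p]) G x.
  rewrite -ge0_integral_bigsetU//.
  - congr integral; apply/seteqP; split => x// _; rewrite -bigcup_seq.
    by exists (pos q k x) => //=; rewrite mem_index_iota/= pos_lt.
  - by move=> p; exact: measurable_posP.
  - exact: iota_uniq.
  - by move=> i j _ _ [x [/= <- <-]].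
  - exact: measurable_funTS.
rewrite !big_nat; apply: eq_bigr => p /andP[_ pQ].
rewrite (integral_iter p (measurable_posP k p) mG G0).
congr integral; apply/seteqP; split => x /=; rewrite pos_iter//.
- move=> xp; have xQ := pos_lt q_gt0 k x.
  have [lt|ge] := ltnP (pos q k x + p)%N (Q k).
    by rewrite modn_small// in xp; lia.
  suff: ((pos q k x + p) %% Q k = pos q k x + p - Q k)%N by lia.
  by rewrite -{1}(subnK ge) modnDr modn_small//; lia.
- by move=> ->; rewrite add0n modn_small.
Qed.

Definition block_inv (T : Type) k (f : odo q -> T) :=
  forall x i, pos q k x = 0%N -> (i < Q k)%N -> f (iter i (tau q) x) = f x.

Lemma integral_block k (G : odo q -> \bar R) :
  measurable_fun [set: odo q] G -> (forall x, 0 <= G x) -> block_inv k G ->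
  \int[mu]_(x in [set x | pos q k x = 0%N]) G x = ((Q k)%:R^-1)%:E * \int[mu]_x G x.
Proof.
move=> mG G0 Ginv; have Q0 := Qn_gt0 q_gt0 k.
rewrite [in RHS](integral_unfold k mG G0).
rewrite [in RHS](eq_integral (fun x => ((Q k)%:R)%:E * G x)); last first.
  move=> x /[!inE]/= x0.
  rewrite big_nat (eq_bigr (fun=> G x)); last by move=> i /andP[_ iQ]; rewrite Ginv.
  by rewrite -big_nat sumr_const_nat subn0 mule_natl.
rewrite ge0_integralZl_EFin//.
- by rewrite muleA -EFinM mulVf ?mul1e// pnatr_eq0 -lt0n.
- exact: measurable_posP.
- exact: measurable_funTS.
Qed.

(** Passage from counting to measure. The number of points of [E] in a block may be bounded in terms
    of a set [F] that is a union of blocks. *)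
Lemma count_le k (E F : set (odo q)) (c : R) : measurable E -> measurable F ->
  (0 <= c)%R -> block_inv k F ->
  (forall x, pos q k x = 0%N ->
    \sum_(0 <= p < Q k) \1_E (iter p (tau q) x) <= c * \1_F x)%R ->
  mu E <= (c / (Q k)%:R)%:E * mu F.
Proof.
move=> mE mF c0 Finv h.
have m1 (A : set (odo q)) : measurable A -> measurable_fun [set: odo q] (EFin \o \1_A : odo q -> \bar R).
  by move=> mA; apply/measurable_EFinP; exact: measurable_indic.
have e (A : set (odo q)) : measurable A -> mu A = \int[mu]_x (\1_A x)%:E.
  by move=> mA; rewrite integral_indic// setIT.
rewrite (e E)// (integral_unfold k)//; last exact: m1.
rewrite (e F)// EFinM -muleA -integral_block//; last 2 first.
- exact: m1.
- by move=> x i x0 iQ; rewrite !indicE; congr ((_ : bool)%:R)%:E; apply/idP/idP; rewrite !inE Finv.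
have mb : measurable ([set x | pos q k x = 0%N] : set (odo q)) by exact: measurable_posP.
rewrite -ge0_integralZl_EFin//; last first.
  exact: measurable_funTS (m1 _ mF).
apply: ge0_le_integral => //.
- by move=> x _; apply: sume_ge0 => i _; rewrite lee_fin.
- apply: emeasurable_sum => p; apply: measurable_funTS.
  by apply: (measurableT_comp (m1 _ mE)); exact: measurable_iter_tau.
- apply: measurable_funeM; exact: measurable_funTS (m1 _ mF).
- by move=> x /= x0; rewrite -EFinM sumEFin lee_fin h.
Qed.

Lemma count_leT k (E : set (odo q)) (c : R) : measurable E -> (0 <= c)%R ->
  (forall x, pos q k x = 0%N ->
    \sum_(0 <= p < Q k) \1_E (iter p (tau q) x) <= c)%R ->
  mu E <= (c / (Q k)%:R)%:E.
Proof.
move=> mE c0 h; rewrite -[leRHS]mule1 -(probability_setT mu).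
apply: count_le => // x x0; rewrite indicT/= mulr1; exact: h.
Qed.

(** A union of blocks is independent of the position inside the block. *)
Lemma measure_block k p (A : set (odo q)) : measurable A -> (p < Q k)%N ->
  (forall x i, pos q k x = 0%N -> (i < Q k)%N -> A (iter i (tau q) x) <-> A x) ->
  mu (A `&` [set x | pos q k x = p]) = ((Q k)%:R^-1)%:E * mu A.
Proof.
move=> mA pQ Ainv.
have m1 : measurable_fun [set: odo q] (EFin \o \1_A : odo q -> \bar R).
  by apply/measurable_EFinP; exact: measurable_indic.
have i1 x i : pos q k x = 0%N -> (i < Q k)%N ->
    \1_A (iter i (tau q) x) = \1_A x :> R.
  by move=> x0 iQ; rewrite !indicE; congr ((_ : bool)%:R); apply/idP/idP; rewrite !inE Ainv.
have mb r : measurable ([set x | pos q k x = r] : set (odo q)) by exact: measurable_posP.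
have -> : mu A = \int[mu]_x (\1_A x)%:E by rewrite integral_indic// setIT.
rewrite -(@integral_block k (fun x => (\1_A x)%:E))//; last first.
  by move=> x i x0 iQ; rewrite i1.
rewrite integral_indic// -(iter_preserving p); last exact: measurableI.
congr (mu _); apply/seteqP; split => x /=; rewrite pos_iter//.
- move=> [Ax xp].
  suff x0 : pos q k x = 0%N by split => //; move/Ainv: Ax; exact.
  have xQ := pos_lt q_gt0 k x.
  have [lt|ge] := ltnP (pos q k x + p)%N (Q k).
    by rewrite modn_small// in xp; lia.
  suff: ((pos q k x + p) %% Q k = pos q k x + p - Q k)%N by lia.
  by rewrite -{1}(subnK ge) modnDr modn_small//; lia.
- by move=> [Ax x0]; rewrite x0 add0n modn_small//; split => //; apply/Ainv.
Qed.

(** By [measure_block] an invariant set is independent of every cylinder, so [mu] restricted to [A]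
    and [mu A] times [mu] are the same measure. Evaluated at [A] this says that [mu A] equals its
    square. *)
Lemma tau_ergodic (A : set (odo q)) : measurable A -> tauq @^-1` A = A ->
  mu A = 0 \/ mu (~` A) = 0.
Proof.
move=> mA Ainv.
have Ai x i : A (iter i (tau q) x) <-> A x.
  by elim: i => // i IH; rewrite iterS -IH -[X in _ <-> X _]Ainv.
have fA : mu A \is a fin_num by exact: fin_num_measure.
pose nu := mrestr mu mA : {measure set (odo q) -> \bar R}.
pose r := fine (mu A).
have r0 : (0 <= r)%R by rewrite fine_ge0.
pose nu' := mscale (NngNum r0) mu : {measure set (odo q) -> \bar R}.
have h k p : nu [set x | pos q k x = p] = nu' [set x | pos q k x = p].
  rewrite /nu /nu' /= /mrestr /mscale/= /r.
  have [pQ|Qp] := ltnP p (Q k).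
    rewrite /mrestr /mscale/= setIC measure_block// mu_cyl// fineK//.
    by rewrite muleC.
  rewrite (_ : [set x | _] = set0) ?set0I ?measure0 ?mule0//.
  by apply/seteqP; split => x //= xp; have := pos_lt q_gt0 k x; lia.
have := @odo_measure_unique nu nu' h _ A mA.
have -> : nu A = r%:E by rewrite /nu/= /mrestr/= setIid fineK.
have -> : nu' A = (r * r)%:E by rewrite /nu'/= /mscale/= EFinM fineK.
have -> : nu setT = r%:E by rewrite /nu/= /mrestr/= setTI fineK.
move=> /(_ (ltry _)).
move=> [] /eqP; rewrite -subr_eq0 -{1}[r]mulr1 -mulrBr mulf_eq0 => /orP[/eqP r0'|].
  by left; rewrite -(fineK fA) -/r r0'.
rewrite subr_eq0 => /eqP r1; right.
by rewrite probability_setC// -(fineK fA) -/r -r1 subee.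
Qed.

Definition cyl_approx (h : odo q -> R) := forall e : R, (0 < e)%R ->
  exists k (r : nat -> R), \int[mu]_x `|h x - r (pos q k x)|%:E <= e%:E.

Lemma measurable_pos_comp k (r : nat -> R) :
  measurable_fun [set: odo q] (fun x => r (pos q k x)).
Proof. by apply: dm_measurable; exact: (dm_comp r (dm_pos k)). Qed.

Lemma integral_triangle (f g h : odo q -> R) (a b : R) :
  measurable_fun [set: odo q] f -> measurable_fun [set: odo q] g ->
  measurable_fun [set: odo q] h ->
  (forall x, `|h x| <= `|f x| + `|g x|)%R ->
  \int[mu]_x `|f x|%:E <= a%:E -> \int[mu]_x `|g x|%:E <= b%:E ->
  \int[mu]_x `|h x|%:E <= (a + b)%:E.
Proof.
move=> mf mg mh le fa gb; rewrite EFinD; apply: le_trans (leeD fa gb).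
have mE (u : odo q -> R) : measurable_fun [set: odo q] u ->
    measurable_fun [set: odo q] (fun x => `|u x|%:E).
  by move=> mu'; apply/measurable_EFinP; exact: measurableT_comp.
rewrite -ge0_integralD//; [|exact: mE..].
apply: ge0_le_integral => //.
- exact: mE.
- by apply: emeasurable_funD; exact: mE.
- by move=> x _; rewrite -EFinD lee_fin.
Qed.

Lemma cyl_approxD (f g : odo q -> R) :
  measurable_fun [set: odo q] f -> measurable_fun [set: odo q] g ->
  cyl_approx f -> cyl_approx g -> cyl_approx (fun x => f x + g x)%R.
Proof.
move=> mf mg hf hg e e0.
have e20 : (0 < e / 2)%R by rewrite divr_gt0.
have [k1 [r1 h1]] := hf _ e20; have [k2 [r2 h2]] := hg _ e20.
exists (maxn k1 k2), (fun p => r1 (p %% Q k1)%N + r2 (p %% Q k2)%N)%R.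
rewrite [e]splitr; apply: integral_triangle h1 h2.
- by apply: measurable_funB => //; exact: measurable_pos_comp.
- by apply: measurable_funB => //; exact: measurable_pos_comp.
- apply: measurable_funB; first exact: measurable_funD.
  exact: (measurable_pos_comp (maxn k1 k2) (fun p => r1 (p %% Q k1)%N + r2 (p %% Q k2)%N)%R).
- move=> x; rewrite !pos_mod ?leq_maxl ?leq_maxr// opprD addrACA.
  exact: ler_normD.
Qed.

Lemma cyl_approxZ (a : R) (f : odo q -> R) : measurable_fun [set: odo q] f ->
  cyl_approx f -> cyl_approx (fun x => a * f x)%R.
Proof.
move=> mf hf e e0.
have a1 : (0 < `|a| + 1)%R by rewrite ltr_wpDl.
have [|k [r h]] := hf (e / (`|a| + 1))%R; first by rewrite divr_gt0.
exists k, (fun p => a * r p)%R.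
under eq_integral do rewrite -mulrBr normrM EFinM.
rewrite ge0_integralZl_EFin//; last first.
  apply/measurable_EFinP; apply: measurableT_comp => //.
  by apply: measurable_funB => //; exact: measurable_pos_comp.
apply: (@le_trans _ _ (`|a|%:E * (e / (`|a| + 1))%:E)).
  by apply: lee_wpmul2l => //; rewrite lee_fin.
rewrite -EFinM lee_fin mulrA ler_pdivrMr// mulrC ler_pM2l//.
by rewrite lerDl.
Qed.

Lemma cyl_approx_lim (f : odo q -> R) : measurable_fun [set: odo q] f ->
  (forall e : R, (0 < e)%R -> exists g : odo q -> R,
    [/\ measurable_fun [set: odo q] g, cyl_approx g &
        \int[mu]_x `|f x - g x|%:E <= e%:E]) -> cyl_approx f.
Proof.
move=> mf hf e e0.
have e20 : (0 < e / 2)%R by rewrite divr_gt0.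
have [g [mg hg fg]] := hf _ e20; have [k [r h]] := hg _ e20.
exists k, r; rewrite [e]splitr; apply: integral_triangle fg h.
- exact: measurable_funB.
- by apply: measurable_funB => //; exact: measurable_pos_comp.
- by apply: measurable_funB => //; exact: measurable_pos_comp.
- by move=> x; rewrite (le_trans _ (ler_normD _ _))// addrA subrK.
Qed.

Lemma eq_cyl_approx (f g : odo q -> R) : f =1 g -> cyl_approx f -> cyl_approx g.
Proof. by move=> /funext ->. Qed.

(** The sets with approximable indicator form a Dynkin system containing the cylinders, which are
    closed under intersection. *)
Lemma cyl_approx_indic (A : set (odo q)) : measurable A -> cyl_approx (\1_A).
Proof.
have mI (B : set (odo q)) : measurable B -> measurable_fun [set: odo q] (\1_B : odo q -> R).
  by move=> mB; exact: measurable_indic.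
have cyl_cst (a : R) : cyl_approx (fun=> a).
  move=> e e0; exists 0%N, (fun=> a); under eq_integral do rewrite subrr normr0.
  by rewrite integral0 lee_fin ltW.
rewrite /measurable/= -(setI_closed_g_dynkin_g_sigma_algebra (cyl_setI q_gt0)).
pose H := [set A : set (odo q) | measurable A /\ cyl_approx (\1_A)].
suff: <<d cyl q >> `<=` H by move=> h /h[].
apply: smallest_sub; last first.
  move=> B cB; split; first exact: sub_sigma_algebra.
  case: cB => [->|[k [p ->]]].
    by apply: eq_cyl_approx (cyl_cst 0%R) => x; rewrite indic0.
  move=> e e0; exists k, (fun r => (r == p)%:R)%R.
  rewrite (eq_integral (fun=> 0)) ?integral0 ?lee_fin ?ltW// => x _.
  rewrite indicE (_ : (x \in _) = (pos q k x == p)) ?subrr ?normr0//.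
  by apply/idP/eqP; rewrite inE.
split.
- by split; [exact: measurableT|apply: eq_cyl_approx (cyl_cst 1%R) => x; rewrite indicT].
- move=> B [mB hB]; split; first exact: measurableC.
  apply: (@eq_cyl_approx (fun x => 1 + (-1) * \1_B x)%R).
    by move=> x; rewrite !indicE in_setC; case: (x \in B); rewrite /= ?mulr1 ?mulr0 ?subrr ?addr0.
  apply: cyl_approxD => //; first by apply: measurable_funM => //; exact: mI.
  by apply: cyl_approxZ => //; exact: mI.
- move=> F0 tF HF; pose F : nat -> set (odo q) := F0.
  have mF n : measurable (F n) by case: (HF n).
  have mU : measurable (\bigcup_n F n) by exact: bigcupT_measurable.
  rewrite -/F in tF HF *; split => //; apply: cyl_approx_lim; first exact: mI.
  move=> e e0; pose G n := \big[setU/set0]_(i < n) F i.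
  have mG n : measurable (G n) by exact: bigsetU_measurable.
  have hG n : cyl_approx (\1_(G n)).
    elim: n => [|n IH].
      by apply: eq_cyl_approx (cyl_cst 0%R) => x; rewrite /G big_ord0 indic0.
    apply: (@eq_cyl_approx (fun x => \1_(G n) x + \1_(F n) x)%R).
      move=> x; rewrite /G big_ord_recr/= -/(G n) !indicE in_setU.
      have [/set_mem|] := boolP (x \in G n); have [/set_mem|] := boolP (x \in F n); rewrite ?addr0 ?add0r//.
      move=> Fx; rewrite /G -bigcup_mkord => -[i/= ni Fi].
      have ei : i = n by apply: tF => //; exists x.
      by rewrite ei ltnn in ni.
    by apply: cyl_approxD; [exact: mI|exact: mI|by []|by case: (HF n)].
  have cvG : mu (G n) @[n --> \oo] --> mu (\bigcup_n F n).
    have eU : \bigcup_n F n = \bigcup_n G n.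
      apply/seteqP; split => [x [n _ Fx]|x [n _]].
        by exists n.+1 => //; rewrite /G big_ord_recr/=; right.
      exact: bigsetU_bigcup.
    rewrite eU; apply: nondecreasing_cvg_mu.
    - by move=> n; exact: mG.
    - by rewrite -eU.
    - by move=> n m nm; apply/subsetPset; exact: subset_bigsetU.
  have fU : mu (\bigcup_n F n) \is a fin_num by exact: fin_num_measure.
  have [n hn] : exists n, mu (\bigcup_n F n) - mu (G n) <= e%:E.
    have /fine_cvgP[_ /cvgrPdist_le/(_ _ e0)[n _ /(_ n (leqnn n))/=]] : mu (G n) @[n --> \oo] --> (fine (mu (\bigcup_n F n)))%:E by rewrite fineK.
    move=> hn; exists n; have fG : mu (G n) \is a fin_num by exact: fin_num_measure.
    rewrite -(fineK fU) -(fineK fG) -EFinB lee_fin.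
    exact: le_trans (ler_norm _) hn.
  exists (\1_(G n)); split; [exact: mI|exact: hG|].
  have sG : G n `<=` \bigcup_n F n by exact: bigsetU_bigcup.
  rewrite -[X in _ - mu X](setIidr sG) -measureD// in hn; last by rewrite ltey_eq fU.
  apply: le_trans hn.
  rewrite -[X in _ <= mu X]setIT -integral_indic//; last exact: measurableD.
  rewrite le_eqVlt; apply/orP; left; apply/eqP; apply: eq_integral => x _.
  congr EFin; rewrite !indicE in_setD.
  have [/set_mem/sG Gx|_] := boolP (x \in G n).
    by rewrite (mem_set Gx)/= subrr normr0.
  by rewrite andbT subr0 ger0_norm.
Qed.

Import HBNNSimple.

Lemma cyl_approx_fun (h : odo q -> \bar R) : measurable_fun [set: odo q] h ->
  (forall x, 0 <= h x) -> \int[mu]_x h x < +oo ->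
  forall e : R, (0 < e)%R -> exists k (r : nat -> R), (forall p, 0 <= r p)%R /\
    \int[mu]_x `|h x - (r (pos q k x))%:E| <= e%:E.
Proof.
move=> mh h0 hoo e e0.
have e20 : (0 < e / 2)%R by rewrite divr_gt0.
pose f := nnsfun_approx measurableT mh.
have mf n : measurable_fun [set: odo q] (f n) by exact: measurable_funPT.
have mEf n : measurable_fun [set: odo q] (EFin \o f n) by exact/measurable_EFinP.
have fh n x : (f n x)%:E <= h x.
  have := cvg_nnsfun_approx measurableT mh (fun x _ => h0 x) (Logic.I : setT x).
  move=> c; rewrite -(cvg_lim _ c)//; apply: lime_ge; first by apply/cvg_ex; exists (h x).
  exists n => // m /= nm; rewrite lee_fin.
  by have /lefP := @nd_nnsfun_approx _ _ _ _ measurableT _ mh n m nm; exact.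
have cvf : \int[mu]_x (f n x)%:E @[n --> \oo] --> \int[mu]_x h x.
  have -> : \int[mu]_x h x = \int[mu]_x limn (fun n => (f n x)%:E).
    apply: eq_integral => x _; apply/esym/cvg_lim => //.
    exact: (cvg_nnsfun_approx measurableT mh (fun x _ => h0 x)).
  apply: cvg_monotone_convergence => //.
  - by move=> n x _; rewrite lee_fin.
  - move=> x _ m n mn; rewrite lee_fin.
    by have /lefP := @nd_nnsfun_approx _ _ _ _ measurableT _ mh m n mn; exact.
have fin_h : \int[mu]_x h x \is a fin_num by rewrite ge0_fin_numE// integral_ge0.
have le_fh n : \int[mu]_x (f n x)%:E <= \int[mu]_x h x.
  apply: ge0_le_integral => //.
  - by move=> x _; rewrite lee_fin.
  - exact: mEf.
have fin_f n : \int[mu]_x (f n x)%:E \is a fin_num.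
  rewrite ge0_fin_numE; last by apply: integral_ge0 => x _; rewrite lee_fin.
  exact: le_lt_trans hoo.
have [n hn] : exists n, \int[mu]_x h x - \int[mu]_x (f n x)%:E <= (e / 2)%:E.
  have /fine_cvgP[_ /cvgrPdist_le/(_ _ e20)[n _ /(_ n (leqnn n))/=]] :
    \int[mu]_x (f n x)%:E @[n --> \oo] --> (fine (\int[mu]_x h x))%:E by rewrite fineK.
  move=> hn; exists n; rewrite -(fineK fin_h) -(fineK (fin_f n)) -EFinB lee_fin.
  exact: le_trans (ler_norm _) hn.
have caf : cyl_approx (f n).
  pose s := finmap.enum_fset (fset_set (range (f n))).
  apply: (@eq_cyl_approx (fun x : odo q => \sum_(y <- s) y * \1_(f n @^-1` [set y]) x)%R (f n : odo q -> R)).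
    by move=> x; rewrite [RHS]fimfunE fsbig_finite.
  elim: s => [|y t IH].
    move=> e' e'0; exists 0%N, (fun=> 0%R).
    under eq_integral do rewrite big_nil subrr normr0.
    by rewrite integral0 lee_fin ltW.
  have mi z : measurable_fun [set: odo q] (\1_(f n @^-1` [set z]) : odo q -> R).
    by apply: measurable_indic; exact: measurable_funPTI.
  apply: (@eq_cyl_approx (fun x => y * \1_(f n @^-1` [set y]) x +
      \sum_(y <- t) y * \1_(f n @^-1` [set y]) x)%R).
    by move=> x; rewrite big_cons.
  apply: cyl_approxD => //.
  - by apply: measurable_funM => //; exact: mi.
  - by apply: measurable_sum => z; apply: measurable_funM => //; exact: mi.
  - apply: cyl_approxZ; first exact: mi.
    by apply: cyl_approx_indic; exact: measurable_funPTI.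
(* As [f n] is nonnegative, passing to the absolute value of [r'] does not increase the distance. *)
have [k [r' hr']] := caf _ e20; pose r p := `|r' p|%R.
exists k, r; split; first by move=> p; exact: normr_ge0.
have mr' := measurable_pos_comp k r'; have mr := measurable_pos_comp k r.
have hr : \int[mu]_x (`|f n x - r (pos q k x)|)%:E <= (e / 2)%:E.
  apply: le_trans hr'; apply: ge0_le_integral => //.
  - by apply/measurable_EFinP; apply: measurableT_comp => //; exact: measurable_funB.
  - by apply/measurable_EFinP; apply: measurableT_comp => //; exact: measurable_funB.
  - by move=> x _; rewrite lee_fin /r -{1}(ger0_norm (_ : 0 <= f n x)%R)// ler_dist_dist.
have mhr : measurable_fun [set: odo q] (fun x => `|h x - (r (pos q k x))%:E|).
  apply: measurableT_comp => //; apply: emeasurable_funB => //.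
  exact/measurable_EFinP.
have mhf : measurable_fun [set: odo q] (fun x => h x - (f n x)%:E).
  by apply: emeasurable_funB => //; exact: mEf.
have mfr : measurable_fun [set: odo q] (fun x => (`|f n x - r (pos q k x)|)%:E).
  by apply/measurable_EFinP; apply: measurableT_comp => //; exact: measurable_funB.
apply: (@le_trans _ _ (\int[mu]_x ((h x - (f n x)%:E) + (`|f n x - r (pos q k x)|)%:E))).
  apply: ge0_le_integral => //.
  - exact: emeasurable_funD.
  - move=> x _; have := fh n x; have := h0 x; case: (h x) => [a| |]//= _.
    rewrite !lee_fin => fa; rewrite -(ger0_norm (_ : 0 <= a - f n x)%R) ?subr_ge0//.
    by rewrite (le_trans _ (ler_normD _ _))// addrA subrK.
rewrite ge0_integralD//; last first.
  by move=> x _; rewrite sube_ge0// fh.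
rewrite [e]splitr EFinD leeD//; apply: le_trans hn.
rewrite integralB ?lexx//; apply/integrableP; split => //.
  by under eq_integral do rewrite gee0_abs//.
  exact: mEf.
under eq_integral do rewrite gee0_abs ?lee_fin//.
exact: le_lt_trans hoo.
Qed.

(** Complete periods contribute exactly their mean. What remains is the incomplete last period and
    its share of the mean, each at most [M * (Q k)%:R]. *)
Lemma sumr_mod_bound k (r : nat -> R) s N (M : R) : (0 <= M)%R ->
  (forall p, (p < Q k)%N -> `|r p| <= M)%R ->
  (`|\sum_(0 <= i < N) r ((s + i) %% Q k)%N -
     (\sum_(0 <= p < Q k) r p) / (Q k)%:R * N%:R| <= M * (Q k)%:R + M * (Q k)%:R)%R.
Proof.
move=> M0 rM; have Q0 := Qn_gt0 q_gt0 k.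
have Q0R : (0 < (Q k)%:R :> R)%R by rewrite ltr0n.
have bQ : (N %% Q k < Q k)%N by rewrite ltn_pmod.
have sumM (t b : nat) : (`|\sum_(0 <= i < b) r ((t + i) %% Q k)%N| <= M * b%:R)%R.
  apply: (le_trans (ler_norm_sum _ _ _)).
  apply: (@le_trans _ _ (\sum_(0 <= i < b) M)%R).
    by apply: ler_sum => i _; apply: rM; rewrite ltn_pmod.
  by rewrite sumr_const_nat subn0 mulr_natr.
rewrite {1 2}(divn_eq N (Q k)) (@big_cat_nat _ _ _ (N %/ Q k * Q k)) ?leq_addr//=.
rewrite sumr_mod_mul (sumr_nat_shift _ (N %/ Q k * Q k) (N %% Q k)).
set S := (\sum_(0 <= d < Q k) r d)%R.
have -> : (S / (Q k)%:R * (N %/ Q k * Q k + N %% Q k)%:R =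
    S *+ (N %/ Q k) + S / (Q k)%:R * (N %% Q k)%:R :> R)%R.
  rewrite natrD natrM mulrDr; congr (_ + _)%R.
  by rewrite mulrCA -mulrA mulVf ?lt0r_neq0// mulr1 mulr_natl.
rewrite opprD addrACA subrr add0r.
apply: (le_trans (ler_normB _ _)); apply: lerD.
  rewrite (eq_bigr (fun i => r (((N %/ Q k * Q k + s) + i) %% Q k)%N)); last by move=> i _; congr (r (_ %% _)%N); lia.
  apply: (le_trans (sumM _ _)); rewrite ler_wpM2l// ler_nat; exact: ltnW.
have SM : (`|S| <= M * (Q k)%:R)%R.
  have -> : S = (\sum_(0 <= i < Q k) r ((0 + i) %% Q k)%N)%R.
    by rewrite /S !big_nat; apply: eq_bigr => i /andP[_ iQ]; rewrite add0n modn_small.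
  exact: sumM.
rewrite normrM normrM (ger0_norm (_ : 0 <= (Q k)%:R^-1)%R) ?invr_ge0// (ger0_norm (_ : 0 <= (N %% Q k)%:R)%R)//.
apply: ler_pM => //; last by rewrite ler_nat ltnW.
by rewrite ler_pdivrMr.
Qed.

Lemma integral_pos k (r : nat -> R) : (forall p, 0 <= r p)%R ->
  \int[mu]_x (r (pos q k x))%:E = ((\sum_(0 <= p < Q k) r p) / (Q k)%:R)%:E.
Proof.
move=> r0; have Q0 := Qn_gt0 q_gt0 k.
rewrite (integral_unfold k); last 2 first.
- by apply/measurable_EFinP; exact: measurable_pos_comp.
- by move=> x; rewrite lee_fin.
rewrite (eq_integral (cst (\sum_(0 <= p < Q k) r p)%:E)); last first.
  move=> x /[!inE]/= x0; rewrite sumEFin; congr EFin.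
  rewrite !big_nat; apply: eq_bigr => p /andP[_ pQ].
  by rewrite pos_iter// x0 add0n modn_small.
rewrite integral_cst; last exact: measurable_posP.
by rewrite EFinM; congr (_ * _); exact: mu_cyl.
Qed.

(** Approximate [h] in L^1 by a function of the position, whose sums are controlled at every point.
    The sum of the approximation error up to [L] is bounded by Markov's inequality; since it
    dominates the shorter sums, one exceptional set serves all [N <= L]. This matters because [N]
    will depend on the point through its type. *)
Lemma mean_ergodic (h : odo q -> \bar R) (c : R) :
  measurable_fun [set: odo q] h -> (forall x, 0 <= h x) ->
  \int[mu]_x h x = c%:E -> forall e d : R, (0 < e)%R -> (0 < d)%R ->
  exists L0 : nat, forall L, (L0 <= L)%N -> exists E : set (odo q),
    [/\ measurable E, mu E <= d%:E & forall x, ~ E x -> forall N, (N <= L)%N ->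
      (c * N%:R - e * L%:R)%:E <= \sum_(0 <= i < N) h (iter i (tau q) x) <=
      (c * N%:R + e * L%:R)%:E].
Proof.
move=> mh h0 hc e d e0 d0.
(* The first bound is for Markov's inequality at height [e * L / 4], the second for the difference
   of the two means. *)
pose e1 := Num.min (e * d / 4)%R (e / 4)%R.
have e10 : (0 < e1)%R by rewrite lt_min !divr_gt0// mulr_gt0.
have [|k [r [r0 hr]]] := cyl_approx_fun mh h0 _ e10; first by rewrite hc ltry.
have Q0 := Qn_gt0 q_gt0 k.
pose M : R := (\sum_(0 <= p < Q k) r p)%R.
have M0 : (0 <= M)%R by exact: sumr_ge0.
have rM p : (p < Q k)%N -> (`|r p| <= M)%R.
  move=> pQ; rewrite /M ger0_norm// big_mkord (bigD1 (Ordinal pQ))//= lerDl.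
  exact: sumr_ge0.
pose K : R := (M * (Q k)%:R + M * (Q k)%:R)%R.
have K0 : (0 <= K)%R by rewrite addr_ge0// mulr_ge0.
pose rb := ((\sum_(0 <= p < Q k) r p) / (Q k)%:R)%R.
pose g x := `|h x - (r (pos q k x))%:E|.
have mr : measurable_fun [set: odo q] (fun x => (r (pos q k x))%:E).
  by apply/measurable_EFinP; exact: measurable_pos_comp.
have mg : measurable_fun [set: odo q] g.
  by apply: measurableT_comp => //; exact: emeasurable_funB.
have g0 x : 0 <= g x by exact: abse_ge0.
have hg x : h x <= (r (pos q k x))%:E + g x by case: (ge0_le_abs_dist (r (pos q k x)) (h0 x)).
have gh x : (r (pos q k x))%:E <= h x + g x by case: (ge0_le_abs_dist (r (pos q k x)) (h0 x)).
have rb1 : (rb <= c + e1)%R.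
  rewrite -lee_fin -(integral_pos k r0) EFinD -hc; apply: (le_trans _ (leeD2l _ hr)).
  rewrite -ge0_integralD//; apply: ge0_le_integral => //.
  - by move=> x _; rewrite lee_fin.
  - exact: emeasurable_funD.
  - by move=> x _; exact: gh.
have rb2 : (c <= rb + e1)%R.
  rewrite -lee_fin -hc EFinD -(integral_pos k r0); apply: (le_trans _ (leeD2l _ hr)).
  rewrite -ge0_integralD//; last by move=> x _; rewrite lee_fin.
  by apply: ge0_le_integral => //; [exact: emeasurable_funD|move=> x _; exact: hg].
pose L0 := (Num.truncn (4 * K / e)).+1.
exists L0 => L L0L.
have KL : (K <= e * L%:R / 4)%R.
  have : (4 * K / e <= L%:R)%R.
    by rewrite (le_trans (ltW (truncnS_gt _)))// ler_nat.
  by rewrite ler_pdivrMr// => ?; rewrite ler_pdivlMr//; lra.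
have L0R : (0 < L%:R :> R)%R by rewrite ltr0n (leq_trans _ L0L).
pose gL x := \sum_(0 <= i < L) g (iter i (tau q) x).
have mgi i : measurable_fun [set: odo q] (fun x => g (iter i (tau q) x)).
  by apply: (measurableT_comp mg); exact: measurable_iter_tau.
have mgL : measurable_fun [set: odo q] gL by exact: emeasurable_sum.
have gL0 x : 0 <= gL x by exact: sume_ge0.
have eL : (0 < e * L%:R / 4)%R by rewrite divr_gt0// mulr_gt0.
have igL : \int[mu]_x gL x = (L%:R * fine (\int[mu]_x g x))%:E.
  have gfin : \int[mu]_x g x \is a fin_num.
    by rewrite ge0_fin_numE ?integral_ge0// (le_lt_trans hr)// ltry.
  rewrite /gL ge0_integral_sum// (eq_bigr (fun=> \int[mu]_x g x)); last first.
    by move=> i _; rewrite (integral_iter i measurableT mg g0) preimage_setT.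
  by rewrite EFinM fineK// sumr_const_nat subn0 mule_natl.
have [|mE Ed] := ge0_markov (e := d) mgL gL0 igL eL.
  have : (fine (\int[mu]_x g x) <= e1)%R.
    by rewrite -lee_fin fineK// ge0_fin_numE ?integral_ge0// (le_lt_trans hr)// ltry.
  have : (e1 <= e * d / 4)%R by rewrite ge_min lexx.
  by move: L0R; set z := fine _; nra.
exists [set x | (e * L%:R / 4)%:E < gL x]; split => // x /negP; rewrite -leNgt => gx N NL.
  have gN : \sum_(0 <= i < N) g (iter i (tau q) x) <= (e * L%:R / 4)%:E.
    apply: (le_trans _ gx); rewrite /gL [leRHS](@big_cat_nat _ _ _ N)//= leeDl//.
    exact: sume_ge0.
  have rN := sumr_mod_bound (pos q k x) N M0 rM; rewrite -/rb -/K in rN.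
  set sN := (\sum_(0 <= i < N) r ((pos q k x + i) %% Q k)%N)%R in rN.
  have sNE : sN%:E = \sum_(0 <= i < N) (r (pos q k (iter i (tau q) x)))%:E.
    by rewrite -sumEFin; apply: eq_bigr => i _; rewrite pos_iter.
  have up : \sum_(0 <= i < N) h (iter i (tau q) x) <= sN%:E + (e * L%:R / 4)%:E.
    apply: (le_trans _ (leeD2l _ gN)); rewrite sNE -big_split/=.
    by apply: lee_sum => i _; exact: hg.
  have lo : sN%:E <= \sum_(0 <= i < N) h (iter i (tau q) x) + (e * L%:R / 4)%:E.
    apply: (le_trans _ (leeD2l _ gN)); rewrite sNE -big_split/=.
    by apply: lee_sum => i _; exact: gh.
  have NLR : (N%:R <= L%:R :> R)%R by rewrite ler_nat.
  have N0R : (0 <= N%:R :> R)%R by [].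
  have e14 : (e1 <= e / 4)%R by rewrite ge_min lexx orbT.
  have e1N : (e1 * N%:R <= e * L%:R / 4)%R.
    by rewrite mulrAC; apply: ler_pM => //; exact: ltW.
  have rb1N : (rb * N%:R <= c * N%:R + e1 * N%:R)%R by rewrite -mulrDl ler_wpM2r.
  have rb2N : (c * N%:R <= rb * N%:R + e1 * N%:R)%R by rewrite -mulrDl ler_wpM2r.
  move: rN; rewrite ler_distl => /andP[r1 r2].
  apply/andP; split.
    rewrite -(leeD2rE _ _ (_ : (e * L%:R / 4)%:E \is a fin_num))//.
    by apply: le_trans lo; rewrite -EFinD lee_fin; lra.
  by apply: (le_trans up); rewrite -EFinD lee_fin; lra.
Qed.

End odometer_theory.

(** * Skyscrapers *)

Section tower.
Context d (Om : measurableType d) (R : realType) (mu : probability Om R).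
Context (t : Om -> Om) (phi : Om -> nat).
Hypothesis mt : measurable_fun [set: Om] t.
Hypothesis mu_t : forall A, measurable A -> mu (t @^-1` A) = mu A.
Hypothesis t_erg : forall A, measurable A -> t @^-1` A = A -> mu A = 0%E \/ mu (~` A) = 0%E.
Hypothesis mphi : forall V : set nat, measurable (phi @^-1` V).
Hypothesis phi_gt0 : forall x, (0 < phi x)%N.

Local Notation X := (Om * nat)%type.
Implicit Types (A : set X) (x : Om).

Definition tow_map (u : X) : X :=
  if (u.2.+1 < phi u.1)%N then (u.1, u.2.+1) else (t u.1, 0%N).

Lemma measurable_section j A : measurable A -> measurable [set x | A (x, j)].
Proof.
move=> mA; rewrite -[X in measurable X]setTI.
exact: (measurable_pair2 j measurableT mA).
Qed.

Lemma measurable_sections A : (forall j, measurable [set x | A (x, j)]) -> measurable A.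
Proof.
move=> mA; have -> : A = \bigcup_j ([set x | A (x, j)] `*` [set j]).
  apply/seteqP; split => [[x j] Axj|[x j] [i _ [/= Axi ->]]//].
  by exists j.
by apply: bigcupT_measurable => j; exact: measurableX.
Qed.

(* The skyscraper is carried by the whole product [Om * nat], but its measure only
   charges the points [(x, j)] with [j < phi x]. *)
Definition lev j A : \bar R := mu ([set x | (j < phi x)%N] `&` [set x | A (x, j)]).

Let mlev j A : measurable A -> measurable ([set x | (j < phi x)%N] `&` [set x | A (x, j)]).
Proof.
move=> mA; apply: measurableI; last exact: measurable_section.
exact: (mphi [set n | (j < n)%N]).
Qed.

Let lev0 j : lev j set0 = 0%E.
Proof. by rewrite /lev setI0 measure0. Qed.

Let lev_ge0 j A : (0 <= lev j A)%E.
Proof. exact: measure_ge0. Qed.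

Let lev_sigma_additive j : semi_sigma_additive (lev j).
Proof.
move=> F mF tF mUF; rewrite /lev.
have -> : [set x | (\bigcup_n F n) (x, j)] = \bigcup_n [set x | F n (x, j)].
  by apply/seteqP; split => x [n _ Fn]; exists n.
rewrite setI_bigcupr; apply: measure_semi_sigma_additive.
- by move=> n; exact: mlev.
- move=> n m _ _ [x [[_ Fn] [_ Fm]]]; apply: tF => //; by exists (x, j).
- by apply: (@bigcupT_measurable _ Om) => n; exact: mlev.
Qed.

HB.instance Definition _ j := isMeasure.Build _ _ _ (lev j)
  (lev0 j) (@lev_ge0 j) (@lev_sigma_additive j).

Definition tow_measure := mseries lev 0.

HB.instance Definition _ := Measure.on tow_measure.

Local Open Scope ereal_scope.

Lemma tow_measureE A : tow_measure A = \sum_(j <oo) lev j A.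
Proof. by []. Qed.

Lemma lev_le1 j A : measurable A -> lev j A <= 1.
Proof. by move=> mA; apply: probability_le1; exact: mlev. Qed.

Lemma tow_measure_base A : measurable A -> (forall x j, A (x, j) -> j = 0%N) ->
  tow_measure A = mu [set x | A (x, 0%N)].
Proof.
move=> mA A0; rewrite tow_measureE nneseries_recl//.
rewrite eseries0 ?adde0; last first.
  move=> j j0 _; rewrite /lev (_ : _ `&` _ = set0) ?measure0//.
  by rewrite -subset0 => x [_ /= /A0 j0']; rewrite j0' in j0.
by congr (mu _); apply/seteqP; split => x /=; [case|split].
Qed.

Lemma tow_sigma_finite : sigma_finite setT tow_measure.
Proof.
exists (fun n => [set u : X | (u.2 < n)%N]).
  by apply/seteqP; split => [[x j] _|//]; exists j.+1 => /=.
move=> n; have mn : measurable [set u : X | (u.2 < n)%N].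
  apply: measurable_sections => j /=; case: (ltnP j n) => jn.
    by rewrite (_ : [set x | _] = setT)//; apply/seteqP; split.
  by rewrite (_ : [set x | _] = set0)//; apply/seteqP; split.
split => //; rewrite tow_measureE (nneseries_split 0 n)// add0n.
rewrite eseries0 ?adde0; last first.
  move=> j /= nj _; rewrite /lev (_ : _ `&` _ = set0) ?measure0//.
  by rewrite -subset0 => x [_ /=]; rewrite ltnNge nj.
apply: (@le_lt_trans _ _ (\sum_(0 <= j < n) 1%E)); last by rewrite sumEFin ltry.
by apply: lee_sum => j _; exact: lev_le1.
Qed.

HB.instance Definition _ :=
  @Measure_isSigmaFinite.Build _ _ _ tow_measure tow_sigma_finite.

Lemma measurable_tow_map : measurable_fun [set: X] tow_map.
Proof.
move=> _ A mA; rewrite setTI; apply: measurable_sections => j.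
rewrite (_ : [set x | _] = ([set x | (j.+1 < phi x)%N] `&` [set x | A (x, j.+1)]) `|`
   ([set x | (phi x <= j.+1)%N] `&` (t @^-1` [set x | A (x, 0%N)]))).
  apply: measurableU; apply: measurableI.
  - exact: (mphi [set n | (j.+1 < n)%N]).
  - exact: measurable_section.
  - exact: (mphi [set n | (n <= j.+1)%N]).
  - by rewrite -[X in measurable X]setTI; apply: mt => //; exact: measurable_section.
apply/seteqP; split => x; rewrite /= /tow_map/=; case: ltnP => h.
- by left.
- by right.
- by case=> [[]|[]]//; rewrite leqNgt h.
- by case=> [[]|[]].
Qed.

(** The preimage of [A] at level [j] consists of points climbing to level [j + 1] and points with
    return time [j + 1]. The former give all levels of [A] but the base; the latter add up to the
    base, since [t] preserves [mu]. *)
Lemma tow_preserving : measure_preserving tow_measure tow_map.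
Proof.
split; first exact: measurable_tow_map.
move=> A mA; rewrite [LHS]tow_measureE [RHS]tow_measureE.
have mA0 : measurable (t @^-1` [set x | A (x, 0%N)]).
  by rewrite -[X in measurable X]setTI; apply: mt => //; exact: measurable_section.
have mB j : measurable ([set x | phi x = j.+1] `&` t @^-1` [set x | A (x, 0%N)]).
  by apply: measurableI => //; exact: (mphi [set j.+1]).
rewrite (eq_eseriesr (g := fun j => lev j.+1 A +
    mu ([set x | phi x = j.+1] `&` t @^-1` [set x | A (x, 0%N)]))); last first.
  move=> j _; rewrite /lev -measureU//; last 2 first.
  - exact: mlev.
  - by rewrite -subset0 => x [[/= h _] [/= e _]]; rewrite e ltnn in h.
  congr (mu _); apply/seteqP; split => x; rewrite /= /tow_map/=.
    case: (ltnP j.+1 (phi x)) => h [h' Ax]; [by left|right; split => //].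
    by apply/eqP; rewrite eqn_leq h h'.
  by case=> [[h Ax]|[-> Ax]]; [rewrite h; split => //; exact: ltnW|rewrite ltnn].
rewrite nneseriesD// [RHS]nneseries_recl//.
rewrite addeC; congr (_ + _); last first.
  rewrite -[RHS]nneseries_addn//; apply: eq_eseriesr => j _.
  by rewrite addn1.
rewrite /lev (_ : [set x | (0 < phi x)%N] = setT) ?setTI; last first.
  by apply/seteqP; split => // x _; exact: phi_gt0.
rewrite -mu_t; last exact: measurable_section.
rewrite -measure_semi_bigcup//; last 2 first.
- by move=> i j _ _ [x [[/= -> _] [/= [->] _]]].
- by apply: bigcupT_measurable.
congr (mu _); apply/seteqP; split => [x [j _ []]//|x Ax].
by exists (phi x).-1 => //; split => //=; rewrite prednK.
Qed.

Definition tow_time N x : nat := (\sum_(0 <= i < N) phi (iter i t x))%N.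

Lemma tow_timeS N x : tow_time N.+1 x = (tow_time N x + phi (iter N t x))%N.
Proof. by rewrite /tow_time big_nat_recr. Qed.

Lemma leq_tow_time N x : (N <= tow_time N x)%N.
Proof. by elim: N => // N IH; rewrite tow_timeS -addn1 leq_add. Qed.

Lemma tow_timeD N j x : (tow_time N x + j <= tow_time (N + j) x)%N.
Proof.
elim: j => [|j IH]; first by rewrite !addn0.
by rewrite !addnS tow_timeS -addn1; exact: leq_add.
Qed.

Lemma iter_tow_level j x : (j < phi x)%N -> iter j tow_map (x, 0%N) = (x, j).
Proof.
elim: j => // j IH jx; rewrite iterS IH; last exact: ltnW.
by rewrite /tow_map/= jx.
Qed.

Lemma iter_tow_return x : iter (phi x) tow_map (x, 0%N) = (t x, 0%N).
Proof.
have := phi_gt0 x; case e : (phi x) => [//|n] _.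
by rewrite iterS iter_tow_level ?e// /tow_map/= e ltnn.
Qed.

Lemma iter_tow_time N x : iter (tow_time N x) tow_map (x, 0%N) = (iter N t x, 0%N).
Proof.
elim: N => [|N IH]; first by rewrite /tow_time big_geq.
by rewrite tow_timeS addnC iterD IH iter_tow_return.
Qed.

Lemma iter_tow_timeD N j x : (j < phi (iter N t x))%N ->
  iter (tow_time N x + j) tow_map (x, 0%N) = (iter N t x, j).
Proof. by move=> jN; rewrite addnC iterD iter_tow_time iter_tow_level. Qed.

(** A return of [t] to the level [j] of [W] is a return of the tower map to [W]. Hence each level of
    a wandering set has disjoint preimages under iterates of [t], of equal measure in a probability
    space, and is null. *)
Lemma tow_conservative : conservative tow_measure tow_map.
Proof.
move=> W [mW tW]; rewrite [LHS]tow_measureE eseries0// => j _ _.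
rewrite /lev; set D := _ `&` _.
have mD : measurable D by exact: mlev.
have mDi i : measurable (iter i t @^-1` D).
  elim: i => // i IH.
  rewrite (_ : _ @^-1` D = t @^-1` (iter i t @^-1` D)).
    by rewrite -[X in measurable X]setTI; exact: mt.
  by apply/seteqP; split => x; rewrite /preimage/= -iterS iterSr.
have muDi i : mu (iter i t @^-1` D) = mu D.
  elim: i => // i <-; rewrite -[RHS]mu_t//; congr (mu _).
  by apply/seteqP; split => x; rewrite /preimage/= -iterS iterSr.
have nret x i : (0 < i)%N -> D x -> ~ D (iter i t x).
  move=> i0 [/= jx Wx] [/= jix Wix].
  have e : iter (tow_time i x) tow_map (x, j) = (iter i t x, j).
    by rewrite -(iter_tow_level jx) -iterD iter_tow_timeD.
  have := leq_tow_time i x.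
  rewrite -(tW 0%N (tow_time i x))//; last by exists (x, j); split => //=; rewrite e.
  by rewrite leqNgt i0.
have tD : trivIset setT (fun i => iter i t @^-1` D).
  suff h i k x : (i < k)%N -> D (iter i t x) -> ~ D (iter k t x).
    move=> i k _ _ [x [Di Dk]].
    by case: (ltngtP i k) => // [/h/(_ Di)|/h/(_ Dk)].
  move=> ik Di; rewrite -(subnK (ltnW ik)) iterD; apply: nret => //.
  by rewrite subn_gt0.
have fD : mu D \is a fin_num by exact: fin_num_measure.
apply/eqP; rewrite -measure_le0 leNgt; apply/negP => D0.
have d0 : (0 < fine (mu D))%R by rewrite fine_gt0// D0 ltey_eq fD.
pose n := (Num.truncn (fine (mu D))^-1%R).+1.
have tDn : trivIset [set: 'I_n] (fun i : 'I_n => iter i t @^-1` D).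
  by move=> a b _ _ ab; apply: val_inj; exact: tD.
have : \sum_(i < n) mu (iter i t @^-1` D) <= 1.
  rewrite -(@measure_bigsetU_ord _ _ _ mu n xpredT)//.
  by apply: probability_le1; exact: bigsetU_measurable.
rewrite (eq_bigr (fun=> (fine (mu D))%:E)); last by move=> i _; rewrite muDi fineK.
rewrite sumEFin lee_fin sumr_const card_ord -mulr_natl.
rewrite -ler_pdivlMr// div1r leNgt => /negP; apply.
exact: truncnS_gt.
Qed.

(** Up to a null set an invariant set is determined by its base level, which is invariant under
    [t]. *)
Lemma tow_ergodic : ergodic tow_measure tow_map.
Proof.
have null A : measurable A -> tow_map @^-1` A = A -> mu [set x | A (x, 0%N)] = 0 ->
    tow_measure A = 0.
  move=> mA Ainv A0; rewrite tow_measureE eseries0// => j _ _.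
  apply/eqP; rewrite -measure_le0 -A0; apply: le_measure.
  - by rewrite inE; exact: mlev.
  - by rewrite inE; exact: measurable_section.
  - move=> x [/= jx]; rewrite -(iter_tow_level jx).
    have Ai u i : A (iter i tow_map u) <-> A u.
      by elim: i => // i IH; rewrite iterS -IH -[X in _ <-> X _]Ainv.
    by rewrite Ai.
move=> A mA Ainv; have mA0 : measurable [set x | A (x, 0%N)] by exact: measurable_section.
have Ai u i : A (iter i tow_map u) <-> A u.
  by elim: i => // i IH; rewrite iterS -IH -[X in _ <-> X _]Ainv.
case: (t_erg mA0).
- by apply/seteqP; split => x /=; rewrite -iter_tow_return Ai.
- by move=> A0; left; exact: null.
- move=> A0; right; apply: null => //; first exact: measurableC.
  by rewrite -[in RHS]Ainv.
Qed.

(** The function induced on the base: the sum of [f] over one excursion. *)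
Definition tow_fun (f : X -> \bar R) x := \sum_(0 <= j < phi x) f (x, j).

Section tower_sums.
Variables (f : X -> \bar R).
Hypothesis f0 : forall u, 0 <= f u.

Definition base_sum n x := \sum_(0 <= k < n) f (iter k tow_map (x, 0%N)).

Lemma base_sum_time N x :
  base_sum (tow_time N x) x = \sum_(0 <= i < N) tow_fun f (iter i t x).
Proof.
elim: N => [|N IH]; first by rewrite /base_sum /tow_time !big_geq.
rewrite [RHS]big_nat_recr//= -IH tow_timeS /base_sum.
rewrite (@big_cat_nat _ _ _ (tow_time N x)) ?leq_addr//=; congr (_ + _).
rewrite sumr_nat_shift /tow_fun !big_nat; apply: eq_bigr => j /andP[_ jN].
by rewrite iter_tow_timeD.
Qed.

Lemma base_sum_mono n n' x : (n <= n')%N -> base_sum n x <= base_sum n' x.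
Proof.
move=> nn'; rewrite /base_sum [leRHS](@big_cat_nat _ _ _ n)//= leeDl//.
exact: sume_ge0.
Qed.

(** Both sums follow the orbit of [(x, 0)]. As [ergodic_sum] starts strictly after [(x, j)], exactly
    [j.+1] terms precede it. *)
Lemma base_sum_ergodic_sum n x j : (j < phi x)%N ->
  base_sum (n + j).+1 x = base_sum j.+1 x + ergodic_sum tow_map f n (x, j).
Proof.
move=> jx; rewrite /base_sum (@big_cat_nat _ _ _ j.+1)//=; last by rewrite ltnS leq_addl.
congr (_ + _); rewrite /ergodic_sum.
rewrite -[(n + j).+1]/(n.+1 + j)%N -[j.+1]/(1 + j)%N big_addn addnK.
by apply: eq_bigr => k _; rewrite iterD iter_tow_level.
Qed.

Lemma ergodic_sum_ge N n x j : (j < phi x)%N -> (tow_time N x <= n)%N ->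
  \sum_(0 <= i < N) tow_fun f (iter i t x) <=
  tow_fun f x + ergodic_sum tow_map f n (x, j).
Proof.
move=> jx Nn; rewrite -base_sum_time.
apply: (le_trans (base_sum_mono _ (_ : _ <= (n + j).+1)%N)).
  by rewrite (leq_trans Nn)// leqW// leq_addr.
rewrite base_sum_ergodic_sum// leeD2r//.
apply: (le_trans (base_sum_mono _ jx)).
have := base_sum_time 1 x; rewrite big_nat1/= /tow_time big_nat1/= => ->.
by [].
Qed.

(** A start at height [j] costs at most [j] further returns, because every return takes at least one
    step. *)
Lemma ergodic_sum_le N n x j : (j < phi x)%N -> (n < tow_time N x)%N ->
  ergodic_sum tow_map f n (x, j) <= \sum_(0 <= i < N + j) tow_fun f (iter i t x).
Proof.
move=> jx Nn; rewrite -base_sum_time.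
apply: (@le_trans _ _ (base_sum (n + j).+1 x)).
  rewrite base_sum_ergodic_sum// leeDr//.
  exact: sume_ge0.
apply: base_sum_mono; apply: (leq_trans _ (tow_timeD _ _ _)).
by rewrite -addSn leq_add2r.
Qed.

End tower_sums.

(** The [N] columns include the visit at time 0, which [ergodic_sum] leaves out; this makes the
    inequality strict, as the tail bound requires. *)
Lemma base_visits_lt N n x : (n < tow_time N x)%N ->
  ergodic_sum tow_map (EFin \o \1_[set u : X | u.2 = 0%N] : X -> \bar R) n (x, 0%N) <
  (N%:R)%:E.
Proof.
move=> nN; set f := EFin \o _.
have f0 u : 0 <= f u by rewrite lee_fin.
have := base_sum_ergodic_sum f n (phi_gt0 x).
have tf y : tow_fun f y = 1.
  rewrite /tow_fun; have := phi_gt0 y; case: (phi y) => // n' _.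
  rewrite big_nat_recl// big1 ?adde0.
    by rewrite /f/= indicE mem_set.
  by move=> i _; rewrite /f/= indicE memNset.
have b1 : base_sum f 1 x = 1.
  by rewrite /base_sum big_nat1/= /f/= indicE mem_set.
rewrite b1 addn0 => e.
have : base_sum f n.+1 x <= N%:R%:E.
  apply: (le_trans (base_sum_mono f0 x nN)); rewrite base_sum_time.
  rewrite (eq_bigr (fun=> 1%:E)); last by move=> i _; rewrite tf.
  by rewrite sumEFin sumr_const_nat subn0.
rewrite e => h; apply: lt_le_trans h.
rewrite -[ltLHS]add0e lteD2rE ?lte01//.
rewrite ge0_fin_numE; last exact: sume_ge0.
apply: (@le_lt_trans _ _ (1 + ergodic_sum tow_map f n (x, 0%N))).
  by rewrite leeDr.
by rewrite -e /base_sum /f/= sumEFin ltry.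
Qed.

(** Integration level by level; for [f = 1] this is Kac's formula. *)
Lemma integral_tow_fun (f : X -> \bar R) : measurable_fun [set: X] f ->
  (forall u, 0 <= f u) ->
  measurable_fun [set: Om] (tow_fun f) /\
  \int[mu]_x tow_fun f x = \int[tow_measure]_u f u.
Proof.
move=> mf f0.
pose g j x := if (j < phi x)%N then f (x, j) else 0.
have mfj j : measurable_fun [set: Om] (fun x => f (x, j)).
  by apply: (measurableT_comp mf); exact: measurable_pair2.
have mg j : measurable_fun [set: Om] (g j).
  apply: measurable_fun_ifT => //.
  apply: (measurable_fun_bool true).
  by rewrite setTI; exact: (mphi [set n | (j < n)%N]).
have g0 j x : 0 <= g j x by rewrite /g; case: ifP.
have fg x : tow_fun f x = \sum_(j <oo) g j x.
  rewrite (nneseries_split 0 (phi x))// add0n eseries0 ?adde0; last first.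
    by move=> j /= pj _; rewrite /g ltnNge pj.
  by rewrite /tow_fun !big_nat; apply: eq_bigr => j /andP[_ jx]; rewrite /g jx.
split.
  by rewrite (_ : tow_fun f = fun x => \sum_(j <oo) g j x);
    [exact: ge0_emeasurable_sum|apply/funext].
under eq_integral do rewrite fg.
rewrite integral_nneseries//.
rewrite ge0_integral_measure_series//; apply: eq_eseriesr => j _.
pose D := [set x | (j < phi x)%N].
have mD : measurable D by exact: (mphi [set n | (j < n)%N]).
have mp : measurable_fun [set: Om] (fun x => (x, j) : X) by exact: measurable_pair2.
transitivity (\int[mu]_(x in D) f (x, j)).
  rewrite [RHS]integral_mkcond; apply: eq_integral => x _.
  by rewrite /g patchE mem_setE.
transitivity (\int[mrestr mu mD]_x f (x, j)); last first.
  rewrite -(@ge0_integral_pushforward _ _ _ _ _ _ mp (mrestr mu mD) setT f)//.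
  by apply: eq_measure_integral => A mA _; rewrite /lev [LHS]/(mu _) setIC.
have mDc : measurable (~` D) by exact: measurableC.
rewrite -(setUv D) ge0_integral_setU//; last 2 first.
- exact: measurable_funTS.
- by rewrite disj_set2E setICr.
rewrite [X in _ = _ + X](_ : _ = 0) ?adde0.
  by apply: eq_measure_integral => A mA AD; rewrite /= /mrestr setIidl.
rewrite (eq_measure_integral mzero) ?integral_measure_zero// => A mA AD.
by rewrite /= /mrestr (_ : A `&` D = set0) ?measure0// -subset0 => x [/AD].
Qed.

End tower.

(** * The return time *)

Section parameters.
Local Open Scope nat_scope.

(* [uu k] is about [k ^ (1/6)], so that the resampling rates
   [ll k / qq k = 1 / (16 uu k ^ 6)] tend to 0 and have a divergent sum. *)
Fixpoint uu k := if k is k'.+1 then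
  if (uu k').+1 ^ 6 <= k.+1 then (uu k').+1 else uu k' else 1.

Definition ll k := uu k ^ 3.

Definition qq k := 16 * uu k ^ 9.

Lemma uu_gt0 k : 0 < uu k.
Proof. by elim: k => //= k IH; case: ifP. Qed.

Lemma uu_leS k : uu k <= uu k.+1.
Proof. by rewrite /=; case: ifP. Qed.

Lemma uu_mono k n : k <= n -> uu k <= uu n.
Proof.
move/subnK <-; elim: (n - k) => // i IH; rewrite addSn.
exact: (leq_trans IH (uu_leS _)).
Qed.

Lemma uu_pow k : uu k ^ 6 <= k.+1.
Proof. by elim: k => //= k IH; case: ifP => // _; rewrite (leq_trans IH). Qed.

(** Together with [uu_pow]: [uu k] is the integer part of the sixth root of [k + 1]. *)
Lemma uu_max k c : c ^ 6 <= k.+1 -> c <= uu k.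
Proof.
elim: k c => [|k IH] c ck.
  by rewrite leqNgt; apply/negP => c2; have := leq_exp2r 2 c (isT : 0 < 6); rewrite c2 => ?; lia.
have [cu|uc] := leqP c (uu k); first exact: leq_trans cu (uu_leS _).
have c1 : (c.-1) ^ 6 <= k.+1.
  have cp : c.-1 < c by have := uu_gt0 k; lia.
  have : c.-1 ^ 6 < c ^ 6 by rewrite ltn_exp2r.
  lia.
have cu := IH _ c1.
have ec : c = (uu k).+1 by lia.
by rewrite /= -ec ck.
Qed.

Lemma uu_unbounded c : exists k0, forall k, k0 <= k -> c <= uu k.
Proof.
exists (c ^ 6) => k ck; apply: uu_max.
exact: leq_trans (leqnSn _).
Qed.

Lemma qq_gt0 k : 0 < qq k.
Proof. by rewrite /qq muln_gt0/= expn_gt0 uu_gt0. Qed.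

Lemma ll_gt0 k : 0 < ll k.
Proof. by rewrite /ll expn_gt0 uu_gt0. Qed.

Lemma ll_lt_qq k : ll k < qq k.
Proof.
have u0 := uu_gt0 k; have := expn_gt0 (uu k) 3; rewrite u0 /= => h3.
have h6 : 0 < uu k ^ 6 by rewrite expn_gt0 u0.
rewrite /ll /qq (expnD _ 3 6); nia.
Qed.

Lemma qq_gt1 k : 1 < qq k.
Proof. exact: leq_ltn_trans (ll_gt0 k) (ll_lt_qq k). Qed.

End parameters.

Local Notation Q := (Qn qq).

Lemma Q_gt0 k : (0 < Q k)%N. Proof. exact: Qn_gt0 qq_gt0 k. Qed.

Lemma sum_blocks (V : nmodType) (g : nat -> V) c q :
  \sum_(0 <= i < c * q) g i = \sum_(0 <= d < c) \sum_(0 <= i < q) g (d * q + i)%N.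
Proof.
elim: c => [|c IH]; first by rewrite mul0n !big_geq.
rewrite mulSn addnC (@big_cat_nat _ _ _ (c * q)%N) ?leq_addr//= IH big_nat_recr//=.
by rewrite (sumr_nat_shift _ (c * q)).
Qed.

Lemma sum_nat_ltn l q : (l <= q)%N -> (\sum_(0 <= d < q) (d < l))%N = l.
Proof.
move=> lq; rewrite (@big_cat_nat _ _ _ l)//= [X in (_ + X)%N]big_nat_cond [X in (_ + X)%N]big1 ?addn0; last first.
  by move=> d; rewrite andbT => /andP[ld _]; rewrite ltnNge ld.
rewrite big_nat (eq_bigr (fun=> 1%N)); last by move=> d /andP[_ ->].
by rewrite -big_nat sum_nat_const_nat subn0 muln1.
Qed.

Section return_time.
Context (R : realType).

(* A block of level [k] and type [y] gets total time about [Q k * (BB k / y + CC k)].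
   The growth of [BB] leaves room for a spacer, and [CC] absorbs the resampled blocks,
   whose types are only known to be at least [1 / uu k]. *)
Fixpoint BB k : R := if k is k'.+1 then BB k' * (1 + (uu k')%:R^-1) else 1.

Fixpoint CC k : R := if k is k'.+1 then CC k' + 1 + BB k' / (uu k')%:R ^+ 2 else 0.

Lemma uuR_ge1 k : 1 <= (uu k)%:R :> R.
Proof. by rewrite ler1n uu_gt0. Qed.

Lemma uuR_gt0 k : 0 < (uu k)%:R :> R.
Proof. by rewrite ltr0n uu_gt0. Qed.

Lemma QR_gt0 k : 0 < (Q k)%:R :> R.
Proof. by rewrite ltr0n Q_gt0. Qed.

Lemma BB_ge k : k.+1%:R <= BB k.
Proof.
elim: k => //= k IH.
have uk : ((uu k)%:R <= k.+1%:R :> R).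
  by rewrite ler_nat (leq_trans _ (uu_pow k))// -{1}[uu k]expn1 leq_pexp2l// uu_gt0.
have u0 := uuR_gt0 k.
have k0 : 0 < k.+1%:R :> R by [].
rewrite -[k.+2%:R]natr1 mulrDr mulr1 lerD// ler_pdivlMr ?mul1r//.
exact: le_trans uk IH.
Qed.

Lemma BB_gt0 k : 0 < BB k.
Proof. by apply: lt_le_trans (BB_ge k). Qed.

Lemma BB_leS k : BB k <= BB k.+1.
Proof. by rewrite /= ler_peMr//; [exact/ltW/BB_gt0|rewrite lerDl invr_ge0]. Qed.

Lemma BB_mono k n : (k <= n)%N -> BB k <= BB n.
Proof.
move/subnK <-; elim: (n - k)%N => // i IH; rewrite addSn.
exact: (le_trans IH (BB_leS _)).
Qed.

Lemma BBS2 k : BB k.+1 <= 2 * BB k.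
Proof.
rewrite /= mulrC ler_pM2r ?BB_gt0//.
have : (uu k)%:R^-1 <= 1 :> R by rewrite invf_le1 ?uuR_gt0// uuR_ge1.
lra.
Qed.

Lemma CC_ge0 k : 0 <= CC k.
Proof.
by elim: k => //= k IH; rewrite !addr_ge0// divr_ge0 ?exprn_ge0// ltW ?BB_gt0.
Qed.

Lemma uu_lim (a : R) : exists k0, forall k, (k0 <= k)%N -> a <= (uu k)%:R.
Proof.
have [k0 h] := uu_unbounded (Num.truncn a).+1.
exists k0 => k /h uk; apply: (le_trans (ltW (truncnS_gt a))).
by rewrite ler_nat.
Qed.

Lemma BB_lim (a : R) : exists k0, forall k, (k0 <= k)%N -> a <= BB k.
Proof.
exists (Num.truncn a) => k ak; apply: (le_trans (ltW (truncnS_gt a))).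
by apply: le_trans (BB_ge k); rewrite ler_nat.
Qed.

(** With [u = uu k], the increments [1 + BB k / u^2] of [CC] are small against the increments
    [BB k / u] of [BB], because [u] tends to infinity and [u^2 <= BB k]. *)
Lemma CC_small (e : R) : 0 < e -> exists k0, forall k, (k0 <= k)%N -> CC k + 1 <= e * BB k.
Proof.
move=> e0; have [k1 h1] := uu_lim (4 / e).
have inc k : (k1 <= k)%N -> CC k.+1 - CC k <= e / 2 * (BB k.+1 - BB k).
  move=> /h1; rewrite ler_pdivrMr// => uk.
  have u0 := uuR_gt0 k; have u1 := uuR_ge1 k.
  have B0 := BB_gt0 k.
  have uB : (uu k)%:R ^+ 2 <= BB k.
    apply: (le_trans _ (BB_ge k)); rewrite -natrX ler_nat.
    by apply: (leq_trans _ (uu_pow k)); rewrite leq_pexp2l// uu_gt0.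
  have -> : CC k.+1 - CC k = 1 + BB k / (uu k)%:R ^+ 2 by rewrite /=; ring.
  have -> : BB k.+1 - BB k = BB k / (uu k)%:R by rewrite /=; ring.
  have -> : BB k / (uu k)%:R ^+ 2 = BB k / (uu k)%:R * (uu k)%:R^-1.
    by rewrite expr2 invfM mulrA.
  have w1 : (uu k)%:R^-1 <= e / 4 by rewrite -[leLHS]mul1r ler_pdivrMr//; lra.
  have Bu : (uu k)%:R <= BB k / (uu k)%:R by rewrite ler_pdivlMr// -expr2.
  set b := BB k / _ in Bu *; set w := _^-1 in w1 *.
  have b0 : 0 < b by exact: lt_le_trans Bu.
  nra.
have dif k i : (k1 <= k)%N -> CC (i + k) - CC k <= e / 2 * (BB (i + k) - BB k).
  move=> k1k; elim: i => [|i IH]; first by rewrite !subrr mulr0.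
  have := inc (i + k)%N (leq_trans k1k (leq_addl _ _)).
  rewrite -addSn; move: IH; lra.
have [k2 h2] := BB_lim ((CC k1 + 1) / (e / 2)).
exists (maxn k1 k2) => k; rewrite geq_max => /andP[k1k k2k].
have := h2 _ k2k; rewrite ler_pdivrMr ?divr_gt0// => h.
have := dif k1 (k - k1)%N (leqnn _); rewrite subnK//.
have := BB_gt0 k1; nra.
Qed.

Context (v : nat -> nat -> R).
Hypothesis v_ge : forall k d, (d < ll k)%N -> (uu k)%:R^-1 <= v k d.

Local Notation odoq := (odo qq).
Implicit Types (x : odoq).
Local Notation ty := (yty qq ll v 1).
Local Notation tau_ i := (iter i (tau qq)).

Definition hh k (y : R) : nat := (Num.truncn ((Q k)%:R * (BB k / y + CC k))).+1.

(* The wait added in a block of level [k+1] to reach its prescribed total time; by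
   [hh_sum_le] the subtraction is not truncated. *)
Definition ss k (y : R) : nat :=
  (hh k.+1 y - (\sum_(0 <= d < ll k) hh k (v k d) + (qq k - ll k) * hh k y))%N.

Lemma hh_ge k y : 0 < y -> (Q k)%:R * BB k / y <= (hh k y)%:R.
Proof.
move=> y0; apply: (le_trans _ (ltW (truncnS_gt _))).
by rewrite -mulrA ler_pM2l ?QR_gt0// lerDl CC_ge0.
Qed.

Lemma hh_le k y : 0 < y -> (hh k y)%:R <= (Q k)%:R * (BB k / y + CC k) + 1.
Proof.
move=> y0; rewrite /hh -natr1 lerD2r truncn_le//.
by rewrite mulr_ge0// addr_ge0 ?CC_ge0// divr_ge0// ltW// BB_gt0.
Qed.

Lemma v_gt0 k d : (d < ll k)%N -> 0 < v k d.
Proof. by move/v_ge; apply: lt_le_trans; rewrite invr_gt0 uuR_gt0. Qed.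

Lemma ty_gt0 k x : 0 < ty k x.
Proof. by apply: (@yty_prop _ qq ll v 1 (fun y => 0 < y)) => //; exact: v_gt0. Qed.

(** Write [u], [Q], [B], [C] for the quantities of level [k]. The resampled blocks have types at
    least [1 / u] and cost at most [u^3 Q (B u + C)] up to rounding. Over the [16 u^9 Q] points of
    the large block, the part [u^4 Q B] is covered by the summand [B / u^2] of [CC k.+1], the part
    [u^3 Q C] by the [u^3] inheriting blocks that are replaced, and the roundings, at most one per
    block, by the summand 1. *)
Lemma hh_sum_le k y : 0 < y ->
  (\sum_(0 <= d < ll k) hh k (v k d) + (qq k - ll k) * hh k y <= hh k.+1 y)%N.
Proof.
move=> y0.
have Q1 : 1 <= (Q k)%:R :> R by rewrite ler1n Q_gt0.
have B0 := BB_gt0 k; have C0 := CC_ge0 k; have u1 := uuR_ge1 k.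
set u : R := (uu k)%:R in u1.
have lq : (ll k <= qq k)%N by exact: ltnW (ll_lt_qq k).
have qu : (qq k)%:R = 16 * u ^+ 9 :> R by rewrite /qq natrM natrX.
have lu : (ll k)%:R = u ^+ 3 :> R by rewrite /ll natrX.
have h1 : (\sum_(0 <= d < ll k) hh k (v k d))%:R <=
    u ^+ 3 * ((Q k)%:R * (BB k * u + CC k) + 1).
  rewrite natr_sum -lu mulr_natl -[in leRHS](subn0 (ll k)) -sumr_const_nat !big_nat.
  apply: ler_sum => d /andP[_ dl]; apply: (le_trans (hh_le k (v_gt0 dl))).
  rewrite lerD2r ler_pM2l ?QR_gt0// lerD2r ler_pM2l//.
  by rewrite -[u]invrK lef_pV2 ?posrE ?invr_gt0 ?v_gt0 ?v_ge// /u uuR_gt0.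
have h2 := hh_le k y0.
suff h : (\sum_(0 <= d < ll k) hh k (v k d) + (qq k - ll k) * hh k y)%:R <=
    (Q k.+1)%:R * (BB k.+1 / y + CC k.+1).
  by rewrite ltnW// -(ltr_nat R) (le_lt_trans h)// truncnS_gt.
rewrite natrD natrM natrB// QnS natrM lu qu.
set c := BB k / u ^+ 2.
have cE : BB k = c * u ^+ 2 by rewrite /c divfK// expf_neq0// gt_eqF// /u uuR_gt0.
have c0 : 0 < c by rewrite divr_gt0// exprn_gt0// uuR_gt0.
have BS : BB k / y <= BB k.+1 / y by rewrite ler_pM2r ?invr_gt0// BB_leS.
have -> : CC k.+1 = CC k + 1 + c by [].
have X0 : 0 <= BB k / y by rewrite divr_ge0// ltW.
move: BS h1 h2; set X := BB k / y in X0 *; set X' := BB k.+1 / y.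
set q := (Q k)%:R in Q1 *; set S := (\sum_(_ <= _ < _) _)%N%:R; set H := (hh k y)%:R.
move=> BS h1 h2.
have u3 : 1 <= u ^+ 3 by rewrite exprn_ege1.
have u9 : u ^+ 9 = u ^+ 3 * u ^+ 3 * u ^+ 3 by rewrite -!exprD.
have u6 : u ^+ 4 * u ^+ 2 = u ^+ 3 * u ^+ 3 by rewrite -!exprD.
have u4 : u ^+ 3 * u = u ^+ 4 by rewrite -exprSr.
set w := u ^+ 3 in u3 u9 u6 u4 h1 *.
have le1 : S <= q * c * (w * w) + w * q * CC k + w.
  apply: (le_trans h1); rewrite cE.
  have -> : w * (q * (c * u ^+ 2 * u + CC k) + 1) = q * c * ((w * u) * u ^+ 2) + w * q * CC k + w by ring.
  by rewrite u4 u6.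
have wq : 0 <= 16 * u ^+ 9 - w by rewrite u9; nra.
have le2 : (16 * u ^+ 9 - w) * H <= (16 * u ^+ 9 - w) * (q * (X + CC k) + 1).
  by rewrite ler_wpM2l.
have q0 : 0 < q by lra.
apply: (le_trans (lerD le1 le2)); rewrite u9.
set W := w * w * w.
have W1 : w * w <= W by rewrite /W; nra.
have W2 : 1 <= w * w by nra.
have t1 : 16 * W * q * X <= 16 * W * q * X' by rewrite ler_pM2l// !mulr_gt0//; lra.
have qc0 : 0 < q * c by exact: mulr_gt0.
have t2 : q * c * (w * w) <= q * c * (16 * W) by rewrite ler_pM2l//; lra.
have t3 : 16 * W <= 16 * W * q by rewrite ler_peMr//; lra.
have t4 : 0 <= w * (q * X).
  by apply: mulr_ge0; [lra|apply: mulr_ge0; [exact: ltW|exact: X0]].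
have -> : q * c * (w * w) + w * q * CC k + w + (16 * W - w) * (q * (X + CC k) + 1) =
  q * c * (w * w) + 16 * W * q * X - w * (q * X) + 16 * W * q * CC k + 16 * W by ring.
have -> : 16 * W * q * (X' + (CC k + 1 + c)) =
  16 * W * q * X' + 16 * W * q * CC k + 16 * W * q + q * c * (16 * W) by ring.
lra.
Qed.

(** The wait of a block of level [j + 1] sits at its position [Q j], the start of its second
    sub-block. Position 0 could be shared by blocks of many levels; with this choice each point
    carries at most one wait, and [phi] is finite everywhere. *)
Definition phik k x : nat :=
  (hh 0 (ty 0 x) + \sum_(0 <= j < k) (pos qq j.+1 x == Q j) * ss j (ty j.+1 x))%N.

Definition phi x : nat := evval (fun k => phik k x).

Lemma phikS k x :
  phik k.+1 x = (phik k x + (pos qq k.+1 x == Q k) * ss k (ty k.+1 x))%N.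
Proof. by rewrite /phik big_nat_recr//= addnA. Qed.

Lemma phik_mono k n x : (k <= n)%N -> (phik k x <= phik n x)%N.
Proof.
by move=> kn; rewrite leq_add2l; apply: leq_sum_nat_widen.
Qed.

Lemma phik_stable k x : pos qq k x != 0%N -> forall n, (k <= n)%N -> phik n x = phik k x.
Proof.
move=> kx; suff h i : phik (i + k) x = phik k x by move=> n kn; rewrite -(subnK kn).
elim: i => // i IH; rewrite addSn phikS IH.
case: eqP => [e|_]; last by rewrite mul0n addn0.
exfalso; move/eqP: kx; apply.
rewrite -(pos_mod qq_gt0 x (_ : k <= (i + k).+1)%N); last by rewrite leqW// leq_addl.
by rewrite e; apply/eqP; apply: dvdn_Qn; rewrite leq_addl.
Qed.

Lemma phik_evconst x : evconst (fun k => phik k x).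
Proof.
have [[k kx]|nx] := pselect (exists k, pos qq k x != 0%N).
  by exists k => n; exact: phik_stable.
exists 0%N => n _; elim: n => // n IH; rewrite phikS IH.
have -> : pos qq n.+1 x = 0%N.
  by apply/eqP/negPn/negP => h; apply: nx; exists n.+1.
by have := Q_gt0 n; case: (Q n) => // ? _; rewrite mul0n addn0.
Qed.

Lemma phi_eq k x : pos qq k x != 0%N -> phi x = phik k x.
Proof. by move=> kx; apply: (evval_eq (n0 := k)) => n; exact: phik_stable. Qed.

Lemma phik_le k x : (phik k x <= phi x)%N.
Proof.
have [n h] := evvalP (phik_evconst x).
rewrite /phi -(h (maxn n k)) ?leq_maxl//; apply: phik_mono.
exact: leq_maxr.
Qed.

Lemma phi_gt0 x : (0 < phi x)%N.
Proof. by apply: (leq_trans _ (phik_le 0 x)); rewrite /phik addn_gt0. Qed.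

Lemma dm_phi : dm phi.
Proof.
apply: dm_evval => [n|x]; last exact: phik_evconst.
have m0 : dm (fun x => hh 0 (ty 0 x)) by exact: (dm_comp (hh 0) (dm_yty qq_gt0 ll v 1 0)).
have ms : dm (fun x => \sum_(0 <= j < n) (pos qq j.+1 x == Q j) * ss j (ty j.+1 x))%N.
  apply: dm_sum => j.
  have mb : dm (fun x : odoq => pos qq j.+1 x == Q j).
    exact: (dm_comp (fun p => p == Q j) (@dm_pos qq j.+1)).
  have mj : dm (fun x => ss j (ty j.+1 x)) by exact: (dm_comp (ss j) (dm_yty qq_gt0 ll v 1 j.+1)).
  exact: (dm_comp (fun ab : bool * nat => ab.1 * ab.2)%N (dm_pair mb mj)).
exact: (dm_comp (fun ab => ab.1 + ab.2)%N (dm_pair m0 ms)).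
Qed.

Lemma ty_block k i x : (pos qq k x + i < Q k)%N -> ty k (tau_ i x) = ty k x.
Proof. exact: (yty_iter _ _ _ qq_gt0). Qed.

Lemma tyS k x : ty k x = if (dig qq k x < ll k)%N then v k (dig qq k x) else ty k.+1 x.
Proof. exact: ytyS. Qed.

(** The wait [ss] is made for this: it fills the total of the sub-blocks up to [hh k.+1]. The
    statement concerns [phik] because the block may also contain the wait of a higher level. *)
Lemma block_sum k x : pos qq k x = 0%N ->
  (\sum_(0 <= i < Q k) phik k (tau_ i x) = hh k (ty k x))%N.
Proof.
elim: k x => [|k IH] x x0.
  by rewrite Qn0 big_nat1 /phik big_geq// addn0.
have Qlt : (Q k < Q k.+1)%N by rewrite QnS; have := qq_gt1 k; have := Q_gt0 k; nia.
have posi i : (i < Q k.+1)%N -> pos qq k.+1 (tau_ i x) = i.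
  by move=> iQ; rewrite pos_iter ?x0 ?add0n ?modn_small//; exact: qq_gt0.
under eq_bigr => i _ do rewrite phikS.
rewrite big_split/= [X in (_ + X)%N](_ : _ = ss k (ty k.+1 x)); last first.
  rewrite big_mkord (bigD1 (Ordinal Qlt))//= posi// eqxx mul1n big1 ?addn0.
    by rewrite ty_block// x0.
  by move=> i /negbTE ne; rewrite posi// (_ : (_ == _) = false)// mul0n.
rewrite QnS sum_blocks.
have -> : (\sum_(0 <= d < qq k) \sum_(0 <= i < Q k) phik k (tau_ (d * Q k + i) x) =
   \sum_(0 <= d < ll k) hh k (v k d) + (qq k - ll k) * hh k (ty k.+1 x))%N.
  have dsum d : (d < qq k)%N -> (\sum_(0 <= i < Q k) phik k (tau_ (d * Q k + i) x))%N =
      hh k (if (d < ll k)%N then v k d else ty k.+1 x).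
    move=> dq; under eq_bigr => i _ do rewrite addnC iterD.
    have dQ : (d * Q k < Q k.+1)%N by rewrite QnS ltn_pmul2r// Q_gt0.
    have x00 : pos qq k x = 0%N.
      by rewrite -(pos_mod qq_gt0 x (leqnSn k)) x0 mod0n.
    rewrite IH; last by rewrite pos_iter ?x00 ?add0n ?modnMl//; exact: qq_gt0.
    rewrite tyS (digE qq_gt0) posi// mulnK ?Q_gt0//.
    by rewrite ty_block// x0.
  rewrite (@big_cat_nat _ _ _ (ll k))//=; last exact: ltnW (ll_lt_qq k).
  congr (_ + _)%N.
    rewrite !big_nat; apply: eq_bigr => d /andP[_ dl].
    by rewrite dsum ?dl// (ltn_trans dl (ll_lt_qq k)).
  rewrite big_nat (eq_bigr (fun=> hh k (ty k.+1 x))).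
    by rewrite -big_nat sum_nat_const_nat mulnC.
  by move=> d /andP[ld dq]; rewrite dsum// ltnNge ld.
by rewrite /ss subnKC// hh_sum_le// ty_gt0.
Qed.

Lemma blocks_sum k c x : pos qq k x = 0%N ->
  (\sum_(0 <= i < c * Q k) phik k (tau_ i x) =
   \sum_(0 <= d < c) hh k (ty k (tau_ (d * Q k) x)))%N.
Proof.
move=> x0; rewrite sum_blocks; apply: eq_bigr => d _.
under eq_bigr => i _ do rewrite addnC iterD.
by rewrite block_sum// pos_iter ?x0 ?add0n ?modnMl//; exact: qq_gt0.
Qed.

Local Notation ttime := (@tow_time _ odoq (tau qq) phi).

(** Cut the window into blocks of level [k] and keep the complete ones that are not resampled: they
    have the type of level [k + 1], at most [Y], and take time at least [Q k * BB k / Y] each. What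
    is lost, namely both ends and [ll k] out of every [qq k] consecutive blocks, is a fraction at
    most [5 / uu k] by [uu k ^ 4 * Q k <= N]. No point has to be excluded. *)
Lemma tow_time_ge k N x (Y : R) : (uu k ^ 4 * Q k <= N)%N -> 0 < Y ->
  (forall i, (i < N)%N -> ty k.+1 (tau_ i x) <= Y) ->
  (1 - 5 / (uu k)%:R) * (N%:R * BB k / Y) <= (ttime N x)%:R.
Proof.
move=> uN Y0 tyY; have Q0 := Q_gt0 k; have B0 := BB_gt0 k.
(* The number of steps to the next start of a block of level [k]. *)
pose i0 := ((Q k - pos qq k x) %% Q k)%N.
have i0Q : (i0 < Q k)%N by rewrite ltn_pmod.
pose x1 := tau_ i0 x.
have x10 : pos qq k x1 = 0%N.
  rewrite pos_iter; last exact: qq_gt0.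
  by rewrite modnDmr subnKC ?modnn// ltnW// pos_lt//; exact: qq_gt0.
have u1 := uu_gt0 k.
have QN : (Q k <= N)%N by apply: leq_trans uN; rewrite leq_pmull// expn_gt0 u1.
have i0N : (i0 <= N)%N by apply: leq_trans QN; exact: ltnW.
pose b := ((N - i0) %/ Q k)%N.
have bQ1 : (b * Q k <= N - i0)%N by exact: leq_trunc_div.
have bQ2 : (N - i0 < b.+1 * Q k)%N by exact: ltn_ceil.
pose good d := ~~ ((dig qq k x1 + d) %% qq k < ll k)%N.
have cnt : (b <= \sum_(0 <= d < b) good d + (b %/ qq k).+1 * ll k)%N.
  have := sum_mod_le (fun d => d < ll k : nat)%N (dig qq k x1) b (qq_gt0 k).
  rewrite sum_nat_ltn; last exact: ltnW (ll_lt_qq k).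
  move=> h; rewrite -(leq_add2r (\sum_(0 <= d < b) ((dig qq k x1 + d) %% qq k < ll k))%N).
  rewrite addnAC -big_split/= -[X in (X + _ <= _)%N]muln1 -[b in (b * 1)%N]subn0 -sum_nat_const_nat.
  apply: leq_add => //; apply: leq_sum => d _.
  by rewrite /good; case: (_ %% _ < _)%N.
have lo : (\sum_(0 <= d < b) hh k (ty k (tau_ (d * Q k) x1)) <= ttime N x)%N.
  have hN : (i0 + b * Q k <= N)%N by lia.
  rewrite -blocks_sum// /tow_time [leqRHS](@big_cat_nat _ _ _ (i0 + b * Q k))//=.
  rewrite [X in (_ <= X + _)%N](@big_cat_nat _ _ _ i0) ?leq_addr//=.
  apply: leq_trans (leq_addr _ _); apply: leq_trans (leq_addl _ _).
  rewrite [leqRHS](sumr_nat_shift _ i0).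
  apply: leq_sum => i _; rewrite /x1 -iterD addnC; exact: phik_le.
pose c : R := (Q k)%:R * BB k / Y.
have c0 : 0 < c by rewrite divr_gt0// mulr_gt0// ltr0n.
have hc d : (d < b)%N -> c * (good d)%:R <= (hh k (ty k (tau_ (d * Q k) x1)))%:R.
  move=> db; rewrite /good; case: ltnP => gd; rewrite /= ?mulr0// mulr1.
  rewrite tyS (dig_iter_Qn qq_gt0) ltnNge gd/=.
  apply: (le_trans _ (hh_ge k (ty_gt0 _ _))).
  rewrite ler_pM2l ?mulr_gt0 ?ltr0n// lef_pV2 ?posrE ?ty_gt0//.
  rewrite /x1 -iterD; apply: tyY.
  have : (d.+1 * Q k <= b * Q k)%N by rewrite leq_mul2r db orbT.
  by rewrite mulSn; lia.
have lo2 : c * (\sum_(0 <= d < b) good d)%:R <= (ttime N x)%:R.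
  apply: (@le_trans _ _ (\sum_(0 <= d < b) hh k (ty k (tau_ (d * Q k) x1)))%:R).
    by rewrite !natr_sum mulr_sumr !big_nat; apply: ler_sum => d /andP[_ db]; exact: hc.
  by rewrite ler_nat.
apply: le_trans lo2.
have -> : (1 - 5 / (uu k)%:R) * (N%:R * BB k / Y) =
    c * ((1 - 5 / (uu k)%:R) * (N%:R / (Q k)%:R)).
  by rewrite /c; field; rewrite ?gt_eqF ?uuR_gt0 ?ltr0n.
rewrite ler_pM2l//.
move: cnt; rewrite -(ler_nat R) natrD natrM => cnt.
have bqR : ((b %/ qq k).+1%:R <= b%:R / (qq k)%:R + 1 :> R).
  rewrite -natr1 lerD2r ler_pdivlMr ?ltr0n ?qq_gt0// -natrM ler_nat.
  exact: leq_trunc_div.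
have lE : (ll k)%:R = (uu k)%:R ^+ 3 :> R by rewrite /ll natrX.
have qE : (qq k)%:R = 16 * (uu k)%:R ^+ 9 :> R by rewrite /qq natrM natrX.
move: bQ1 bQ2; rewrite -(leq_add2r i0) subnK// => bQ1 bQ2.
have bQ2' : (N <= (b.+2) * Q k)%N by rewrite !mulSn in bQ2 *; lia.
have bQ1' : (b * Q k <= N)%N by lia.
have {}uN : (uu k)%:R ^+ 4 * (Q k)%:R <= N%:R :> R by rewrite -natrX -natrM ler_nat.
have b1 : b%:R * (Q k)%:R <= N%:R :> R by rewrite -natrM ler_nat.
have b2 : N%:R <= b.+2%:R * (Q k)%:R :> R by rewrite -natrM ler_nat.
have uR := uuR_ge1 k; set u : R := (uu k)%:R in uR lE qE uN *.
have QR0 := QR_gt0 k; set QQ : R := (Q k)%:R in QR0 b1 b2 uN *.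
set n : R := N%:R / QQ.
have nE : N%:R = n * QQ by rewrite /n divfK// gt_eqF.
have b1' : b%:R <= n by rewrite /n ler_pdivlMr.
have b2' : n <= b%:R + 2 by rewrite /n ler_pdivrMr// -natrD addn2.
have un : u ^+ 4 <= n by rewrite /n ler_pdivlMr.
apply: (@le_trans _ _ (b%:R - (b%:R / (qq k)%:R + 1) * (ll k)%:R)); last first.
  have : (b %/ qq k).+1%:R * (ll k)%:R <= (b%:R / (qq k)%:R + 1) * (ll k)%:R :> R.
    by rewrite ler_wpM2r.
  lra.
rewrite lE qE.
have u0 : 0 < u by lra.
have -> : (b%:R / (16 * u ^+ 9) + 1) * u ^+ 3 = b%:R / (16 * u ^+ 6) + u ^+ 3.
  by field; rewrite gt_eqF.
have u2 : 1 <= u ^+ 2 by rewrite exprn_ege1.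
have u3 : 1 <= u ^+ 3 by rewrite exprn_ege1.
have e1 : b%:R / (16 * u ^+ 6) <= n / u.
  apply: (@le_trans _ _ (n / (16 * u ^+ 6))).
    by rewrite ler_pM2r// invr_gt0 mulr_gt0// exprn_gt0.
  have n0 : 0 < n by apply: lt_le_trans un; rewrite exprn_gt0.
  rewrite ler_pM2l// lef_pV2 ?posrE// ?mulr_gt0 ?exprn_gt0//.
  have : u <= u ^+ 6 by rewrite -{1}[u]expr1 ler_weXn2l.
  have : 0 <= u ^+ 6 by rewrite exprn_ge0// ltW.
  lra.
have e2 : u ^+ 3 <= n / u by rewrite ler_pdivlMr// -exprSr.
have e3 : 2 <= 2 * (n / u) by lra.
have -> : (1 - 5 / u) * n = n - 5 * (n / u) by field; rewrite gt_eqF.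
lra.
Qed.

End return_time.

(** * Return times along windows *)

Section concentration.
Context (R : realType) (v : nat -> nat -> R).
Hypothesis v_ge : forall k d, (d < ll k)%N -> (uu k)%:R^-1 <= v k d.

Local Notation odoq := (odo qq).
Implicit Types (x : odoq).
Local Notation ty := (yty qq ll v 1).
Local Notation tau_ i := (iter i (tau qq)).
Local Notation ttime := (@tow_time _ odoq (tau qq) (phi v)).

Lemma ty_zone k x : (ll k * Q k <= pos qq k.+1 x)%N -> ty k x = ty k.+1 x.
Proof.
by move=> h; rewrite tyS (digE qq_gt0) ltnNge leq_divRL ?Q_gt0// h.
Qed.

(** Beyond position [Q k] the wait of level [k + 1] has passed, and waits of higher levels occur
    only at position 0. The additional block in [(ll k).+1] excludes position [Q k] also when
    [ll k = 1]. *)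
Lemma phi_zone k x : ((ll k).+1 * Q k <= pos qq k.+1 x)%N -> phi v x = phik v k x.
Proof.
move=> h; have Qp : (Q k < pos qq k.+1 x)%N.
  by apply: leq_trans h; rewrite ltn_Pmull ?Q_gt0// ltnS ll_gt0.
rewrite (@phi_eq _ _ k.+1) ?phikS; last by rewrite -lt0n (leq_ltn_trans _ Qp).
by rewrite gtn_eqF// mul0n addn0.
Qed.

Lemma pos_tau_block k i x : pos qq k x = 0%N -> (i < Q k)%N -> pos qq k (tau_ i x) = i.
Proof.
by move=> x0 iQ; rewrite pos_iter ?x0 ?add0n ?modn_small//; exact: qq_gt0.
Qed.

Lemma Q_ltS k : (Q k < Q k.+1)%N.
Proof. by rewrite QnS; have := qq_gt1 k; have := Q_gt0 k; nia. Qed.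

Lemma phi_zone_sum k x : pos qq k.+1 x = 0%N ->
  (\sum_((ll k).+1 * Q k <= p < Q k.+1) phi v (tau_ p x) <= qq k * hh k (ty k.+1 x))%N.
Proof.
move=> x0; have x00 : pos qq k x = 0%N by rewrite -(pos_mod qq_gt0 x (leqnSn k)) x0 mod0n.
have lq : ((ll k).+1 <= qq k)%N by exact: ll_lt_qq.
have QE : (Q k.+1 = (ll k).+1 * Q k + (qq k - (ll k).+1) * Q k)%N.
  by rewrite -mulnDl subnKC// QnS.
rewrite big_nat (eq_bigr (fun p => phik v k (tau_ p x))); last first.
  by move=> p /andP[lp pQ]; rewrite (@phi_zone k)// pos_tau_block.
rewrite -big_nat QE sumr_nat_shift.
under eq_bigr => i _ do rewrite addnC iterD.
rewrite blocks_sum//; last first.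
  by rewrite pos_iter ?x00 ?add0n ?modnMl//; exact: qq_gt0.
apply: (@leq_trans ((qq k - (ll k).+1) * hh k (ty k.+1 x))); last first.
  by rewrite leq_mul2r leq_subr orbT.
rewrite -[X in (_ <= X * _)%N]subn0 -sum_nat_const_nat !big_nat leq_eqVlt.
apply/orP; left; apply/eqP; apply: eq_bigr => d /andP[_ dl].
rewrite -iterD -mulnDl.
have dq : ((d + (ll k).+1) * Q k < Q k.+1)%N by rewrite QnS ltn_pmul2r ?Q_gt0//; lia.
rewrite ty_zone ?ty_block ?x0//.
by rewrite pos_tau_block// leq_mul2r; apply/orP; right; lia.
Qed.

(** For each offset [i < N] the points reached from the admissible starts are distinct points of the
    zone, so every offset contributes at most the total time of the zone. *)
Lemma tow_time_sum_le k N x : pos qq k.+1 x = 0%N ->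
  (\sum_((ll k).+1 * Q k <= p < Q k.+1 - N) ttime N (tau_ p x) <=
   N * (qq k * hh k (ty k.+1 x)))%N.
Proof.
move=> x0; rewrite /tow_time exchange_big/=.
rewrite -[X in (_ <= X * _)%N]subn0 -sum_nat_const_nat big_nat [leqRHS]big_nat.
apply: leq_sum => i /andP[_ iN].
apply: leq_trans (phi_zone_sum x0).
have [h|h] := leqP (Q k.+1 - N) ((ll k).+1 * Q k); first by rewrite big_geq.
under eq_bigr => p _ do rewrite -iterD.
have -> : (\sum_((ll k).+1 * Q k <= p < Q k.+1 - N) phi v (tau_ (i + p) x) =
  \sum_((ll k).+1 * Q k + i <= p < (Q k.+1 - N) + i) phi v (tau_ p x))%N.
  rewrite [RHS](big_addn) addnK; apply: eq_bigr => p _; rewrite addnC //.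
rewrite [leqRHS](@big_cat_nat _ _ _ ((ll k).+1 * Q k + i))/= ?leq_addr//; last by lia.
apply: leq_trans (leq_addl _ _).
rewrite [leqRHS](@big_cat_nat _ _ _ ((Q k.+1 - N) + i))/= ?leq_addr//; lia.
Qed.

(** Markov's inequality for the excess of [t] over its lower bound [(1 - c) * A]. *)
Lemma finite_markov (t : nat -> R) a b (A c eta : R) : (a <= b)%N -> 0 <= c -> 0 < eta -> 0 < A ->
  (forall p, (a <= p < b)%N -> (1 - c) * A <= t p) ->
  eta * A * \sum_(a <= p < b) ((1 + eta) * A < t p)%R%:R + (1 - c) * A * (b - a)%:R
    <= \sum_(a <= p < b) t p.
Proof.
move=> ab c0 eta0 A0 h; rewrite mulr_sumr mulr_natr -sumr_const_nat -big_split/= !big_nat.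
apply: ler_sum => p abp; have := h _ abp.
case: ltP => [h1 _|_]; last by rewrite mulr0 add0r.
rewrite mulr1; apply: le_trans (ltW h1); have := mulr_ge0 c0 (ltW A0); lra.
Qed.

Lemma sum_nat_split3 (V : nmodType) (F : nat -> V) a b c : (a <= b)%N -> (b <= c)%N ->
  \sum_(0 <= p < c) F p =
  \sum_(0 <= p < a) F p + (\sum_(a <= p < b) F p + \sum_(b <= p < c) F p).
Proof.
move=> ab bc; rewrite (@big_cat_nat _ _ _ a)//=; last exact: leq_trans bc.
by congr (_ + _); rewrite (@big_cat_nat _ _ _ b).
Qed.

(* [tow_time_ge] makes the time of every window in the zone of constant type at least
   almost the average, so few of them can be much larger (Markov). *)
Lemma tow_time_count k N x (eta th : R) : pos qq k.+2 x = 0%N ->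
  (uu k ^ 4 * Q k <= N)%N -> (N <= uu k.+1 ^ 6 * Q k.+1)%N ->
  0 < eta -> 0 < th -> 5 / (uu k)%:R <= eta ->
  ty k.+2 x * (CC R k.+1 + 1) <= th * BB R k.+1 ->
  \sum_(0 <= p < Q k.+2)
     (~~ ((1 - eta) * (N%:R * BB R k / ty k.+2 x) <= (ttime N (tau_ p x))%:R <=
          (1 + eta) * (N%:R * BB R k / ty k.+2 x)))%:R
  <= (((1 + (uu k)%:R^-1) * (1 + th) - 1 + 6 / (uu k)%:R) / eta + (uu k)%:R^-1) * (Q k.+2)%:R.
Proof.
move=> x0 uN Nu eta0 th0 ueta yth.
set y := ty k.+2 x; set A := N%:R * BB R k / y.
have y0 : 0 < y by exact: ty_gt0.
have B0 := BB_gt0 R k.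
have N0 : (0 < N)%N by apply: leq_trans uN; rewrite muln_gt0 expn_gt0 uu_gt0 Q_gt0.
have A0 : 0 < A by rewrite divr_gt0// mulr_gt0// ltr0n.
have u1 := uuR_ge1 R k.+1; have uk1 := uuR_ge1 R k.
have ule : ((uu k)%:R <= (uu k.+1)%:R :> R) by rewrite ler_nat uu_leS.
set a := ((ll k.+1).+1 * Q k.+1)%N.
(* With [u = uu k.+1]: the starts left out, in the first [u^3 + 1] blocks and the last [u^6] blocks
   of level [k + 1], are a fraction at most [1 / u] of the [16 u^9] blocks. *)
have wQ : ((uu k.+1 ^ 3 + 1 + uu k.+1 ^ 6) * uu k.+1 * Q k.+1 <= Q k.+2)%N.
  rewrite [Q k.+2]QnS leq_mul2r; apply/orP; right; rewrite /qq.
  have h1 : (0 < uu k.+1)%N by exact: uu_gt0.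
  rewrite (_ : uu k.+1 ^ 9 = uu k.+1 ^ 3 * uu k.+1 * uu k.+1 * uu k.+1 ^ 4)%N; last first.
    by rewrite -!expnSr -expnD.
  rewrite (_ : uu k.+1 ^ 6 = uu k.+1 ^ 4 * uu k.+1 * uu k.+1)%N; last by rewrite -!expnSr.
  have h3 : (0 < uu k.+1 ^ 3)%N by rewrite expn_gt0 h1.
  rewrite (_ : uu k.+1 ^ 4 = uu k.+1 ^ 3 * uu k.+1)%N; last by rewrite -!expnSr.
  nia.
have aNQ : (a + N <= Q k.+2)%N.
  apply: leq_trans wQ; rewrite /a /ll.
  have := uu_gt0 k.+1; nia.
have NQ : (N <= Q k.+2)%N by apply: leq_trans aNQ; exact: leq_addl.
have aQ : (a <= Q k.+2)%N by apply: leq_trans aNQ; exact: leq_addr.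
have aN : (a <= Q k.+2 - N)%N by rewrite leq_subRL// addnC.
have zone p : (a <= p < Q k.+2 - N)%N -> (1 - 5 / (uu k)%:R) * A <= (ttime N (tau_ p x))%:R.
  move=> /andP[ap pN]; apply: tow_time_ge => // i iN.
  have ipQ : (i + p < Q k.+2)%N.
    by move: pN; rewrite ltn_subRL; apply: leq_ltn_trans; rewrite leq_add2r ltnW.
  rewrite -iterD ty_zone; first by rewrite ty_block ?x0.
  rewrite pos_tau_block//.
  by apply: leq_trans (leq_trans ap _); rewrite ?leq_addl// leq_mul2r leqnSn orbT.
have c0 : 0 <= 5 / (uu k)%:R :> R by rewrite divr_ge0.
have mk := finite_markov aN c0 eta0 A0 zone.
(* The mean time is about [N * BB k.+1 / y]: one factor compares [BB k.+1] with [BB k], and [1 + th]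
   accounts for [CC] and rounding. *)
have up : \sum_(a <= p < Q k.+2 - N) (ttime N (tau_ p x))%:R <=
    (Q k.+2)%:R * A * ((1 + (uu k)%:R^-1) * (1 + th)).
  rewrite -natr_sum; have := tow_time_sum_le N x0; rewrite -(ler_nat R) -/a => /le_trans; apply.
  rewrite 2!natrM -/y.
  have Q1 : 1 <= (Q k.+1)%:R :> R by rewrite ler1n Q_gt0.
  have hb : (hh k.+1 y)%:R <= (Q k.+1)%:R * (BB R k.+1 / y + CC R k.+1 + 1).
    by apply: (le_trans (hh_le k.+1 y0)); rewrite [leRHS]mulrDr mulr1 lerD2l.
  have hc : CC R k.+1 + 1 <= th * (BB R k.+1 / y) by rewrite mulrA ler_pdivlMr// mulrC.
  have -> : (Q k.+2)%:R * A * ((1 + (uu k)%:R^-1) * (1 + th)) =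
      N%:R * ((qq k.+1)%:R * ((Q k.+1)%:R * ((1 + th) * (BB R k.+1 / y)))).
    by rewrite [Q k.+2]QnS natrM /A /=; field; rewrite ?gt_eqF ?uuR_gt0.
  rewrite ler_pM2l ?ltr0n// ler_pM2l ?ltr0n ?qq_gt0//; apply: (le_trans hb).
  rewrite ler_pM2l ?QR_gt0//; lra.
have sz : (Q k.+2 - N - a)%:R = (Q k.+2)%:R - (a + N)%:R :> R.
  by rewrite -subnDA addnC natrB.
have saN : (a + N)%:R <= (Q k.+2)%:R / (uu k)%:R :> R.
  apply: (@le_trans _ _ ((Q k.+2)%:R / (uu k.+1)%:R)).
    rewrite ler_pdivlMr ?uuR_gt0// -natrM ler_nat; apply: leq_trans wQ.
    by rewrite [leqRHS]mulnAC leq_mul2r /a /ll mulSn !mulnDl mul1n (addnC (Q _)) leq_add2l Nu orbT.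
  by rewrite ler_pM2l ?QR_gt0// lef_pV2 ?posrE ?uuR_gt0.
rewrite (sum_nat_split3 _ aN (leq_subr _ _)).
have t1 : \sum_(0 <= p < a)
   (~~ ((1 - eta) * A <= (ttime N (tau_ p x))%:R <= (1 + eta) * A))%:R <= a%:R :> R.
  apply: (@le_trans _ _ (\sum_(0 <= p < a) 1)); first by apply: ler_sum => p _; rewrite lern1 leq_b1.
  by rewrite sumr_const_nat subn0.
have t3 : \sum_(Q k.+2 - N <= p < Q k.+2)
   (~~ ((1 - eta) * A <= (ttime N (tau_ p x))%:R <= (1 + eta) * A))%:R <= N%:R :> R.
  apply: (@le_trans _ _ (\sum_(Q k.+2 - N <= p < Q k.+2) 1)).
    by apply: ler_sum => p _; rewrite lern1 leq_b1.
  by rewrite sumr_const_nat subKn.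
have t2 : \sum_(a <= p < Q k.+2 - N)
   (~~ ((1 - eta) * A <= (ttime N (tau_ p x))%:R <= (1 + eta) * A))%:R <=
   \sum_(a <= p < Q k.+2 - N) ((1 + eta) * A < (ttime N (tau_ p x))%:R)%R%:R :> R.
  rewrite !big_nat; apply: ler_sum => p /zone zp.
  have -> : (1 - eta) * A <= (ttime N (tau_ p x))%:R.
    by apply: le_trans zp; rewrite ler_pM2r//; lra.
  by rewrite /= -ltNge.
set nb := \sum_(a <= p < Q k.+2 - N) ((1 + eta) * A < _)%R%:R in mk t2.
suff nbh : nb <= ((1 + (uu k)%:R^-1) * (1 + th) - 1 + 6 / (uu k)%:R) / eta * (Q k.+2)%:R.
  apply: (le_trans (lerD t1 (lerD t2 t3))).
  set c1 := (_ / eta) in nbh *; rewrite (mulrDl c1) (mulrC (uu k)%:R^-1).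
  move: saN nbh; rewrite natrD; set q2 := _ / (uu k)%:R; set q3 := c1 * _; lra.
rewrite -(ler_pM2l (mulr_gt0 eta0 A0)).
have -> : eta * A * (((1 + (uu k)%:R^-1) * (1 + th) - 1 + 6 / (uu k)%:R) / eta * (Q k.+2)%:R) =
   (Q k.+2)%:R * A * ((1 + (uu k)%:R^-1) * (1 + th)) - (1 - 5 / (uu k)%:R) * A * (Q k.+2)%:R
   + A * ((Q k.+2)%:R / (uu k)%:R).
  by field; rewrite ?gt_eqF ?uuR_gt0.
move: mk; rewrite sz => mk.
have : (1 - 5 / (uu k)%:R) * A * (a + N)%:R <= A * ((Q k.+2)%:R / (uu k)%:R).
  have : A * (a + N)%:R <= A * ((Q k.+2)%:R / (uu k)%:R) by rewrite ler_pM2l.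
  have : 0 <= 5 / (uu k)%:R * A * (a + N)%:R by rewrite mulr_ge0// mulr_ge0// ltW.
  lra.
lra.
Qed.

(** The type is read at level [k + 2] because [N] may exceed a block of level [k + 1]. The range of
    [N] leaves room, on both sides, for a bounded factor around the interval from [uu k ^ 5 * Q k]
    to [uu k.+1 ^ 5 * Q k.+1]. *)
Lemma tow_time_concentration (eta e M : R) : 0 < eta -> 0 < e -> 0 < M ->
  exists k0, forall k, (k0 <= k)%N -> forall x N, pos qq k.+2 x = 0%N -> ty k.+2 x <= M ->
  (uu k ^ 4 * Q k <= N)%N -> (N <= uu k.+1 ^ 6 * Q k.+1)%N ->
  \sum_(0 <= p < Q k.+2)
     (~~ ((1 - eta) * (N%:R * BB R k / ty k.+2 x) <= (ttime N (tau_ p x))%:R <=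
          (1 + eta) * (N%:R * BB R k / ty k.+2 x)))%:R
  <= e * (Q k.+2)%:R.
Proof.
move=> eta0 e0 M0; pose th := e * eta / 8.
have th0 : 0 < th by rewrite divr_gt0// mulr_gt0.
have [k1 h1] := CC_small (divr_gt0 th0 M0).
have [k2 h2] := uu_lim (28 / (e * eta)).
have [k3 h3] := uu_lim (2 / e).
have [k4 h4] := uu_lim (5 / eta).
exists (maxn (maxn k1 k2) (maxn k3 k4)) => k.
rewrite !geq_max => /andP[/andP[/leqW/h1 CB /h2 u2] /andP[/h3 u3 /h4 u4]] x N x0 yM N1 N2.
have u0 := uuR_gt0 R k.
have w1 : (uu k)%:R^-1 <= 1 :> R by rewrite invf_le1// uuR_ge1.
have inv_le (a b : R) : 0 < b -> a / b <= (uu k)%:R -> a * (uu k)%:R^-1 <= b.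
  by move=> b0; rewrite ler_pdivrMr// => h; rewrite ler_pdivrMr// mulrC.
have {}u2 := inv_le _ _ (mulr_gt0 e0 eta0) u2.
have {}u3 := inv_le _ _ e0 u3.
have {}u4 := inv_le _ _ eta0 u4.
have w0 : 0 < (uu k)%:R^-1 :> R by rewrite invr_gt0.
apply: (le_trans (tow_time_count x0 N1 N2 eta0 th0 u4 _)).
  apply: (@le_trans _ _ (M * (CC R k.+1 + 1))).
    by rewrite ler_wpM2r// addr_ge0 ?CC_ge0.
  apply: (@le_trans _ _ (M * (th / M * BB R k.+1))); first by rewrite ler_pM2l.
  by rewrite mulrA (mulrC M) divfK ?gt_eqF.
rewrite ler_pM2r ?QR_gt0//.
set w := (uu k)%:R^-1 in w0 w1 u2 u3 u4 *.
have : ((1 + w) * (1 + th) - 1 + 6 * w) / eta <= e / 2.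
  rewrite ler_pdivrMr//.
  have wt : w * th <= th by rewrite ler_piMl// ltW.
  have : e * eta = 8 * th by rewrite /th; field.
  lra.
lra.
Qed.

End concentration.

Local Notation odoq := (odo qq).

(** * Large types met by a window *)

Section tail.
Context (R : realType) (v : nat -> nat -> R).
Hypothesis v_ge : forall k d, (d < ll k)%N -> (uu k)%:R^-1 <= v k d.
Context (mu : probability odoq R).
Hypothesis mu_cyl : forall k p, (p < Q k)%N -> mu [set x | pos qq k x = p] = ((Q k)%:R^-1)%:E.
Implicit Types (x : odoq).
Local Notation ty := (yty qq ll v 1).
Local Notation tau_ i := (iter i (tau qq)).

Lemma measurable_window k N (X : R) :
  measurable ([set x | exists2 i, (i < N)%N & X <= ty k (tau_ i x)] : set odoq).
Proof.
rewrite (_ : [set x | _] = \bigcup_(i in `I_N) [set x | X <= ty k (tau_ i x)]); last first.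
  by apply/seteqP; split => x [i iN h]; exists i.
apply: bigcup_measurable => i _.
exact: (dm_iter qq_gt0 i (dm_yty qq_gt0 ll v 1 k) [set y | X <= y]).
Qed.

(** A window of [N <= Q k.+1] points meets at most the current block of level [k + 1] and the next
    one, the latter only if it starts among the last [N] positions. The point [tau_ (Q k.+1) x], at
    the same position in the next block, represents the type of that block. *)
Lemma ty_window k N X x : (N <= Q k.+1)%N ->
  (exists2 i, (i < N)%N & X <= ty k (tau_ i x)) ->
  [\/ X <= ty k.+1 x,
      (Q k.+1 - N <= pos qq k.+1 x)%N /\ X <= ty k.+1 (tau_ (Q k.+1) x) |
      ((pos qq k.+1 x < ll k * Q k)%N || (Q k.+1 - N <= pos qq k.+1 x)%N) /\
      (exists2 d, (d < ll k)%N & X <= v k d)].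
Proof.
move=> NQ [i iN]; rewrite tyS; case: ifP => [dl Xv|dl Xy].
  apply: Or33; split; last by exists (dig qq k (tau_ i x)).
  have [h|h] := ltnP (pos qq k.+1 x + i) (Q k.+1).
    apply/orP; left; move: dl.
    rewrite (digE qq_gt0) pos_iter; last exact: qq_gt0.
    rewrite modn_small// ltn_divLR ?Q_gt0//; apply: leq_ltn_trans.
    exact: leq_addr.
  by apply/orP; right; rewrite leq_subLR (leq_trans h)// addnC leq_add2r ltnW.
have [h|h] := ltnP (pos qq k.+1 x + i) (Q k.+1).
  by apply: Or31; rewrite -(ty_block v h).
apply: Or32; split.
  by rewrite leq_subLR (leq_trans h)// addnC leq_add2r ltnW.
suff <- : ty k.+1 (tau_ i x) = ty k.+1 (tau_ (Q k.+1) x) by [].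
have iQ : (i < Q k.+1)%N by exact: leq_trans iN NQ.
rewrite -(subnK (ltnW iQ)) iterD [RHS]ty_block//.
rewrite pos_iter; last exact: qq_gt0.
have pQ : (pos qq k.+1 x < Q k.+1)%N by apply: pos_lt; exact: qq_gt0.
rewrite -(subnK h) modnDr modn_small//; lia.
Qed.

(* The three cases are those of [ty_window]. The last one occurs only if some resampled
   type is [>= X], which already forces [p >= 1 / ll k]. *)
Lemma window_measure k N (X p : R) : (N <= uu k ^ 5 * Q k)%N ->
  (mu [set x | (X <= ty k.+1 x)%R] <= p%:E)%E -> 0 <= p ->
  ((exists2 d, (d < ll k)%N & X <= v k d) -> (ll k)%:R^-1 <= p) ->
  (mu [set x | exists2 i, (i < N)%N & (X <= ty k (tau_ i x))%R] <= (2 * p)%:E)%E.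
Proof.
move=> Nu Ap p0 vp.
have u1 := uuR_ge1 R k; have Qk := QR_gt0 R k; have Qk1 := QR_gt0 R k.+1.
have lE : (ll k)%:R = (uu k)%:R ^+ 3 :> R by rewrite /ll natrX.
have QE : (Q k.+1)%:R = 16 * (uu k)%:R ^+ 9 * (Q k)%:R :> R.
  by rewrite QnS natrM; congr (_ * _); rewrite /qq natrM natrX.
have NR : N%:R <= (uu k)%:R ^+ 5 * (Q k)%:R :> R by rewrite -natrX -natrM ler_nat.
have u5 : 1 <= (uu k)%:R ^+ 5 :> R by rewrite exprn_ege1.
have u3 : 1 <= (uu k)%:R ^+ 3 :> R by rewrite exprn_ege1.
have u59 : (uu k)%:R ^+ 5 <= (uu k)%:R ^+ 9 :> R by rewrite ler_weXn2l.
have NQ2 : N%:R / (Q k.+1)%:R <= 2^-1 :> R.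
  rewrite ler_pdivrMr// QE; apply: (le_trans NR); rewrite !mulrA ler_pM2r//; lra.
have NQ : (N <= Q k.+1)%N.
  by rewrite -(ler_nat R); move: NQ2; rewrite ler_pdivrMr//; lra.
pose A : set odoq := [set x | X <= ty k.+1 x].
pose I : set odoq := [set x | (Q k.+1 - N <= pos qq k.+1 x)%N].
pose J : set odoq := [set x | (pos qq k.+1 x < ll k * Q k)%N || (Q k.+1 - N <= pos qq k.+1 x)%N].
have mA : measurable A.
  exact: (dm_yty qq_gt0 ll v 1 k.+1 [set y | X <= y]).
have mI : measurable I by exact: (@dm_pos qq k.+1 [set p | (Q k.+1 - N <= p)%N]).
have mJ : measurable J.
  exact: (@dm_pos qq k.+1 [set p | (p < ll k * Q k)%N || (Q k.+1 - N <= p)%N]).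
have mE2 : measurable ((tau_ (Q k.+1) : odoq -> odoq) @^-1` (A `&` I)).
  have := measurable_iter_tau qq_gt0 (Q k.+1) measurableT (measurableI _ _ mA mI); rewrite setTI; exact.
pose J' : set odoq := [set x | J x /\ (exists2 d, (d < ll k)%N & X <= v k d)].
have J'E : J' = J /\ (exists2 d, (d < ll k)%N & X <= v k d) \/ J' = set0.
  have [vd|nvd] := pselect (exists2 d, (d < ll k)%N & X <= v k d).
    by left; split => //; apply/seteqP; split => [x []|x].
  by right; apply/seteqP; split => // x [].
have mJ' : measurable J' by case: J'E => [[->]|->] //; exact: measurable0.
apply: (@le_trans _ _ (mu (A `|` ((tau_ (Q k.+1) : odoq -> odoq) @^-1` (A `&` I) `|` J')))%E).
  apply: le_measure; rewrite ?inE; last first.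
  - move=> x /(ty_window NQ)[xA|[xI xA]|[xJ xd]]; [by left|right; left|by right; right].
      split => //; rewrite /I/= pos_iter; last exact: qq_gt0.
      by rewrite modnDr modn_small// pos_lt//; exact: qq_gt0.
  - by apply: measurableU => //; exact: measurableU.
  - exact: measurable_window.
(* The type of a block is independent of the position in it, and the last [N] positions are at most
   half of the block. *)
have m1 : (mu (A `&` I) <= (p / 2)%:E)%E.
  have bA : block_inv k.+1 A.
    move=> x i x0 iQ; rewrite /A/= ty_block// x0//.
  have cI x : pos qq k.+1 x = 0%N ->
      \sum_(0 <= i < Q k.+1) \1_(A `&` I) (tau_ i x) <= N%:R * \1_A x :> R.
    move=> x0; rewrite (@big_cat_nat _ _ _ (Q k.+1 - N))/= ?leq_subr//.
    rewrite big_nat big1 ?add0r; last first.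
      move=> i /andP[_ iQ]; rewrite indicE memNset// => -[_].
      rewrite /I/= pos_tau_block//; first by move/(leq_trans iQ); rewrite ltnn.
      by apply: leq_trans iQ _; exact: leq_subr.
    rewrite -[in leRHS](subKn NQ) mulr_natl -sumr_const_nat !big_nat.
    apply: ler_sum => i /andP[_ iQ]; rewrite -(_ : \1_A (tau_ i x) = \1_A x) ?indicI.
      by rewrite /= ler_piMr// indicE lern1 leq_b1.
    rewrite !indicE; congr (_%:R); congr nat_of_bool.
    by apply/idP/idP; rewrite !inE bA.
  have N0 : 0 <= N%:R :> R by [].
  apply: (le_trans (count_le qq_gt0 mu_cyl (measurableI _ _ mA mI) mA N0 bA cI)).
  apply: (@le_trans _ _ ((N%:R / (Q k.+1)%:R)%:E * p%:E)%E).
    by apply: lee_wpmul2l => //; rewrite lee_fin divr_ge0.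
  by rewrite -EFinM lee_fin mulrC ler_wpM2l.
(* With [u = uu k], the set [J] has at most [(u^3 + u^5) * Q k] positions out of [16 u^9 * Q k], a
   fraction at most half of [1 / ll k]. *)
have m2 : (mu J' <= (p / 2)%:E)%E.
  case: J'E => [[-> vd]|->]; last by rewrite measure0 lee_fin divr_ge0.
  have cJ x : pos qq k.+1 x = 0%N ->
      \sum_(0 <= i < Q k.+1) \1_J (tau_ i x) <= (ll k * Q k + N)%:R :> R.
    move=> x0; have lQ : (ll k * Q k <= Q k.+1)%N.
      by rewrite QnS leq_mul2r ltnW ?orbT// ll_lt_qq.
    apply: (@le_trans _ _ (\sum_(0 <= i < Q k.+1) ((i < ll k * Q k)%N%:R + (Q k.+1 - N <= i)%N%:R))).
      rewrite !big_nat; apply: ler_sum => i /andP[_ iQ].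
      rewrite indicE; have [/set_mem|_] := boolP (tau_ i x \in J); last by rewrite addr_ge0.
      rewrite /J/= pos_tau_block//.
      by move=> /orP[] ->; rewrite ?lerDl ?lerDr.
    rewrite big_split/= natrD lerD//.
      by rewrite -natr_sum sum_nat_ltn.
    rewrite (@big_cat_nat _ _ _ (Q k.+1 - N))/= ?leq_subr//.
    rewrite big_nat big1 ?add0r; last by move=> i /andP[_ iQ]; rewrite (ltn_geF iQ).
    rewrite -[in leRHS](subKn NQ) -sumr_const_nat.
    by apply: ler_sum => i _; rewrite lern1 leq_b1.
  apply: (le_trans (count_leT qq_gt0 mu_cyl mJ (ler0n _ _) cJ)).
  rewrite lee_fin; apply: (@le_trans _ _ ((ll k)%:R^-1 / 2)); last first.
    by rewrite ler_pM2r// vp.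
  rewrite ler_pdivrMr// lE QE natrD natrM lE.
  have -> : (uu k)%:R ^- 3 / 2 * (16 * (uu k)%:R ^+ 9 * (Q k)%:R) =
      8 * (uu k)%:R ^+ 6 * (Q k)%:R :> R by field; rewrite gt_eqF// uuR_gt0.
  have : (uu k)%:R ^+ 3 * (Q k)%:R <= (uu k)%:R ^+ 6 * (Q k)%:R :> R.
    by rewrite ler_pM2r// ler_weXn2l.
  have : (uu k)%:R ^+ 5 * (Q k)%:R <= (uu k)%:R ^+ 6 * (Q k)%:R :> R.
    by rewrite ler_pM2r// ler_weXn2l.
  have : 0 <= (uu k)%:R ^+ 6 * (Q k)%:R :> R by rewrite mulr_ge0.
  lra.
apply: (le_trans (measureU2 _ _ _)) => //; first exact: measurableU.
rewrite (_ : 2 * p = p + p)%R; last ring.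
rewrite EFinD leeD//; apply: (le_trans (measureU2 _ _ _)) => //.
have -> : (p%:E = (p / 2)%:E + (p / 2)%:E)%E by rewrite -EFinD -splitr.
have mE2E := iter_preserving qq_gt0 mu_cyl (Q k.+1) (measurableI _ _ mA mI).
by apply: leeD => //; rewrite [leLHS]mE2E.
Qed.

End tail.

(** * The law of the types *)

Section grid_count.

(* For a decreasing predicate [b] and [1 <= n], the largest [r <= n] satisfying [b],
   but at least 1. *)
Definition grid_count (b : nat -> bool) n := (1 + \sum_(2 <= r < n.+1) b r)%N.

Context (b : nat -> bool).
Hypothesis b_anti : forall r s, (r <= s)%N -> b s -> b r.

Lemma grid_countS n : (1 <= n)%N -> grid_count b n.+1 = (grid_count b n + b n.+1)%N.
Proof. by move=> n1; rewrite /grid_count big_nat_recr//= addnA. Qed.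

Lemma grid_count_full n : (1 <= n)%N -> b n -> grid_count b n = n.
Proof.
elim: n => // -[_ _|n IH _] bn; first by rewrite /grid_count big_geq.
by rewrite grid_countS// bn IH ?addn1//; exact: b_anti bn.
Qed.

Lemma grid_count_pos n m : (2 <= m)%N -> (m <= grid_count b n)%N -> b m.
Proof.
elim: n => [|[|n] IH] m2 mn.
- by move: mn; rewrite /grid_count big_geq// addn0 leqNgt m2.
- by move: mn; rewrite /grid_count big_geq// addn0 leqNgt m2.
- case: (boolP (b n.+2)) => [bn|nbn].
    by move: mn; rewrite grid_count_full// => /b_anti; apply.
  by apply: IH => //; move: mn; rewrite grid_countS// (negbTE nbn) addn0.
Qed.

Lemma grid_count_neg n : (grid_count b n < n)%N -> ~~ b (grid_count b n).+1.
Proof.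
elim: n => // -[_|n IH]; first by rewrite /grid_count big_geq.
case: (boolP (b n.+2)) => [bn|nbn]; first by rewrite grid_count_full// ltnn.
rewrite grid_countS// (negbTE nbn) addn0 ltnS leq_eqVlt => /orP[/eqP->//|]; exact: IH.
Qed.

(** A function of the count becomes linear in the indicators [b r], so that averaging it only
    requires the frequencies of the events [b r]. *)
Lemma grid_count_telescope (V : zmodType) (f : nat -> V) n : (1 <= n)%N ->
  f (grid_count b n) = f 1%N + \sum_(2 <= r < n.+1) (f r - f r.-1) *+ b r.
Proof.
elim: n => // -[_ _|n IH _]; first by rewrite /grid_count !big_geq// addn0 addr0.
rewrite [in RHS]big_nat_recr//= addrA -IH//.
case: (boolP (b n.+2)) => [bn|nbn].
  have bn1 : b n.+1 by exact: b_anti bn.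
  by rewrite !grid_count_full// mulr1n addrC subrK.
by rewrite grid_countS// (negbTE nbn) addn0 mulr0n addr0.
Qed.

End grid_count.

(* An excess of [z] over [A] would be multiplied by partial sums of [e], which diverge
   like the harmonic series. *)
Lemma descent (R : realType) (e z : nat -> R) (A M : R) k0 :
  (forall k, 0 <= e k < 1) -> (forall k, 1 / (16 * k.+1%:R) <= e k) ->
  (forall k, z k <= M) ->
  (forall k, (k0 <= k)%N -> z k <= e k * A + (1 - e k) * z k.+1) ->
  forall k, (k0 <= k)%N -> z k <= A.
Proof.
move=> e01 eh zM h k kk; rewrite leNgt; apply/negP => Az.
pose w := z k - A; have w0 : 0 < w by rewrite /w subr_gt0.
have st n : w * (1 + \sum_(0 <= i < n) e (k + i)%N) <= z (k + n)%N - A.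
  elim: n => [|n IH]; first by rewrite big_geq// addr0 mulr1 addn0.
  rewrite big_nat_recr//= addnS.
  have := h (k + n)%N (leq_trans kk (leq_addr _ _)).
  have /andP[e0 e1] := e01 (k + n)%N.
  have s0 : 0 <= \sum_(0 <= i < n) e (k + i)%N.
    by apply: sumr_ge0 => i _; case/andP: (e01 (k + i)%N).
  move: IH; set s := \sum_(0 <= i < n) _ in s0 *; set E := e (k + n)%N in e0 e1 *.
  set a := z _; set a' := z _ => IH hz.
  have : w * (1 + s) <= (1 - E) * (a' - A) by lra.
  have ws : 0 <= w * s by rewrite mulr_ge0// ltW.
  nra.
have ub n : \sum_(0 <= i < n) (k + i).+1%:R^-1 <= 16 * ((M - A) / w) :> R.
  have h1 : \sum_(0 <= i < n) (k + i).+1%:R^-1 <= 16 * \sum_(0 <= i < n) e (k + i)%N :> R.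
    rewrite mulr_sumr; apply: ler_sum => i _.
    have := eh (k + i)%N; rewrite mul1r invfM; set a := (k + i).+1%:R^-1; set b := e _; lra.
  apply: (le_trans h1); rewrite ler_pM2l// ler_pdivlMr// mulrC.
  have := st n; have := zM (k + n)%N; lra.
apply: (@dvg_harmonic R).
apply: nondecreasing_is_cvgn.
  apply/nondecreasing_seqP => n; rewrite /series/= big_nat_recr//= lerDl.
  by rewrite invr_ge0.
exists (\sum_(0 <= i < k) i.+1%:R^-1 + 16 * ((M - A) / w)) => _ [n _ <-]; rewrite /series/=.
apply: (@le_trans _ _ (\sum_(0 <= i < k + n) i.+1%:R^-1)).
  rewrite addnC [leRHS](@big_cat_nat _ _ _ n)/= ?leq_addr// lerDl.
  by apply: sumr_ge0 => i _; rewrite invr_ge0.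
rewrite (@big_cat_nat _ _ _ k)/= ?leq_addr// lerD2l sumr_nat_shift; exact: ub.
Qed.

Section law.
Context (R : realType) (v : nat -> nat -> R).
Hypothesis v_ge : forall k d, (d < ll k)%N -> (uu k)%:R^-1 <= v k d.
Context (mu : probability odoq R).
Hypothesis mu_cyl : forall k p, (p < Q k)%N -> mu [set x | pos qq k x = p] = ((Q k)%:R^-1)%:E.
Implicit Types (x : odoq).
Local Notation ty := (yty qq ll v 1).
Local Notation tau_ i := (iter i (tau qq)).
Implicit Type psi : R -> R.

Definition tmean psi k : R := fine (\int[mu]_x (psi (ty k x))%:E).

Lemma measurable_ty psi k : measurable_fun [set: odoq] (fun x => (psi (ty k x))%:E).
Proof.
apply/measurable_EFinP; apply: dm_measurable.
exact: (dm_comp psi (dm_yty qq_gt0 ll v 1 k)).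
Qed.

Lemma integral_ty_bound psi k M : (forall y, 0 <= psi y <= M) ->
  (0 <= \int[mu]_x (psi (ty k x))%:E <= M%:E)%E.
Proof.
move=> h; apply/andP; split.
  by apply: integral_ge0 => x _; rewrite lee_fin; case/andP: (h (ty k x)).
apply: (@le_trans _ _ (\int[mu]_x (cst M%:E x))%E).
  apply: ge0_le_integral => //.
  - by move=> x _; rewrite lee_fin; case/andP: (h (ty k x)).
  - exact: measurable_ty.
  - by move=> x _; rewrite lee_fin; case/andP: (h (ty k x)).
by rewrite integral_cst// -[leRHS]mule1 -(probability_setT mu).
Qed.

Lemma tmeanE psi k M : (forall y, 0 <= psi y <= M) ->
  (\int[mu]_x (psi (ty k x))%:E)%E = (tmean psi k)%:E.
Proof.
move=> /(integral_ty_bound k) /andP[h1 h2]; rewrite /tmean fineK// ge0_fin_numE//.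
exact: le_lt_trans h2 (ltry _).
Qed.

Lemma tmean_bound psi k M : (forall y, 0 <= psi y <= M) -> 0 <= tmean psi k <= M.
Proof. by move=> h; have := integral_ty_bound k h; rewrite (tmeanE _ h) !lee_fin. Qed.

(** For [k <= n] the type of level [n] is constant on blocks of level [k], hence independent of the
    position at level [k]. This is the source of the asymptotic independence from cylinders. *)
Lemma integral_cyl_ty psi M k n (r : nat -> R) : (forall y, 0 <= psi y <= M) ->
  (forall p, 0 <= r p) -> (k <= n)%N ->
  (\int[mu]_x (r (pos qq k x) * psi (ty n x))%:E)%E =
  ((\sum_(0 <= p < Q k) r p) / (Q k)%:R * tmean psi n)%:E.
Proof.
move=> psi0 r0 kn.
have mpsi := measurable_ty psi n.
have tyb x i : pos qq k x = 0%N -> (i < Q k)%N -> ty n (tau_ i x) = ty n x.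
  move=> x0 iQ; apply: eq_yty => j nj; apply: (dig_iter qq_gt0 (leq_trans kn nj)).
  by rewrite x0.
have Q0 := QR_gt0 R k.
have s0 : 0 <= \sum_(0 <= p < Q k) r p by exact: sumr_ge0.
rewrite (integral_unfold qq_gt0 mu_cyl k); last 2 first.
- apply/measurable_EFinP; apply: dm_measurable.
  exact: (dm_comp (fun ab => r ab.1 * psi ab.2) (dm_pair (@dm_pos qq k) (dm_yty qq_gt0 ll v 1 n))).
- by move=> x; rewrite lee_fin mulr_ge0//; case/andP: (psi0 (ty n x)).
rewrite (eq_integral (fun x => (\sum_(0 <= p < Q k) r p)%:E * (psi (ty n x))%:E)%E); last first.
  move=> x /[!inE]/= x0; rewrite sumEFin; congr EFin; rewrite mulr_suml !big_nat.
  by apply: eq_bigr => p /andP[_ pQ]; rewrite pos_tau_block// tyb.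
rewrite ge0_integralZl_EFin//; last 3 first.
- exact: measurable_posP.
- by move=> x _; rewrite lee_fin; case/andP: (psi0 (ty n x)).
- exact: measurable_funTS.
rewrite (integral_block qq_gt0 mu_cyl)//; last 2 first.
- by move=> x; rewrite lee_fin; case/andP: (psi0 (ty n x)).
- by move=> x i x0 iQ; rewrite tyb.
by rewrite (tmeanE _ psi0) -!EFinM mulrA.
Qed.

(** The law of the type at level [k] is a mixture of the sampled values, with weight [ll k / qq k],
    and of the law at level [k + 1]. *)
Lemma tmean_rec psi M k : (forall y, 0 <= psi y <= M) ->
  tmean psi k = (\sum_(0 <= d < ll k) psi (v k d)) / (qq k)%:R +
                (1 - (ll k)%:R / (qq k)%:R) * tmean psi k.+1.
Proof.
move=> psi0; apply/eqP; rewrite -(@eqe R); apply/eqP; rewrite -(tmeanE _ psi0).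
have Qk0 := QR_gt0 R k; have q0 : 0 < (qq k)%:R :> R by rewrite ltr0n qq_gt0.
have lq : (ll k <= qq k)%N by exact: ltnW (ll_lt_qq k).
have psi1 y : 0 <= psi y by case/andP: (psi0 y).
pose s := \sum_(0 <= d < ll k) psi (v k d).
have s0 : 0 <= s by apply: sumr_ge0.
rewrite (integral_unfold qq_gt0 mu_cyl k.+1); last 2 first.
- exact: measurable_ty.
- by move=> x; rewrite lee_fin.
pose G (x : odoq) : \bar R :=
  ((Q k)%:R * (s + (qq k - ll k)%:R * psi (ty k.+1 x)))%:E.
have mG : measurable_fun [set: odoq] G.
  exact: (measurable_ty (fun y => (Q k)%:R * (s + (qq k - ll k)%:R * psi y))).
rewrite (eq_integral G); last first.
  move=> x /[!inE]/= x0; rewrite sumEFin; congr EFin.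
  have x00 : pos qq k x = 0%N by rewrite -(pos_mod qq_gt0 x (leqnSn k)) x0 mod0n.
  rewrite QnS sum_blocks.
  have dsum d : (d < qq k)%N -> \sum_(0 <= i < Q k) psi (ty k (tau_ (d * Q k + i) x)) =
      (Q k)%:R * psi (if (d < ll k)%N then v k d else ty k.+1 x).
    move=> dq; have dQ : (d * Q k < Q k.+1)%N by rewrite QnS ltn_pmul2r// Q_gt0.
    rewrite mulr_natl -[in RHS](subn0 (Q k)) -sumr_const_nat !big_nat.
    apply: eq_bigr => i /andP[_ iQ]; rewrite addnC iterD ty_block; last first.
      by rewrite pos_iter ?x00 ?add0n ?modnMl//; exact: qq_gt0.
    rewrite tyS (digE qq_gt0) pos_tau_block// mulnK ?Q_gt0//.
    by rewrite ty_block// x0.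
  rewrite big_nat (eq_bigr (fun d => (Q k)%:R * psi (if (d < ll k)%N then v k d else ty k.+1 x))); last first.
    by move=> d /andP[_ /dsum].
  rewrite -big_nat -mulr_sumr; congr (_ * _).
  rewrite (@big_cat_nat _ _ _ (ll k))//=; congr (_ + _).
    by rewrite /s !big_nat; apply: eq_bigr => d /andP[_ ->].
  rewrite mulr_natl -sumr_const_nat !big_nat; apply: eq_bigr => d /andP[ld _].
  by rewrite ltnNge ld.
rewrite (integral_block qq_gt0 mu_cyl)//; last 2 first.
- by move=> x; rewrite lee_fin mulr_ge0// addr_ge0// mulr_ge0.
- by move=> x i x0 iQ; rewrite /G ty_block// x0.
have -> : (\int[mu]_x G x)%E =
    ((Q k)%:R * (s + (qq k - ll k)%:R * tmean psi k.+1))%:E.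
  rewrite /G; under eq_integral => x _ do rewrite EFinM EFinD EFinM.
  rewrite ge0_integralZl_EFin//; last 2 first.
  - by move=> x _; rewrite -EFinM -EFinD lee_fin addr_ge0// mulr_ge0.
  - exact: (measurable_ty (fun y => s + (qq k - ll k)%:R * psi y)).
  rewrite ge0_integralD//; last 2 first.
  - by move=> x _; rewrite -EFinM lee_fin mulr_ge0.
  - exact: (measurable_ty (fun y => (qq k - ll k)%:R * psi y)).
  rewrite integral_cst// [X in (_ * (_ * X + _))%E](probability_setT mu) mule1.
  rewrite ge0_integralZl_EFin//; last 2 first.
  - by move=> x _; rewrite lee_fin.
  - exact: measurable_ty.
  by rewrite (tmeanE _ psi0).
rewrite -EFinM QnS natrM natrB//; congr EFin; rewrite -/s.
by field; rewrite ?gt_eqF.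
Qed.

End law.

Lemma count_above (R : realType) (a : R) (l : nat) : 0 <= a ->
  (a <= l%:R -> l%:R - a - 1 <= (\sum_(0 <= d < l) (a <= d%:R)%R)%:R <= l%:R - a) /\
  (l%:R < a -> (\sum_(0 <= d < l) (a <= d%:R)%R)%N = 0%N).
Proof.
move=> a0; elim: l => [|l [IH1 IH2]].
  by rewrite big_geq//; split => // h; apply/andP; split; lra.
have e1 : l.+1%:R = l%:R + 1 :> R by rewrite natr1.
rewrite big_nat_recr//= natrD e1; have [al|al] := leP a l%:R.
  have /andP[h1 h2] := IH1 al.
  split => [_|h]; last by exfalso; lra.
  apply/andP; split; rewrite /=; lra.
rewrite IH2//= addr0; split => // h; apply/andP; split; lra.
Qed.

Lemma resample_rate (R : realType) k : 0 <= ((ll k)%:R / (qq k)%:R : R) < 1.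
Proof.
rewrite divr_ge0//= ltr_pdivrMr ?ltr0n ?qq_gt0// mul1r ltr_nat; exact: ll_lt_qq.
Qed.

Lemma resample_rate_ge (R : realType) k : 1 / (16 * k.+1%:R) <= (ll k)%:R / (qq k)%:R :> R.
Proof.
have u0 := uuR_gt0 R k.
have -> : (ll k)%:R / (qq k)%:R = 1 / (16 * (uu k)%:R ^+ 6) :> R.
  by rewrite /ll /qq natrM !natrX; field; rewrite gt_eqF.
rewrite !mul1r lef_pV2 ?posrE ?mulr_gt0 ?exprn_gt0//.
by rewrite ler_pM2l// -natrX ler_nat uu_pow.
Qed.

(** * Sampling from the law of Y *)

Section sampling.
Context (R : realType) (d' : measure_display) (Om : measurableType d')
  (P : probability Om R) (Y : {RV P >-> R}).
Hypothesis Y_gt0 : forall w, 0 < Y w.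

(** The survival function of [Y], with the weak inequality of the tail bound. *)
Definition sf (y : R) : R := fine (P [set w | y <= Y w]).

Lemma measurable_sf_set y : measurable [set w | y <= Y w].
Proof.
rewrite -[X in measurable X]setTI (_ : [set w | _] = Y @^-1` `[y, +oo[%classic); last first.
  by apply/seteqP; split => w /=; rewrite in_itv/= andbT.
exact: measurable_funPT.
Qed.

Lemma sfE y : P [set w | y <= Y w] = (sf y)%:E.
Proof. by rewrite /sf fineK// fin_num_measure//; exact: measurable_sf_set. Qed.

Lemma sf_ge0 y : 0 <= sf y.
Proof. by rewrite -lee_fin -sfE. Qed.

Lemma sf_le1 y : sf y <= 1.
Proof. by rewrite -lee_fin -sfE probability_le1//; exact: measurable_sf_set. Qed.

Lemma sf_anti x y : x <= y -> sf y <= sf x.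
Proof.
move=> xy; rewrite -lee_fin -!sfE; apply: le_measure; rewrite ?inE; try exact: measurable_sf_set.
by move=> w /=; exact: le_trans.
Qed.

(* The quantile of order [d / ll k] of [Y], rounded down to the grid of mesh [1 / uu k] in
   [[1 / uu k, uu k]]; [dd k] below rounds real numbers to the same grid. *)
Definition vv k d : R :=
  (grid_count (fun r => (ll k)%:R * (1 - sf (r%:R / (uu k)%:R)) <= d%:R) (uu k ^ 2))%:R / (uu k)%:R.

Definition dd k (y : R) : R :=
  (grid_count (fun r => r%:R / (uu k)%:R <= y) (uu k ^ 2))%:R / (uu k)%:R.

Lemma vv_anti k (d : R) r s : (r <= s)%N -> (ll k)%:R * (1 - sf (s%:R / (uu k)%:R)) <= d ->
  (ll k)%:R * (1 - sf (r%:R / (uu k)%:R)) <= d.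
Proof.
move=> rs; apply: le_trans; rewrite ler_pM2l ?ltr0n ?ll_gt0// lerD2l lerN2.
by apply: sf_anti; rewrite ler_pM2r ?ler_nat// invr_gt0 uuR_gt0.
Qed.

Lemma dd_anti k (y : R) r s : (r <= s)%N -> s%:R / (uu k)%:R <= y -> r%:R / (uu k)%:R <= y.
Proof.
move=> rs; apply: le_trans; by rewrite ler_pM2r ?ler_nat// invr_gt0 uuR_gt0.
Qed.

Lemma vv_ge k d : (d < ll k)%N -> (uu k)%:R^-1 <= vv k d.
Proof.
move=> _; rewrite /vv -[leLHS]mul1r ler_pM2r ?invr_gt0 ?uuR_gt0//.
by rewrite ler1n /grid_count addn_gt0.
Qed.

Lemma uu2_gt0 k : (0 < uu k ^ 2)%N. Proof. by rewrite expn_gt0 uu_gt0. Qed.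

(** Rounding down makes this exact: [X <= vv k d] forces [d >= ll k * (1 - sf X)], and at most
    [ll k * sf X] integers below [ll k] satisfy that. The hypothesis [1 < X] excludes the least grid
    value, to which smaller quantiles are rounded up. *)
Lemma vv_count k (X : R) : 1 < X ->
  (\sum_(0 <= d < ll k) (X <= vv k d)%R)%:R <= (ll k)%:R * sf X.
Proof.
move=> X1; have l0 : 0 <= (ll k)%:R * (1 - sf X) by rewrite mulr_ge0// subr_ge0 sf_le1.
have ll0 : (ll k)%:R * (1 - sf X) <= (ll k)%:R.
  by rewrite ler_piMr// lerBlDl lerDr sf_ge0.
have /andP[_ h] := (count_above (ll k) l0).1 ll0.
apply: (@le_trans _ _ ((ll k)%:R - (ll k)%:R * (1 - sf X))); last by lra.
apply: le_trans h; rewrite ler_nat; apply: leq_sum => d _.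
case: (leP X (vv k d)) => // Xv.
suff -> : (ll k)%:R * (1 - sf X) <= d%:R by [].
have u0 := uuR_gt0 R k.
move: Xv; rewrite /vv ler_pdivlMr//; set m := grid_count _ _ => Xm.
have m2 : (2 <= m)%N.
  rewrite ltnNge; apply/negP => m1.
  have : m%:R <= 1 :> R by rewrite lern1.
  have := uuR_ge1 R k; nra.
have := @grid_count_pos _ (@vv_anti k d%:R) _ m m2 (leqnn _).
apply: le_trans; rewrite ler_pM2l ?ltr0n ?ll_gt0// lerD2l lerN2.
by apply: sf_anti; rewrite ler_pdivlMr.
Qed.

Lemma vv_zone k (X : R) : 1 < X -> (exists2 d, (d < ll k)%N & X <= vv k d) ->
  (ll k)%:R^-1 <= sf X.
Proof.
move=> X1 [d dl Xv]; have l0 : 0 < (ll k)%:R :> R by rewrite ltr0n ll_gt0.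
rewrite -[leLHS]mul1r ler_pdivrMr// mulrC; apply: le_trans (vv_count k X1).
rewrite ler1n big_mkord (bigD1 (Ordinal dl))//= Xv. by rewrite addn_gt0.
Qed.

Lemma dd_cvg (y e : R) : 0 < y -> 0 < e ->
  exists k0, forall k, (k0 <= k)%N -> `|dd k y - y| <= e.
Proof.
move=> y0 e0.
have [k1 h1] := uu_lim y; have [k2 h2] := uu_lim (2 / e); have [k3 h3] := uu_lim (2 / y).
exists (maxn k1 (maxn k2 k3)) => k; rewrite !geq_max => /and3P[/h1 u1 /h2 u2 /h3 u3].
have u0 := uuR_gt0 R k.
rewrite /dd; set b := (fun r => _ <= y).
have bA : forall r s, (r <= s)%N -> b s -> b r by move=> r s; exact: dd_anti.
set m := grid_count _ _.
have ie : (uu k)%:R^-1 <= e / 2.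
  by move: u2; rewrite -[X in _ -> X <= _]mul1r !ler_pdivrMr//; lra.
have iy : (uu k)%:R^-1 <= y / 2.
  by move: u3; rewrite -[X in _ -> X <= _]mul1r !ler_pdivrMr//; lra.
have up : m%:R / (uu k)%:R <= y.
  have [m1|m2] := leqP m 1.
    apply: (@le_trans _ _ (uu k)%:R^-1); last by lra.
    by rewrite -[leRHS]mul1r ler_pM2r ?invr_gt0// lern1.
  exact: (@grid_count_pos _ bA _ m m2 (leqnn _)).
have lo : y - e <= m%:R / (uu k)%:R.
  have [mu2|] := ltnP m (uu k ^ 2).
    have := @grid_count_neg _ bA _ mu2; rewrite /b -ltNge -/m -natr1 mulrDl mul1r; lra.
  rewrite -(ler_nat R) natrX => h.
  have : (uu k)%:R <= m%:R / (uu k)%:R :> R by rewrite ler_pdivlMr// -expr2.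
  lra.
by rewrite ler_norml; apply/andP; split; lra.
Qed.

Context (psi : R -> R) (M : R).
Hypothesis psi0M : forall y, 0 <= psi y <= M.
Hypothesis psi_cont : continuous psi.

Lemma M_ge0 : 0 <= M. Proof. by case/andP: (psi0M 0) => /le_trans; apply. Qed.

Lemma psi_dist x y : `|psi x - psi y| <= M.
Proof.
by have /andP[? ?] := psi0M x; have /andP[? ?] := psi0M y; rewrite ler_norml; apply/andP; split; lra.
Qed.

Local Notation df k r := (psi (r%:R / (uu k)%:R) - psi (r.-1%:R / (uu k)%:R)).

Lemma integral_dd k : (\int[P]_w (psi (dd k (Y w)))%:E)%E =
  (psi (1%:R / (uu k)%:R) + \sum_(2 <= r < (uu k ^ 2).+1) df k r * sf (r%:R / (uu k)%:R))%:E.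
Proof.
have i1 : P.-integrable setT (cst (psi (1%:R / (uu k)%:R))%:E).
  exact: finite_measure_integrable_cst.
have iA r : P.-integrable setT (fun w => (df k r)%:E * (\1_[set w | (r%:R / (uu k)%:R <= Y w)%R] w)%:E)%E.
  by apply: integrableZl => //; apply: integrable_indic => //; exact: measurable_sf_set.
rewrite (eq_integral (fun w => (psi (1%:R / (uu k)%:R))%:E + \sum_(2 <= r < (uu k ^ 2).+1)
   ((df k r)%:E * (\1_[set w | (r%:R / (uu k)%:R <= Y w)%R] w)%:E))%E); last first.
  move=> w _; rewrite sumEFin -EFinD; congr EFin.
  rewrite /dd (@grid_count_telescope _ _ _ (fun m => psi (m%:R / (uu k)%:R))) ?uu2_gt0//; last first.
    by move=> r s; exact: dd_anti.
  congr (_ + _); apply: eq_bigr => r _.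
  by rewrite indicE mulr_natr; congr (_ *+ _); congr nat_of_bool; apply/idP/idP; rewrite inE.
rewrite integralD//; last exact: integrable_sum.
rewrite integral_cst// [X in (_ * X + _)%E]probability_setT mule1 integral_sum// EFinD; congr (_ + _)%E.
rewrite -sumEFin; apply: eq_bigr => r _.
rewrite integralZl//; last by apply: integrable_indic => //; exact: measurable_sf_set.
by rewrite integral_indic//; [rewrite setIT EFinM; congr (_ * _)%E; exact: sfE|exact: measurable_sf_set].
Qed.

Lemma avg_vv k : (\sum_(0 <= d < ll k) psi (vv k d)) / (ll k)%:R =
  psi (1%:R / (uu k)%:R) + \sum_(2 <= r < (uu k ^ 2).+1) df k r *
    ((\sum_(0 <= d < ll k) ((ll k)%:R * (1 - sf (r%:R / (uu k)%:R)) <= d%:R)%R)%:R / (ll k)%:R).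
Proof.
have l0 : 0 < (ll k)%:R :> R by rewrite ltr0n ll_gt0.
apply: (mulIf (lt0r_neq0 l0)); rewrite divfK ?gt_eqF// mulrDl mulr_suml.
rewrite (eq_bigr (fun d => psi (1%:R / (uu k)%:R) + \sum_(2 <= r < (uu k ^ 2).+1)
   df k r *+ ((ll k)%:R * (1 - sf (r%:R / (uu k)%:R)) <= d%:R)%R)); last first.
  move=> d _; rewrite /vv (@grid_count_telescope _ _ _ (fun m => psi (m%:R / (uu k)%:R))) ?uu2_gt0//.
  by move=> r s; exact: vv_anti.
rewrite big_split/= sumr_const_nat subn0 mulr_natr; congr (_ + _).
rewrite exchange_big/=; apply: eq_bigr => r _.
by rewrite -mulrA divfK ?gt_eqF// mulr_natr -sumrMnr.
Qed.

(** Both averages are the same linear combination of [uu k ^ 2 - 1] thresholds. The frequencies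
    differ by at most [1 / ll k = 1 / uu k ^ 3] at each, and the coefficients are at most [M]. *)
Lemma avg_dd k : `|(\sum_(0 <= d < ll k) psi (vv k d)) / (ll k)%:R
   - fine (\int[P]_w (psi (dd k (Y w)))%:E)| <= M / (uu k)%:R.
Proof.
have l0 : 0 < (ll k)%:R :> R by rewrite ltr0n ll_gt0.
have u0 := uuR_gt0 R k.
rewrite integral_dd avg_vv/= opprD addrACA subrr add0r -sumrB.
apply: (le_trans (ler_norm_sum _ _ _)).
apply: (@le_trans _ _ (\sum_(2 <= r < (uu k ^ 2).+1) M / (ll k)%:R)).
  apply: ler_sum => r _; rewrite -mulrBr normrM.
  apply: ler_pM => //; first exact: psi_dist.
  set s := sf _; have s0 : 0 <= s by exact: sf_ge0.
  have s1 : s <= 1 by exact: sf_le1.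
  have a0 : 0 <= (ll k)%:R * (1 - s) by rewrite mulr_ge0// subr_ge0.
  have al : (ll k)%:R * (1 - s) <= (ll k)%:R by rewrite ler_piMr// lerBlDl lerDr.
  have /andP[h1 h2] := (count_above (ll k) a0).1 al.
  rewrite -(ler_pM2r l0) -[X in _ * X <= _](gtr0_norm l0) -normrM mulrBl divfK ?gt_eqF//.
  by rewrite mulVf ?gt_eqF// ler_norml; apply/andP; split; lra.
rewrite sumr_const_nat; have M0 := M_ge0.
apply: (@le_trans _ _ (M / (ll k)%:R *+ (uu k ^ 2))).
  by rewrite -[leLHS]mulr_natr -[leRHS]mulr_natr ler_wpM2l ?divr_ge0// ler_nat subSS leq_subr.
rewrite -mulr_natr natrX /ll natrX.
by rewrite le_eqVlt; apply/orP; left; apply/eqP; field; rewrite gt_eqF.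
Qed.

Lemma measurable_psiY : measurable_fun [set: Om] (fun w => psi (Y w)).
Proof.
apply: (measurableT_comp (f := psi)); first exact: continuous_measurable_fun.
exact: measurable_funPT.
Qed.

Lemma expect_dd_cvg :
  fine (\int[P]_w (psi (dd k (Y w)))%:E) @[k --> \oo] --> fine (\int[P]_w (psi (Y w))%:E).
Proof.
have mdd k : measurable_fun [set: Om] (fun w => psi (dd k (Y w))).
  pose g (w : Om) := psi (1%:R / (uu k)%:R) +
    \sum_(2 <= r < (uu k ^ 2).+1) df k r * \1_[set w | r%:R / (uu k)%:R <= Y w] w.
  rewrite (_ : (fun w => psi (dd k (Y w))) = g).
    apply: measurable_funD => //; apply: measurable_sum => r.
    by apply: measurable_funM => //; apply: measurable_indic; exact: measurable_sf_set.
  apply/funext => w; rewrite /dd /g.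
  rewrite (@grid_count_telescope _ _ _ (fun m => psi (m%:R / (uu k)%:R))) ?uu2_gt0//; last first.
    by move=> r s; exact: dd_anti.
  congr (_ + _); apply: eq_bigr => r _.
  by rewrite indicE mulr_natr; congr (_ *+ _); congr nat_of_bool; apply/idP/idP; rewrite inE.
have [] := @dominated_convergence _ Om R P setT measurableT
  (fun k w => (psi (dd k (Y w)))%:E) (fun w => (psi (Y w))%:E) (cst M%:E).
- by move=> k; apply/measurable_EFinP; exact: mdd.
- by apply/measurable_EFinP; exact: measurable_psiY.
- apply: aeW => w _; apply: cvg_EFin; first by near=> n.
  apply: continuous_cvg; first exact: psi_cont.
  apply/cvgrPdist_le => e e0; have [k0 h] := dd_cvg (Y_gt0 w) e0.
  by exists k0 => // k /= kk; rewrite distrC; exact: h.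
- exact: finite_measure_integrable_cst.
- apply: aeW => w n _; rewrite lee_fin; have /andP[a b] := psi0M (dd n (Y w)).
  by rewrite ger0_norm.
move=> ig _ cv; apply: fine_cvg; rewrite fineK//.
by apply: integrable_fin_num.
Unshelve. all: by end_near. Qed.

Lemma avg_cvg : (\sum_(0 <= d < ll k) psi (vv k d)) / (ll k)%:R @[k --> \oo] -->
  fine (\int[P]_w (psi (Y w))%:E).
Proof.
apply/cvgrPdist_le => e e0.
have e20 : 0 < e / 2 by rewrite divr_gt0.
have /cvgrPdist_le/(_ _ e20)[k1 _ h1] := expect_dd_cvg.
have [k2 h2] := uu_lim (M / (e / 2)).
exists (maxn k1 k2) => // k /=; rewrite geq_max => /andP[k1k k2k].
have /= := h1 _ k1k; have := avg_dd k.
have : M / (uu k)%:R <= e / 2.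
  by have := h2 _ k2k; rewrite ler_pdivrMr// ler_pdivrMr ?uuR_gt0// mulrC.
set a := _ / (ll k)%:R; set b := fine _; set c := fine _ => h3 h4 h5.
rewrite (_ : c - a = (c - b) + (b - a)); last by ring.
apply: (le_trans (ler_normD _ _)); rewrite (distrC b a); lra.
Qed.

Context (mu : probability odoq R).
Hypothesis mu_cyl : forall k p, (p < Q k)%N -> mu [set x | pos qq k x = p] = ((Q k)%:R^-1)%:E.
Local Notation ty := (yty qq ll vv 1).

(** Apply [descent] to the means with bound [E + e], and to their negatives with bound [e - E]. *)
Lemma tmean_cvg : tmean vv mu psi k @[k --> \oo] --> fine (\int[P]_w (psi (Y w))%:E).
Proof.
set E := fine _.
apply/cvgrPdist_le => e e0.
have /cvgrPdist_le/(_ _ e0)[k0 _ h] := avg_cvg.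
have rec k := tmean_rec vv mu_cyl k psi0M.
have q0 k : 0 < (qq k)%:R :> R by rewrite ltr0n qq_gt0.
have l0 k : 0 < (ll k)%:R :> R by rewrite ltr0n ll_gt0.
have recE k : tmean vv mu psi k = (ll k)%:R / (qq k)%:R *
   ((\sum_(0 <= d < ll k) psi (vv k d)) / (ll k)%:R) +
   (1 - (ll k)%:R / (qq k)%:R) * tmean vv mu psi k.+1.
  by rewrite rec; congr (_ + _); field; rewrite ?gt_eqF.
exists k0 => // k /= kk; rewrite ler_norml lerBlDr -lerBlDl; apply/andP; split.
- rewrite lerBrDr addrC -lerBrDr opprK addrC.
  apply: (@descent _ _ (tmean vv mu psi) _ M k0 (resample_rate R) (resample_rate_ge R) _ _ k kk).
    by move=> j; case/andP: (tmean_bound vv mu j psi0M).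
  move=> j jj; rewrite {1}recE lerD2r; apply: ler_wpM2l.
    by case/andP: (resample_rate R j).
  by have := h _ jj; rewrite /= ler_norml => /andP[]; rewrite -/E; lra.
- rewrite -lerN2; apply: (@descent _ _ (fun k => - tmean vv mu psi k) _ 0 k0 (resample_rate R) (resample_rate_ge R) _ _ k kk).
    by move=> j; rewrite oppr_le0; case/andP: (tmean_bound vv mu j psi0M).
  move=> j jj; rewrite {1}recE opprD -!mulrN lerD2r; apply: ler_wpM2l.
    by case/andP: (resample_rate R j).
  by have := h _ jj; rewrite /= ler_norml => /andP[]; rewrite -/E; lra.
Qed.

End sampling.

Section tail_law.
Context (R : realType) (d' : measure_display) (Om : measurableType d')
  (P : probability Om R) (Y : {RV P >-> R}) (mu : probability odoq R).
Hypothesis mu_cyl : forall k p, (p < Q k)%N -> mu [set x | pos qq k x = p] = ((Q k)%:R^-1)%:E.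
Local Notation ty := (yty qq ll (vv Y) 1).

(** By [vv_count] the sampled frequencies are at most [sf Y X] at every level, so [descent] works
    from level 0 on and leaves no error term. *)
Lemma ty_tail_law (X : R) k : 1 < X -> (mu [set x | (X <= ty k x)%R] <= (sf Y X)%:E)%E.
Proof.
move=> X1; pose psi y : R := (X <= y)%R%:R.
have psi01 y : 0 <= psi y <= 1 by rewrite /psi ler0n lern1 leq_b1.
have mA j : measurable ([set x | X <= ty j x] : set odoq).
  exact: (dm_yty qq_gt0 ll (vv Y) 1 j [set y | X <= y]).
have -> : mu [set x | (X <= ty k x)%R] = (tmean (vv Y) mu psi k)%:E.
  rewrite -(tmeanE _ _ _ psi01).
  transitivity (\int[mu]_x (\1_([set x | (X <= ty k x)%R] : set odoq) x)%:E)%E.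
    by rewrite integral_indic// setIT.
  apply: eq_integral => x _; congr EFin.
  by rewrite indicE /psi; congr (nat_of_bool _)%:R; apply/idP/idP; rewrite inE.
rewrite lee_fin.
apply: (@descent _ _ (tmean (vv Y) mu psi) _ 1 0 (resample_rate R) (resample_rate_ge R)) => //.
  by move=> j; case/andP: (tmean_bound (vv Y) mu j psi01).
move=> j _; rewrite {1}(tmean_rec _ mu_cyl _ psi01) lerD2r.
rewrite mulrAC ler_pM2r ?invr_gt0 ?ltr0n ?qq_gt0// -natr_sum; exact: vv_count.
Qed.

End tail_law.

(** * The return sequence *)

Section normalization.
Context {R : realType}.

Lemma level_exists (g : nat -> R) t : g 0%N <= t -> (forall k, k%:R <= g k) ->
  exists k, g k <= t < g k.+1.
Proof.
move=> g0 gk; have ex : exists k, t < g k.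
  by exists (Num.truncn t).+1; apply: lt_le_trans (gk _); exact: truncnS_gt.
case: (ex_minnP ex) => -[|k] tk kmin; first by move: tk; rewrite ltNge g0.
by exists k; rewrite tk andbT leNgt; apply/negP => /kmin; rewrite ltnn.
Qed.

(** About the time needed for [uu k ^ 5] blocks of level [k] and type 1; times between [HH k] and
    [HH k.+1] are treated with level [k]. *)
Definition HH k : R := (uu k)%:R ^+ 5 * (Q k)%:R * BB R k.

Lemma HH0 : HH 0 = 1. Proof. by rewrite /HH /= Qn0 expr1n !mulr1. Qed.

Lemma HH_gt0 k : 0 < HH k.
Proof. by rewrite !mulr_gt0 ?exprn_gt0 ?uuR_gt0 ?QR_gt0 ?BB_gt0. Qed.

Lemma HH_ratio k : (uu k)%:R * HH k <= HH k.+1.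
Proof.
have u0 := uuR_gt0 R k; have u1 := uuR_ge1 R k.
have ule : ((uu k)%:R <= (uu k.+1)%:R :> R) by rewrite ler_nat uu_leS.
rewrite /HH (_ : _ * _ = (uu k)%:R ^+ 6 * (Q k)%:R * BB R k); last by ring.
apply: ler_pM; rewrite ?mulr_ge0 ?exprn_ge0 ?BB_leS//; try exact/ltW.
  exact/ltW/BB_gt0.
apply: (@le_trans _ _ ((uu k)%:R ^+ 5 * (Q k.+1)%:R)); last first.
  by rewrite ler_pM2r ?QR_gt0// lerXn2r ?nnegrE.
rewrite exprSr -mulrA ler_pM2l ?exprn_gt0// QnS natrM ler_pM2r ?QR_gt0//.
rewrite ler_nat /qq -[leqLHS]mul1n; apply: leq_mul => //.
by rewrite -{1}(expn1 (uu k)) leq_pexp2l// uu_gt0.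
Qed.

Lemma HH_leS k : HH k <= HH k.+1.
Proof.
apply: le_trans (HH_ratio k); rewrite ler_peMl//; [exact/ltW/HH_gt0|exact: uuR_ge1].
Qed.

Lemma HH_mono k n : (k <= n)%N -> HH k <= HH n.
Proof.
move/subnK <-; elim: (n - k)%N => // i IH; rewrite addSn.
exact: (le_trans IH (HH_leS _)).
Qed.

Lemma BB_le_HH k : BB R k <= HH k.
Proof.
rewrite /HH ler_peMl ?(ltW (BB_gt0 _ _))// -natrX -natrM ler1n muln_gt0 Q_gt0 andbT.
by rewrite expn_gt0 uu_gt0.
Qed.

Lemma HH_ge k : k%:R <= HH k.
Proof.
by apply: le_trans (BB_le_HH k); apply: le_trans (BB_ge R k); rewrite ler_nat.
Qed.

(* Junk value 0 for [t < 1]. *)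
Definition kk (t : R) : nat := xget 0%N [set k | HH k <= t < HH k.+1].

Lemma kkP t : 1 <= t -> HH (kk t) <= t < HH (kk t).+1.
Proof.
rewrite -HH0 => t1; have [k hk] := level_exists t1 HH_ge.
exact: (xgetPex 0%N (ex_intro (fun k => HH k <= t < HH k.+1) k hk)).
Qed.

Lemma kk_ge k t : HH k <= t -> (k <= kk t)%N.
Proof.
move=> kt; have t1 : 1 <= t by apply: le_trans kt; rewrite -HH0 HH_mono.
have /andP[_ h] := kkP t1; rewrite leqNgt; apply/negP => /HH_mono h2.
by have := lt_le_trans h (le_trans h2 kt); rewrite ltxx.
Qed.

Lemma kk_lt k t : 1 <= t -> t < HH k.+1 -> (kk t <= k)%N.
Proof.
move=> t1 kt; have /andP[h _] := kkP t1; rewrite leqNgt; apply/negP => /HH_mono h2.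
by have := lt_le_trans kt (le_trans h2 h); rewrite ltxx.
Qed.

Lemma kk_unbounded k0 : exists n0, forall n : nat, (n0 <= n)%N ->
  1 <= n%:R :> R /\ (k0 <= kk n%:R)%N.
Proof.
exists (Num.truncn (HH k0)).+1 => n nn.
have Hn : HH k0 <= n%:R by apply: (le_trans (ltW (truncnS_gt _))); rewrite ler_nat.
by split; [apply: le_trans Hn; rewrite -HH0 HH_mono|exact: kk_ge].
Qed.

(* The factor [1 + 10 / uu] beats the loss [5 / uu] of [tow_time_ge]; this makes the tail
   bound hold for every [x > 1]. *)
Definition beta t : R := (1 + 10 / (uu (kk t))%:R) / BB R (kk t).

Definition aa t : R := beta t * t.

Lemma beta_gt0 t : 0 < beta t.
Proof. by rewrite divr_gt0 ?BB_gt0// addr_gt0// divr_gt0// uuR_gt0. Qed.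

(** The ratios [HH k.+1 / HH k] tend to infinity, so [s] and [t] belong to the same or to
    consecutive levels. Between these [BB] changes by the factor [1 + 1 / uu k], and the correction
    by at most [1 + 10 / uu k]; the constant 21 covers both generously. *)
Lemma beta_step (X e : R) : 0 < e -> exists k0, forall s t, HH k0 <= s -> s <= t -> t <= X * s ->
  (1 - e) * beta s <= beta t <= beta s.
Proof.
move=> e0; have [k1 h1] := uu_lim (21 / e); have [k2 h2] := uu_lim X.
exists (maxn k1 k2) => s t Hs st tX.
set k := kk s; have : (maxn k1 k2 <= k)%N by exact: kk_ge.
rewrite geq_max => /andP[/h1 u1 k2k].
have s1 : 1 <= s by apply: le_trans Hs; rewrite -HH0 HH_mono.
have t1 : 1 <= t by exact: le_trans st.
have /andP[ks sk] := kkP s1; rewrite -/k in ks sk.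
have u0 := uuR_gt0 R k.
have w21 : 21 * (uu k)%:R^-1 <= e by move: u1; rewrite ler_pdivrMr// mulrC -ler_pdivrMr.
set w := (uu k)%:R^-1 in w21; have w0 : 0 < w by rewrite invr_gt0.
have w1 : w <= 1 by rewrite invf_le1// uuR_ge1.
have B0 := BB_gt0 R k.
have kt1 : (k <= kk t)%N by apply: kk_ge; exact: le_trans st.
have kt2 : (kk t <= k.+1)%N.
  apply: kk_lt => //; apply: (le_lt_trans tX).
  have [X0|X0] := leP X 0; first by apply: (le_lt_trans _ (HH_gt0 _)); rewrite mulr_le0_ge0//; lra.
  apply: (@lt_le_trans _ _ (X * HH k.+1)); first by rewrite ltr_pM2l.
  apply: le_trans (HH_ratio k.+1); rewrite ler_pM2r ?HH_gt0//.
  by apply: h2; exact: leqW.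
move: kt1; rewrite leq_eqVlt => /orP[/eqP kE|kl].
  rewrite /beta -kE -/k lexx andbT ler_piMl//; last by lra.
  by rewrite divr_ge0// ?ltW// addr_ge0// divr_ge0// ltW.
have -> : beta t = (1 + 10 / (uu k.+1)%:R) / (BB R k * (1 + w)).
  by rewrite /beta (_ : kk t = k.+1)//; apply/eqP; rewrite eqn_leq kt2.
have -> : beta s = (1 + 10 * w) / BB R k by [].
have iw : (uu k.+1)%:R^-1 <= w by rewrite lef_pV2 ?posrE ?uuR_gt0// ler_nat uu_leS.
have iw0 : 0 < (uu k.+1)%:R^-1 :> R by rewrite invr_gt0 uuR_gt0.
set z := (uu k.+1)%:R^-1 in iw iw0 *; set b := (BB R k)^-1.
have b0 : 0 < b by rewrite invr_gt0.
have w10 : 0 < 1 + w by lra.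
have -> : (1 + 10 * z) / (BB R k * (1 + w)) = (1 + 10 * z) / (1 + w) * b.
  by rewrite /b; field; rewrite !gt_eqF.
rewrite mulrA !ler_pM2r//.
rewrite ler_pdivrMr// ler_pdivlMr//; apply/andP; split; last by nra.
apply: (@le_trans _ _ ((1 - 21 * w) * (1 + 10 * w) * (1 + w))).
  by rewrite -!mulrA ler_pM2r ?mulr_gt0//; lra.
nra.
Qed.

(** By [beta_step] the factor [beta] is slowly varying; for [x < 1] the roles of [t] and [x * t] are
    exchanged. *)
Lemma aa_regular : regularly_varying1 aa.
Proof.
split=> [t t0|x x0]; first by rewrite mulr_gt0// beta_gt0.
apply/cvgrPdist_le => e e0.
pose e' := Num.min (2^-1) (e / (2 * x)).
have e'0 : 0 < e' by rewrite lt_min invr_gt0 ltr0n/= divr_gt0// mulr_gt0.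
have e'1 : e' <= 2^-1 by rewrite ge_min lexx.
have e'2 : 2 * (x * e') <= e.
  have : e' <= e / (2 * x) by rewrite ge_min lexx orbT.
  by rewrite ler_pdivlMr ?mulr_gt0//; lra.
have [k0 h] := beta_step (Num.max x x^-1) e'0.
have [x1|x1] := leP 1 x.
  near=> t.
  have t0 : 0 < t by near: t; exact: nbhs_pinfty_gt.
  have Ht : HH k0 <= t by near: t; exact: nbhs_pinfty_ge (num_real _).
  have /andP[h1 h2] : (1 - e') * beta t <= beta (x * t) <= beta t.
    apply: h => //; first by rewrite ler_peMl// ltW.
    by rewrite ler_pM2r// le_max lexx.
  have bt := beta_gt0 t.
  have -> : aa (x * t) / aa t = x * (beta (x * t) / beta t).
    by rewrite /aa; field; rewrite ?gt_eqF.
  set r := beta (x * t) / beta t.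
  have r1 : 1 - e' <= r by rewrite ler_pdivlMr.
  have r2 : r <= 1 by rewrite ler_pdivrMr// mul1r.
  rewrite ler_norml; apply/andP; split; nra.
near=> t.
have t0 : 0 < t by near: t; exact: nbhs_pinfty_gt.
have Ht : HH k0 / x <= t by near: t; exact: nbhs_pinfty_ge (num_real _).
have bt := beta_gt0 t; have bxt := beta_gt0 (x * t).
have /andP[h1 h2] : (1 - e') * beta (x * t) <= beta t <= beta (x * t).
  apply: h; first by move: Ht; rewrite ler_pdivrMr// mulrC.
    by rewrite ler_piMl ?ltW.
  rewrite mulrA -[leLHS]mul1r ler_pM2r// -ler_pdivrMr// mul1r le_max lexx orbT //.
have -> : aa (x * t) / aa t = x * (beta (x * t) / beta t).
  by rewrite /aa; field; rewrite ?gt_eqF.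
set r := beta (x * t) / beta t.
have r1 : 1 <= r by rewrite ler_pdivlMr// mul1r.
have r2 : (1 - e') * r <= 1 by rewrite mulrA ler_pdivrMr// mul1r.
have r3 : r <= 2 by nra.
rewrite ler_norml; apply/andP; split; nra.
Unshelve. all: by end_near. Qed.

End normalization.

(** * Windows adapted to a given time *)

Section windows.
Context (R : realType) (v : nat -> nat -> R).
Hypothesis v_ge : forall k d, (d < ll k)%N -> (uu k)%:R^-1 <= v k d.
Implicit Types (x : odoq).
Local Notation ty := (yty qq ll v 1).
Local Notation tau_ i := (iter i (tau qq)).
Local Notation ttime := (@tow_time _ odoq (tau qq) (phi v)).

Lemma Q_gt k : (k < Q k)%N.
Proof.
elim: k => [|k IH]; first by rewrite Qn0.
by apply: leq_ltn_trans IH _; exact: Q_ltS.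
Qed.

Lemma uQ_mono p k n : (k <= n)%N -> (uu k ^ p * Q k <= uu n ^ p * Q n)%N.
Proof.
move=> kn; apply: leq_mul; last by apply: leq_Qn => //; exact: qq_gt0.
by case: p => // p; rewrite leq_exp2r// uu_mono.
Qed.

Lemma truncn_le_real (r : R) : 0 <= r -> (Num.truncn r)%:R <= r.
Proof. by move=> r0; rewrite truncn_le. Qed.

Lemma truncn_gt_real (r : R) : r - 1 < (Num.truncn r)%:R.
Proof. by have := truncnS_gt r; rewrite -natr1; lra. Qed.

Lemma aaE n : 1 <= n -> aa n = (1 + 10 / (uu (kk n))%:R) * (n / BB R (kk n)).
Proof. by move=> _; rewrite /aa /beta mulrAC mulrA. Qed.

(** As [X] is unbounded, [N] may lie far above the scale of [n], so the level is adapted to [N]: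
    [tow_time_ge] is applied at level [k'] and the types are read at level [k'.+1]. A higher level
    only helps, since [BB] increases. In the time bound [X * a * BB / X] the factor [X] cancels,
    whence the uniformity in [X]. *)
Lemma tail_window : exists n0, forall n, (n0 <= n)%N -> forall X : R, 1 < X ->
  exists N k, [/\ (N <= uu k ^ 5 * Q k)%N, N%:R <= X * aa n%:R &
    forall x, (forall i, (i < N)%N -> ty k (tau_ i x) <= X) -> (n < ttime N x)%N].
Proof.
have [k0 h0] := uu_lim (20 : R).
have [n0 hn0] := @kk_unbounded R k0; exists n0 => n /hn0[n1 k0k] X X1.
set k := kk (n%:R : R) in k0k.
have /andP[kn nk] := kkP n1; rewrite -/k in kn nk.
have u20 : 20 <= (uu k)%:R :> R by exact: h0.
have B0 := BB_gt0 R k; have u0 := uuR_gt0 R k.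
set u : R := (uu k)%:R in u20 u0.
set a := aa n%:R.
have aE : a = (1 + 10 / u) * (n%:R / BB R k) by rewrite /a aaE.
have nB : u ^+ 5 * (Q k)%:R <= n%:R / BB R k by rewrite ler_pdivlMr.
have iu0 : 0 < u^-1 by rewrite invr_gt0.
have nB0 : 0 < n%:R / BB R k by rewrite divr_gt0// (lt_le_trans ltr01).
have an : n%:R / BB R k <= a by rewrite aE ler_peMl//; lra.
have a0 : 0 < a by lra.
have aX : a <= X * a by rewrite ler_peMl; lra.
pose N := Num.truncn (X * a).
have Xa0 : 0 <= X * a by lra.
have NX : N%:R <= X * a by exact: truncn_le_real.
have uN : (uu k ^ 5 * Q k <= N)%N.
  rewrite /N truncn_ge_nat// natrM natrX -/u; lra.
have [k' /andP[k1 k2]] : exists k', (uu k' ^ 5 * Q k')%:R <= (N%:R : R) < (uu k'.+1 ^ 5 * Q k'.+1)%:R.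
  apply: level_exists => [|j].
    by rewrite ler_nat; apply: leq_trans uN; exact: uQ_mono.
  rewrite ler_nat; apply: (@leq_trans (Q j)); first exact: ltnW (Q_gt j).
  by rewrite leq_pmull// expn_gt0 uu_gt0.
move: k1 k2; rewrite ler_nat ltr_nat => k1 k2.
have kk' : (k <= k')%N.
  rewrite leqNgt; apply/negP => /(uQ_mono 5) h.
  by have := leq_trans k2 (leq_trans h uN); rewrite ltnn.
exists N, k'.+1; split => //; first exact: ltnW.
move=> x tyX.
have X0 : 0 < X by lra.
have k4 : (uu k' ^ 4 * Q k' <= N)%N.
  by apply: leq_trans k1; rewrite leq_mul2r leq_pexp2l ?orbT// uu_gt0.
have := tow_time_ge v_ge k4 X0 tyX; rewrite -(ltr_nat R); apply: lt_le_trans.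
have uk' : u <= (uu k')%:R by rewrite ler_nat uu_mono.
have BB' : BB R k <= BB R k' by exact: BB_mono.
have NXa : (1 - u^-1) * (X * a) <= N%:R.
  have := truncn_gt_real (X * a); rewrite -/N.
  suff : 1 <= u^-1 * (X * a) by lra.
  rewrite mulrC ler_pdivlMr// mul1r.
  have u5 : u ^+ 5 <= X * a.
    have : u ^+ 5 <= u ^+ 5 * (Q k)%:R by rewrite ler_peMr ?exprn_ge0 ?ler1n ?Q_gt0// ltW.
    lra.
  by apply: le_trans u5; rewrite -[leLHS]expr1 ler_weXn2l//; lra.
have w20 : u^-1 <= 20^-1 by rewrite lef_pV2 ?posrE.
have w1 : 0 <= 1 - u^-1 by lra.
apply: (@lt_le_trans _ _ ((1 - 5 / u) * ((1 - u^-1) * (X * a) * BB R k / X))); last first.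
  have h5 : 5 / (uu k')%:R <= 5 / u by rewrite ler_pM2l// lef_pV2 ?posrE ?uuR_gt0.
  apply: ler_pM; [lra| |lra|].
    exact: divr_ge0 (mulr_ge0 (mulr_ge0 w1 Xa0) (ltW B0)) (ltW X0).
  rewrite ler_pM2r ?invr_gt0//; apply: ler_pM; [|exact: ltW|exact: NXa|exact: BB'].
  exact: mulr_ge0 w1 Xa0.
(* For [w = 1 / u <= 1 / 20] the product [(1 - 5 w) (1 - w) (1 + 10 w)] exceeds 1. The three factors
   come from [tow_time_ge], from rounding [N], and from [beta]. *)
have -> : (1 - 5 / u) * ((1 - u^-1) * (X * a) * BB R k / X) =
   (1 - 5 * u^-1) * (1 - u^-1) * (1 + 10 * u^-1) * n%:R.
  by rewrite aE; field; rewrite !gt_eqF.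
rewrite ltr_pMl; last by lra.
set w := u^-1 in iu0 w20 *; nra.
Qed.

Context (mu : probability odoq R).
Hypothesis mu_cyl : forall k p, (p < Q k)%N -> mu [set x | pos qq k x = p] = ((Q k)%:R^-1)%:E.

(** The length [Nf y] may depend on the type, since the type is constant on the blocks in which the
    points are counted. The predicate [C] selects the types with an admissible length. *)
Lemma concentration_measure (eta e M : R) : 0 < eta -> 0 < e -> 0 < M ->
  exists k0, forall k, (k0 <= k)%N -> forall (C : R -> bool) (Nf : R -> nat),
  (forall y, C y -> [/\ y <= M, (uu k ^ 4 * Q k <= Nf y)%N &
     (Nf y <= uu k.+1 ^ 6 * Q k.+1)%N]) ->
  exists E : set odoq, [/\ measurable E, (mu E <= e%:E)%E &
    forall x, ~ E x -> C (ty k.+2 x) ->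
    (1 - eta) * ((Nf (ty k.+2 x))%:R * BB R k / ty k.+2 x) <= (ttime (Nf (ty k.+2 x)) x)%:R <=
    (1 + eta) * ((Nf (ty k.+2 x))%:R * BB R k / ty k.+2 x)].
Proof.
move=> eta0 e0 M0; have [k0 h] := tow_time_concentration v_ge eta0 e0 M0.
exists k0 => k kk0 C Nf hC.
pose b (m : nat) (y : R) := C y && ~~ ((1 - eta) * ((Nf y)%:R * BB R k / y) <= m%:R <=
    (1 + eta) * ((Nf y)%:R * BB R k / y)).
pose E : set odoq := [set x | b (ttime (Nf (ty k.+2 x)) x) (ty k.+2 x)].
have mty := dm_yty qq_gt0 ll v 1 k.+2.
have mE : measurable E.
  have mt : dm (fun x : odoq => ttime (Nf (ty k.+2 x)) x).
    apply: (dm_bind (g := ttime) (dm_comp Nf mty)) => N.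
    by apply: dm_sum => i; apply: dm_iter; [exact: qq_gt0|exact: (dm_phi v)].
  exact: (dm_pair mt mty [set my | b my.1 my.2]).
exists E; split => //.
  have -> : (e%:E = ((e * (Q k.+2)%:R) / (Q k.+2)%:R)%:E)%E.
    by rewrite mulfK// gt_eqF// QR_gt0.
  apply: (count_leT qq_gt0 mu_cyl mE); first by rewrite mulr_ge0// ltW.
  move=> x x0; have [Cx|nCx] := boolP (C (ty k.+2 x)); last first.
    rewrite big_nat big1 ?mulr_ge0//; first exact: ltW.
    move=> p /andP[_ pQ]; rewrite indicE memNset//.
    by rewrite /E/= /b ty_block ?x0// (negbTE nCx).
  have [yM N1 N2] := hC _ Cx.
  apply: le_trans (h k kk0 x _ x0 yM N1 N2).
  rewrite !big_nat; apply: ler_sum => p /andP[_ pQ].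
  rewrite indicE ler_nat; have [/set_mem|//] := boolP (iter p (tau qq) x \in E).
  by rewrite /E/= /b ty_block ?x0// => /andP[_ ->].
move=> x nE Cx; apply/negPn/negP => h1; apply: nE; by rewrite /E/= /b Cx.
Qed.

(* Types below [dl] are treated in the upper estimate as if they were [dl]; so no lower bound
   on the types is needed. *)
Lemma tower_window (eta e dl M : R) : 0 < eta <= 4^-1 -> 0 < e -> 0 < dl <= M ->
  exists n0, forall n, (n0 <= n)%N -> exists E : set odoq,
  [/\ measurable E, (mu E <= e%:E)%E &
   forall x, ~ E x -> ty (kk (n%:R : R)).+2 x <= M ->
   let y := ty (kk (n%:R : R)).+2 x in let t : R := n%:R / BB R (kk (n%:R : R)) in
   (n < ttime (Num.truncn ((1 + 2 * eta) * Num.max y dl * t)).+1 x)%N /\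
   (dl <= y -> (ttime (Num.truncn ((1 - 2 * eta) * y * t)) x <= n)%N)].
Proof.
move=> /andP[eta0 eta4] e0 /andP[dl0 dlM].
have M0 : 0 < M by lra.
have e20 : 0 < e / 2 by rewrite divr_gt0.
have [k1 h1] := concentration_measure eta0 e20 M0.
(* These two bounds keep the lengths [Np] and [Nm], for types between [dl] and [M], in the range
   required by [concentration_measure]. *)
have [k2 h2] := uu_lim (4 / dl).
have [k3 h3] := uu_lim (4 * M + 1).
have [n' hn'] := @kk_unbounded R (maxn k1 (maxn k2 k3)).
exists n' => n /hn'[n1]; set k := kk (n%:R : R).
rewrite !geq_max => /and3P[k1k k2k k3k].
have n0 : 0 < n%:R :> R by lra.
have /andP[kn nk] := kkP n1; rewrite -/k in kn nk.
have B0 := BB_gt0 R k; have u0 := uuR_gt0 R k; have u1 := uuR_ge1 R k.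
have Qk0 := QR_gt0 R k; have Qk1 := QR_gt0 R k.+1.
pose t : R := n%:R / BB R k.
have t0 : 0 < t by rewrite divr_gt0.
have udl : 4 <= dl * (uu k)%:R by have := h2 _ k2k; rewrite ler_pdivrMr// mulrC.
have uM : 4 * M + 1 <= (uu k.+1)%:R by apply: h3; exact: leqW.
have tlo : (uu k)%:R ^+ 5 * (Q k)%:R <= t by rewrite ler_pdivlMr.
have u'0 := uuR_gt0 R k.+1; have u'1 := uuR_ge1 R k.+1.
have thi : t <= 2 * ((uu k.+1)%:R ^+ 5 * (Q k.+1)%:R).
  rewrite ler_pdivrMr//; apply: (le_trans (ltW nk)).
  rewrite /HH; set w : R := (uu k.+1)%:R ^+ 5 * (Q k.+1)%:R.
  have w0 : 0 < w by rewrite mulr_gt0 ?exprn_gt0.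
  apply: (@le_trans _ _ (w * (2 * BB R k))); last by rewrite mulrCA mulrA.
  by rewrite (ler_pM2l w0); exact: BBS2.
have ulo (r : R) : 2^-1 * dl * t <= r -> (uu k ^ 4 * Q k <= Num.truncn r)%N.
  move=> hr.
  have : 2^-1 * dl * ((uu k)%:R ^+ 5 * (Q k)%:R) <= r.
    by apply: le_trans hr; rewrite ler_pM2l// mulr_gt0.
  have -> : 2^-1 * dl * ((uu k)%:R ^+ 5 * (Q k)%:R) =
     2^-1 * (dl * (uu k)%:R) * ((uu k)%:R ^+ 4 * (Q k)%:R) by ring.
  have w0 : 0 < (uu k)%:R ^+ 4 * (Q k)%:R :> R by rewrite mulr_gt0 ?exprn_gt0.
  move=> hr2; rewrite truncn_ge_nat ?natrM ?natrX; first by nra.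
  by apply: le_trans hr2; rewrite !mulr_ge0// ltW.
have uhi (r : R) : 0 <= r -> r <= 2 * M * t -> (Num.truncn r < uu k.+1 ^ 6 * Q k.+1)%N.
  move=> r0 hr; rewrite -(ltr_nat R) (le_lt_trans (truncn_le_real r0))//.
  rewrite natrM natrX; set w : R := (uu k.+1)%:R ^+ 5 * (Q k.+1)%:R in thi.
  have w0 : 0 < w by rewrite mulr_gt0 ?exprn_gt0.
  have -> : (uu k.+1)%:R ^+ 6 * (Q k.+1)%:R = (uu k.+1)%:R * w by rewrite mulrA -exprS.
  have := BBS2 R k; nra.
pose Np (y : R) := (Num.truncn ((1 + 2 * eta) * Num.max y dl * t)).+1.
pose Nm (y : R) := Num.truncn ((1 - 2 * eta) * y * t).
have rp y : 0 < y <= M -> [/\ y <= M, (uu k ^ 4 * Q k <= Np y)%N &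
    (Np y <= uu k.+1 ^ 6 * Q k.+1)%N].
  move=> /andP[y0 yM].
  have m0 : 0 < Num.max y dl by rewrite lt_max y0.
  have mM : Num.max y dl <= M by rewrite ge_max yM.
  have mt : dl * t <= Num.max y dl * t by rewrite ler_pM2r// le_max lexx orbT.
  have mt0 : 0 < Num.max y dl * t by exact: mulr_gt0.
  have mt2 : Num.max y dl * t <= M * t by rewrite ler_pM2r.
  split => //.
    apply: (leq_trans _ (leqnSn _)); apply: ulo; rewrite -!mulrA; nra.
  apply: uhi; rewrite -!mulrA; nra.
have rm y : dl <= y <= M -> [/\ y <= M, (uu k ^ 4 * Q k <= Nm y)%N &
    (Nm y <= uu k.+1 ^ 6 * Q k.+1)%N].
  move=> /andP[y0 yM].
  have mt : dl * t <= y * t by rewrite ler_pM2r.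
  have mt0 : 0 < dl * t by exact: mulr_gt0.
  have mt2 : y * t <= M * t by rewrite ler_pM2r.
  split => //.
    apply: ulo; rewrite -!mulrA; nra.
  apply: ltnW; apply: uhi; rewrite -!mulrA; nra.
have [Ep [mEp Ep_le hEp]] := h1 k k1k _ _ rp.
have [Em [mEm Em_le hEm]] := h1 k k1k _ _ rm.
exists (Ep `|` Em); split; first exact: measurableU.
  apply: (le_trans (measureU2 _ mEp mEm)).
  by rewrite (splitr e) EFinD; exact: leeD.
move=> x nE yM y; rewrite -/t; have y0 : 0 < y by exact: (ty_gt0 v_ge).
have tB : t * BB R k = n%:R by rewrite /t divfK ?gt_eqF.
split.
  have /andP[h4 _] : (1 - eta) * ((Np y)%:R * BB R k / y) <= (ttime (Np y) x)%:R <=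
    (1 + eta) * ((Np y)%:R * BB R k / y).
    by apply: hEp; [move=> h; apply: nE; left|rewrite -/y y0].
  rewrite -(ltr_nat R); apply: lt_le_trans h4.
  have h5 : (1 + 2 * eta) * n%:R <= (Np y)%:R * BB R k / y.
    rewrite ler_pdivlMr// -tB -mulrA (mulrC _ y) mulrA [leLHS]mulrA ler_pM2r//.
    apply: le_trans (ltW (truncnS_gt _)).
    rewrite -mulrA -[leRHS]mulrA ler_pM2l; last by lra.
    by rewrite ler_pM2r// le_max lexx.
  apply: (@lt_le_trans _ _ ((1 - eta) * ((1 + 2 * eta) * n%:R))).
    rewrite mulrA -[ltLHS]mul1r ltr_pM2r//; nra.
  by rewrite ler_pM2l//; lra.
move=> dly.
have /andP[_ h4] : (1 - eta) * ((Nm y)%:R * BB R k / y) <= (ttime (Nm y) x)%:R <=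
    (1 + eta) * ((Nm y)%:R * BB R k / y).
  by apply: hEm; [move=> h; apply: nE; right|rewrite -/y dly].
rewrite -(ler_nat R); apply: le_trans h4 _.
have h5 : (Nm y)%:R * BB R k / y <= (1 - 2 * eta) * n%:R.
  rewrite ler_pdivrMr// -tB -mulrA (mulrC _ y) mulrA [leRHS]mulrA ler_pM2r//.
  have e2 : 0 <= 1 - 2 * eta by lra.
  exact: (truncn_le_real (mulr_ge0 (mulr_ge0 e2 (ltW y0)) (ltW t0))).
apply: (@le_trans _ _ ((1 + eta) * ((1 - 2 * eta) * n%:R))).
  by rewrite ler_pM2l//; lra.
rewrite mulrA -[leRHS]mul1r ler_pM2r//; nra.
Qed.

End windows.

(** * Distributional limits *)

Section real_bounds.
Context (R : realFieldType).
Implicit Types (c y M eta w a t rho N s dl j : R).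

(** Bookkeeping for the lower half of [ratio_close]: [N] is about [y * t], [t] about [a], and [s] is
    the error of the ergodic theorem. *)
Lemma lower_real c y M eta w a t rho N s : 0 <= c -> 0 <= y <= M -> 0 <= eta <= 4^-1 ->
  0 <= w -> 0 < a -> (1 - 10 * w) * a <= t -> 16 * (c * M * eta) <= rho ->
  80 * (c * M * w) <= rho -> 8 * c <= rho * a -> (1 - 2 * eta) * y * t - 1 <= N ->
  s <= rho / 8 * a -> (c * y - rho) * a <= c * N - s - rho / 8 * a.
Proof.
move=> c0 /andP[y0 yM] /andP[eta0 eta4] w0 a0 at1 ceta cw ca tN sa.
have e1 : c * ((1 - 2 * eta) * y * t - 1) <= c * N by rewrite ler_wpM2l.
have e2 : c * ((1 - 2 * eta) * y) * ((1 - 10 * w) * a) <= c * ((1 - 2 * eta) * y) * t.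
  by rewrite ler_wpM2l// !mulr_ge0//; lra.
have e3 : 0 <= c * y * a * (eta * w) by rewrite !mulr_ge0// ltW.
have cyM : c * y <= c * M by rewrite ler_wpM2l.
have e4 : c * y * eta * a <= c * M * eta * a by rewrite ler_pM2r// ler_wpM2r.
have e5 : c * y * w * a <= c * M * w * a by rewrite ler_pM2r// ler_wpM2r.
have e6 : 16 * (c * M * eta) * a <= rho * a by rewrite ler_pM2r.
have e7 : 80 * (c * M * w) * a <= rho * a by rewrite ler_pM2r.
have e8 : 0 <= c * M * eta by rewrite !mulr_ge0//; lra.
have e9 : 0 <= rho * a by rewrite mulr_ge0//; lra.
lra.
Qed.

Lemma upper_real c y M dl eta a t rho N s j : 0 <= c -> 0 <= y <= M -> 0 <= dl <= M ->
  0 <= eta -> 0 <= t <= a -> 0 < a -> 16 * (c * M * eta) <= rho -> 8 * (c * dl) <= rho ->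
  8 * c * (j + 2) <= rho * a -> N <= (1 + 2 * eta) * Num.max y dl * t + 1 ->
  s <= rho / 8 * a -> c * (N + j) + s <= (c * y + rho) * a.
Proof.
move=> c0 /andP[y0 yM] /andP[dl0 dlM] eta0 /andP[t0 ta] a0 ceta cdl cj tN sa.
have my : Num.max y dl <= y + dl by rewrite ge_max lerDl lerDr dl0 y0.
have m0 : 0 <= Num.max y dl by rewrite le_max y0.
set mx := Num.max y dl in my m0 tN.
have e1 : c * N <= c * ((1 + 2 * eta) * mx * t + 1) by rewrite ler_wpM2l.
have e2 : c * ((1 + 2 * eta) * mx) * t <= c * ((1 + 2 * eta) * mx) * a.
  by rewrite ler_wpM2l// !mulr_ge0//; lra.
have e3 : c * (1 + 2 * eta) * a * mx <= c * (1 + 2 * eta) * a * (y + dl).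
  by rewrite ler_wpM2l// !mulr_ge0// ?ltW//; lra.
have ydl : c * eta * a * (y + dl) <= c * eta * a * (2 * M).
  by rewrite ler_wpM2l ?mulr_ge0 ?(ltW a0)//; lra.
have e6 : 16 * (c * M * eta) * a <= rho * a by rewrite ler_pM2r.
have e7 : 8 * (c * dl) * a <= rho * a by rewrite ler_pM2r.
have e8 : 0 <= c * dl by rewrite mulr_ge0.
have e9 : 0 <= rho * a by rewrite mulr_ge0//; lra.
lra.
Qed.

End real_bounds.

Section ratio.
Context (R : realType) (v : nat -> nat -> R).
Hypothesis v_ge : forall k d, (d < ll k)%N -> (uu k)%:R^-1 <= v k d.
Context (mu : probability odoq R).
Hypothesis mu_cyl : forall k p, (p < Q k)%N -> mu [set x | pos qq k x = p] = ((Q k)%:R^-1)%:E.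
Implicit Types (x : odoq).
Local Notation ty := (yty qq ll v 1).
Local Notation tau_ i := (iter i (tau qq)).
Local Notation ttime := (@tow_time _ odoq (tau qq) (phi v)).
Local Notation T := (@tow_map _ odoq (tau qq) (phi v)).
Local Notation m := (@tow_measure _ odoq R mu (phi v) (dm_phi v)).

Lemma aa_large (A : R) : exists n0, forall n, (n0 <= n)%N ->
  [/\ 1 <= n%:R :> R, A <= (uu (kk (n%:R : R)))%:R :> R & A <= n%:R / BB R (kk (n%:R : R))].
Proof.
have [k0 h0] := uu_lim A; have [n0 hn0] := @kk_unbounded R k0.
exists n0 => n /hn0[n1 /h0 Ak]; have /andP[kn nk] := kkP n1.
split => //; apply: (le_trans Ak); rewrite ler_pdivlMr ?BB_gt0//; apply: le_trans kn.
rewrite /HH ler_pM2r ?BB_gt0// -natrX -natrM ler_nat.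
apply: (@leq_trans (uu (kk (n%:R : R)) ^ 5)); last by rewrite leq_pmulr// Q_gt0.
by rewrite -{1}[uu _]expn1 leq_pexp2l// uu_gt0.
Qed.

(** Up to time [n] the base is visited about [y * t] times by [tower_window], and by [mean_ergodic]
    each visit contributes [c] on average. The exceptional set also contains the points with a large
    first column, which a start at height [j] may miss. *)
Lemma ratio_close (f : odoq * nat -> \bar R) (c M rho e : R) (J : nat) :
  measurable_fun setT f -> (forall z, 0 <= f z)%E -> (\int[m]_z f z = c%:E)%E ->
  0 < M -> 0 < rho -> 0 < e ->
  exists n0, forall n, (n0 <= n)%N -> exists E : set odoq,
  [/\ measurable E, (mu E <= e%:E)%E &
   forall x j, ~ E x -> (j < phi v x)%N -> (j <= J)%N -> ty (kk (n%:R : R)).+2 x <= M ->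
   ((c * ty (kk (n%:R : R)).+2 x - rho)%:E <=
      ergodic_sum T f n (x, j) * ((aa (n%:R : R))^-1)%:E <=
    (c * ty (kk (n%:R : R)).+2 x + rho)%:E)%E].
Proof.
move=> mf f0 fc M0 rho0 e0.
have [mF] := integral_tow_fun mu (dm_phi v) mf f0; rewrite [in X in _ = X -> _]fc => Fc.
set F := tow_fun (phi v) f in mF Fc.
have F0 x : (0 <= F x)%E by apply: sume_ge0 => j _.
have c0 : 0 <= c by rewrite -lee_fin -Fc; exact: integral_ge0.
have e30 : 0 < e / 3 by rewrite divr_gt0.
pose dl := Num.min M (rho / (8 * (c + 1))).
have c1 : 0 < c + 1 by lra.
have dl0 : 0 < dl by rewrite lt_min M0 divr_gt0// mulr_gt0.
have dlM : dl <= M by rewrite ge_min lexx.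
have cdl : 8 * (c * dl) <= rho.
  have : dl <= rho / (8 * (c + 1)) by rewrite ge_min lexx orbT.
  rewrite ler_pdivlMr ?mulr_gt0//; nra.
pose eta := Num.min 4^-1 (rho / (16 * (c + 1) * M)).
have eta0 : 0 < eta by rewrite lt_min invr_gt0 ltr0n/= divr_gt0// !mulr_gt0.
have eta4 : eta <= 4^-1 by rewrite ge_min lexx.
have cM0 : 0 <= c * M by rewrite mulr_ge0// ltW.
have ceta : 16 * (c * M * eta) <= rho.
  have : eta <= rho / (16 * (c + 1) * M) by rewrite ge_min lexx orbT.
  rewrite ler_pdivlMr ?mulr_gt0//.
  have : 0 <= M * eta by rewrite mulr_ge0 ?ltW.
  have -> : eta * (16 * (c + 1) * M) = 16 * (c * M * eta) + 16 * (M * eta) by ring.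
  lra.
pose e1 := rho / (24 * M).
have e10 : 0 < e1 by rewrite divr_gt0// mulr_gt0.
have e1M : 24 * (M * e1) = rho by rewrite /e1; field; rewrite gt_eqF.
have [L0 hL] := mean_ergodic qq_gt0 mu_cyl mF F0 Fc e10 e30.
have /(_ _)[||n1 h1] := @tower_window R v v_ge mu mu_cyl eta (e / 3) dl M _ e30.
- by rewrite eta0.
- by rewrite dl0.
(* The summands serve, in this order: [L0 <= L <= 3 * M * a]; the comparison of [t] with [a];
   rounding and the starting height; Markov's inequality for the first column. *)
pose A := (L0%:R + J%:R + 2) / M + 80 * c * M / rho + 8 * c * (J%:R + 2) / rho + 24 * c / (rho * e).
have [n2 h2] := aa_large A.
exists (maxn n1 n2) => n; rewrite geq_max => /andP[n1n n2n].
have [En [mEn En_le hEn]] := h1 n n1n; have [n1' uA tA] := h2 n n2n.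
set k := kk (n%:R : R) in En mEn En_le hEn uA tA *.
set t : R := n%:R / BB R k in hEn tA.
have u0 := uuR_gt0 R k; set u : R := (uu k)%:R in uA u0.
set a : R := aa n%:R.
have aE : a = (1 + 10 / u) * t by rewrite /a aaE.
have J0 : 0 <= J%:R :> R by [].
have L00 : 0 <= L0%:R :> R by [].
have p1 : 0 <= (L0%:R + J%:R + 2) / M by rewrite divr_ge0 ?ltW//; lra.
have p2 : 0 <= 80 * c * M / rho.
  exact: divr_ge0 (mulr_ge0 (mulr_ge0 (ler0n _ 80) c0) (ltW M0)) (ltW rho0).
have p3 : 0 <= 8 * c * (J%:R + 2) / rho.
  by apply: divr_ge0 (mulr_ge0 (mulr_ge0 (ler0n _ 8) c0) _) (ltW rho0); lra.
have p4 : 0 <= 24 * c / (rho * e).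
  exact: divr_ge0 (mulr_ge0 (ler0n _ 24) c0) (ltW (mulr_gt0 rho0 e0)).
have A1 : (L0%:R + J%:R + 2) / M <= A by rewrite /A; lra.
have A2 : 80 * c * M / rho <= A by rewrite /A; lra.
have A3 : 8 * c * (J%:R + 2) / rho <= A by rewrite /A; lra.
have A4 : 24 * c / (rho * e) <= A by rewrite /A; lra.
clear p1 p2 p3 p4 h1 h2; clearbody A dl eta e1 u t.
have A0 : 0 < A by apply: lt_le_trans A1; rewrite divr_gt0//; lra.
have t0 : 0 < t by lra.
have iu0 : 0 < u^-1 by rewrite invr_gt0.
have ta : t <= a by rewrite aE ler_peMl ?ltW//; lra.
have a0 : 0 < a by lra.
have at1 : (1 - 10 * u^-1) * a <= t.
  rewrite aE mulrA -[leRHS]mul1r ler_pM2r//; nra.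
have Aa : A <= a by lra.
clearbody a.
pose L := ((Num.truncn (2 * M * a)).+1 + J.+1)%N.
have LM : L0%:R + J%:R + 2 <= a * M by move: A1; rewrite ler_pdivrMr//; nra.
have La : L%:R <= 3 * M * a.
  have := truncn_le_real (mulr_ge0 (mulr_ge0 (ler0n _ 2) (ltW M0)) (ltW a0)).
  by rewrite /L natrD -!natr1; lra.
have L0L : (L0 <= L)%N.
  rewrite -(ler_nat R); apply: (@le_trans _ _ (2 * M * a)); first by lra.
  apply: (le_trans (ltW (truncnS_gt _))); rewrite ler_nat; exact: leq_addr.
have [E1 [mE1 E1_le hE1]] := hL L L0L.
have s0 : 0 < rho / 8 * a by rewrite mulr_gt0// divr_gt0.
have [|mE3 E3_le] := ge0_markov (e := e / 3) mF F0 Fc s0.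
  move: (le_trans A4 Aa); rewrite ler_pdivrMr ?mulr_gt0//; lra.
have wle : 80 * (c * M * u^-1) <= rho.
  move: (le_trans A2 uA); rewrite !mulrA ler_pdivrMr// => h.
  by rewrite ler_pdivrMr// (le_trans h)// mulrC.
have ca : 8 * c * (J%:R + 2) <= rho * a.
  by move: (le_trans A3 Aa); rewrite ler_pdivrMr// mulrC (mulrC rho).
exists (En `|` (E1 `|` [set x | (rho / 8 * a)%:E < F x]%E)); split.
- by apply: measurableU => //; exact: measurableU.
- apply: (le_trans (measureU2 _ mEn (measurableU _ _ mE1 mE3))).
  rewrite (_ : e = e / 3 + (e / 3 + e / 3)); last by field.
  rewrite 2!EFinD leeD//; apply: (le_trans (measureU2 _ mE1 mE3)); exact: leeD.
move=> x j nE jphi jJ yM; set y := ty k.+2 x in yM *.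
have y0 : 0 < y by exact: (ty_gt0 v_ge).
have [|up lo] := hEn x _ yM; first by move=> h; apply: nE; left.
have nE1 : ~ E1 x by move=> h; apply: nE; right; left.
have Fx : (F x <= (rho / 8 * a)%:E)%E.
  by rewrite leNgt; apply/negP => h; apply: nE; right; right.
move: up lo; rewrite -/y; set Np := (Num.truncn _).+1; set Nm := Num.truncn _ => up lo.
have e1L : e1 * L%:R <= rho / 8 * a.
  apply: (@le_trans _ _ (e1 * (3 * M * a))); first by rewrite ler_pM2l.
  by rewrite -e1M; have -> : e1 * (3 * M * a) = 24 * (M * e1) / 8 * a by field.
clear A1 A2 A3 A4 tA uA Aa LM La L0L e1M L00 hL hEn; have ia0 : (0 <= (a^-1)%:E)%E by rewrite lee_fin invr_ge0 ltW.
have y0M : 0 <= y <= M by rewrite (ltW y0).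
have eta04 : 0 <= eta <= 4^-1 by rewrite ltW.
have dl0M : 0 <= dl <= M by rewrite ltW.
have t0a : 0 <= t <= a by rewrite ltW.
have S0 : (0 <= ergodic_sum T f n (x, j))%E by apply: sume_ge0.
have yt : y * t <= M * a by rewrite ler_pM// ltW.
have yt0 : 0 < y * t by rewrite mulr_gt0.
set S := ergodic_sum _ _ _ _ in S0 *.
apply/andP; split.
- have [dly|ydl] := leP dl y.
    have := ergodic_sum_ge (phi_gt0 v) f0 jphi (lo dly); rewrite -/F -/S.
    have NmL : (Nm <= L)%N.
      apply: leq_trans (leq_addr _ _); apply: leq_trans (leqnSn _).
      apply: le_truncn; rewrite -mulrA; nra.
    have /andP[s1 _] := hE1 x nE1 Nm NmL.
    move=> s2; have {s1 s2}s := le_trans s1 s2.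
    have {}s : ((c * Nm%:R - e1 * L%:R - rho / 8 * a)%:E <= S)%E.
      by rewrite EFinB leeBlDl//; apply: (le_trans s); exact: leeD.
    apply: (le_trans _ (lee_wpmul2r ia0 s)).
    rewrite -EFinM lee_fin ler_pdivlMr//.
    apply: (lower_real c0 y0M eta04 (ltW iu0) a0 at1 ceta wle _ _ e1L).
      have : c * 8 * 1 <= c * 8 * (J%:R + 2) by rewrite ler_wpM2l ?mulr_ge0//; lra.
      lra.
    exact: ltW (truncn_gt_real _).
  (* For a type below [dl] the lower bound is negative or 0, since [c * dl <= rho / 8]. *)
  apply: (@le_trans _ _ 0%E); last exact: mule_ge0.
  rewrite lee_fin; have : c * y <= c * dl by rewrite ler_wpM2l// ltW.
  lra.
- have Mm : Num.max y dl <= M by rewrite ge_max yM.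
  have m0 : 0 < Num.max y dl by rewrite lt_max y0.
  have mt : Num.max y dl * t <= M * a by rewrite ler_pM// ltW.
  have mt0 : 0 < Num.max y dl * t by rewrite mulr_gt0.
  have NpL : (Np + j <= L)%N.
    apply: leq_add; last exact: leqW.
    by rewrite ltnS; apply: le_truncn; rewrite -mulrA; nra.
  have /andP[_ s1] := hE1 x nE1 _ NpL.
  have := ergodic_sum_le (phi_gt0 v) f0 jphi up; rewrite -/F -/S => s2.
  have {s1 s2} s := le_trans s2 s1.
  apply: (le_trans (lee_wpmul2r ia0 s)); rewrite -EFinM lee_fin ler_pdivrMr// natrD.
  apply: (upper_real c0 y0M dl0M (ltW eta0) t0a a0 ceta cdl _ _ e1L).
    have : c * 8 * (j%:R + 2) <= c * 8 * (J%:R + 2).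
      by rewrite ler_wpM2l ?mulr_ge0// lerD2r ler_nat.
    lra.
  rewrite /Np -natr1 lerD2r truncn_le_real// -mulrA mulr_ge0 ?ltW//; lra.
Qed.

End ratio.

Lemma vanishing_sets d (T : measurableType d) (R : realType) (mu : probability T R)
    (A : nat -> set T) (e : R) : (forall n, measurable (A n)) ->
  (forall m n, (m <= n)%N -> A n `<=` A m) -> \bigcap_n A n = set0 -> 0 < e ->
  exists n, (mu (A n) <= e%:E)%E.
Proof.
move=> mA dA A0 e0.
have cv : mu (A n) @[n --> \oo] --> mu (\bigcap_n A n).
  apply: nonincreasing_cvg_mu => //.
  - by rewrite (le_lt_trans (probability_le1 _ (mA 0%N)))// ltry.
  - exact: bigcapT_measurable.
  - by move=> m n mn; apply/subsetPset; exact: dA.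
move: cv; rewrite A0 measure0 => /fine_cvgP[_] /cvgrPdist_le/(_ _ e0)[n _ /(_ n (leqnn _))].
rewrite /= sub0r normrN => h; exists n.
rewrite -(@fineK _ (mu (A n))) ?fin_num_measure// lee_fin.
by apply: le_trans h; exact: ler_norm.
Qed.

(** Uniform continuity with one point allowed outside the segment, as the ratio may leave [0, c M]
    slightly. *)
Lemma uniform_on_segment (R : realType) (g : R -> R) (a b e : R) : continuous g -> 0 < e ->
  exists2 rho, 0 < rho & forall x y, a <= x <= b -> `|x - y| <= rho -> `|g x - g y| <= e.
Proof.
move=> cg e0.
have /compact_near_coveringP/(_ R (0 : R)^'+
  (fun r x => forall y, `|x - y| <= r -> `|g x - g y| <= e) _) :=
  @segment_compact R a b.
move=> h; have {h} : \forall r \near (0:R)^'+, `[a, b]%classic `<=`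
    (fun x => forall y, `|x - y| <= r -> `|g x - g y| <= e).
  apply: h => x _.
  have e20 : 0 < e / 2 by rewrite divr_gt0.
  have /cvgrPdist_lt/(_ _ e20) := cg x; rewrite nearE/= => /nbhs_ballP[dl /= dl0 hd].
  exists (ball x (dl / 2), [set r | r < dl / 2])%type.
    split => /=; first by apply: nbhsx_ballx; rewrite divr_gt0.
    by apply: nbhs_right_lt; rewrite divr_gt0.
  move=> [z r] /= [xz rd] y zy.
  have b1 : `|g x - g z| < e / 2.
    by apply: (hd z); move: xz; rewrite /ball/=; lra.
  have b2 : `|g x - g y| < e / 2.
    apply: (hd y); rewrite /ball/= -(subrKA z).
    by apply: (le_lt_trans (ler_normD _ _)); move: xz; rewrite /ball/=; lra.
  rewrite -(subrKA (g x)); apply: (le_trans (ler_normD _ _)).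
  by rewrite (distrC (g z)); lra.
move=> H.
have : \forall r \near (0:R)^'+, 0 < r /\ `[a, b]%classic `<=`
    (fun x => forall y, `|x - y| <= r -> `|g x - g y| <= e).
  by near=> r; split; near: r => //; exact: nbhs_right_gt.
move=> /(@filter_ex _ _ _)[r [r0 hr]]; exists r => // x y xab xy.
by apply: hr => //=; rewrite in_itv.
Unshelve. all: by end_near. Qed.

(** * Absolutely continuous initial laws *)

Section domination.
Context (R : realType) (mu nu : probability odoq R).
Hypothesis mu_cyl : forall k p, (p < Q k)%N -> mu [set x | pos qq k x = p] = ((Q k)%:R^-1)%:E.
Hypothesis nu_mu : nu `<< mu.
Implicit Types (x : odoq) (f : odoq -> R).

(* The Radon-Nikodym density of [nu], approximated in [L^1] by a cylinder function. *)
Lemma density_approx (e : R) : 0 < e -> exists k (r : nat -> R), (forall p, 0 <= r p) /\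
  forall f G, measurable_fun [set: odoq] f -> (forall x, 0 <= f x <= G) ->
  (\int[nu]_x (f x)%:E <= \int[mu]_x (r (pos qq k x) * f x)%:E + (G * e)%:E)%E /\
  (\int[mu]_x (r (pos qq k x) * f x)%:E <= \int[nu]_x (f x)%:E + (G * e)%:E)%E.
Proof.
move=> e0; pose h := Radon_Nikodym_SigmaFinite.f nu mu.
have h0 x : (0 <= h x)%E by exact: Radon_Nikodym_SigmaFinite.f_ge0.
have hfin x : h x \is a fin_num by exact: Radon_Nikodym_SigmaFinite.f_fin_num.
have ih : mu.-integrable setT h by exact: Radon_Nikodym_SigmaFinite.f_integrable.
have mh : measurable_fun [set: odoq] h by exact: measurable_int ih.
have hoo : (\int[mu]_x h x < +oo)%E.
  by rewrite -(@Radon_Nikodym_SigmaFinite.f_integral _ _ _ nu mu nu_mu)// ltey_eq fin_num_measure.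
have [k [r [r0 hr]]] := cyl_approx_fun qq_gt0 mh h0 hoo e0.
exists k, r; split => // f G mf fG.
have G0 : 0 <= G by case/andP: (fG point) => /le_trans; apply.
have f0 x : 0 <= f x by case/andP: (fG x).
have mr : measurable_fun [set: odoq] (fun x => (r (pos qq k x) * f x)%:E).
  by apply/measurable_EFinP; apply: measurable_funM => //; exact: measurable_pos_comp.
have md : measurable_fun [set: odoq] (fun x => `|h x - (r (pos qq k x))%:E|%E).
  apply: measurableT_comp => //; apply: emeasurable_funB => //.
  by apply/measurable_EFinP; exact: measurable_pos_comp.
have mfh : measurable_fun [set: odoq] (fun x => (f x)%:E * h x)%E.
  by apply: emeasurable_funM => //; exact/measurable_EFinP.
have nuE : (\int[nu]_x (f x)%:E = \int[mu]_x ((f x)%:E * h x))%E.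
  rewrite (@Radon_Nikodym_SigmaFinite.change_of_variables _ _ _ nu mu nu_mu)//.
  exact/measurable_EFinP.
have mG : measurable_fun [set: odoq] (fun x => G%:E * `|h x - (r (pos qq k x))%:E|)%E.
  exact: measurable_funeM.
have intG : (\int[mu]_x (G%:E * `|h x - (r (pos qq k x))%:E|) <= (G * e)%:E)%E.
  by rewrite ge0_integralZl_EFin// EFinM lee_wpmul2l.
have G00 x : (0 <= G%:E * `|h x - (r (pos qq k x))%:E|)%E by rewrite mule_ge0.
rewrite nuE; split.
- apply: (@le_trans _ _ (\int[mu]_x ((r (pos qq k x) * f x)%:E +
     G%:E * `|h x - (r (pos qq k x))%:E|))%E).
    apply: ge0_le_integral => //.
    + by move=> x _; rewrite mule_ge0// lee_fin.
    + exact: emeasurable_funD.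
    move=> x _; have [+ _] := ge0_le_abs_dist (r (pos qq k x)) (h0 x).
    rewrite -(fineK (hfin x)) -EFinB -!EFinM -!EFinD !lee_fin.
    have := f0 x; have /andP[_ fx] := fG x; set a := fine _; set b := r _.
    have := normr_ge0 (a - b); set w := `|a - b|; nra.
  rewrite ge0_integralD//; first by rewrite leeD2l.
  by move=> x _; rewrite lee_fin mulr_ge0.
- apply: (@le_trans _ _ (\int[mu]_x ((f x)%:E * h x +
     G%:E * `|h x - (r (pos qq k x))%:E|))%E).
    apply: ge0_le_integral => //.
    + by move=> x _; rewrite lee_fin mulr_ge0.
    + exact: emeasurable_funD.
    move=> x _; have [_ +] := ge0_le_abs_dist (r (pos qq k x)) (h0 x).
    rewrite -(fineK (hfin x)) -EFinB -!EFinM -!EFinD !lee_fin.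
    have := f0 x; have /andP[_ fx] := fG x; set a := fine _; set b := r _.
    have := normr_ge0 (a - b); set w := `|a - b|; nra.
  rewrite ge0_integralD//; first by rewrite leeD2l.
  by move=> x _; rewrite mule_ge0// lee_fin.
Qed.

(** The approximating cylinder function is bounded by the sum of its finitely many values. *)
Lemma small_dominated (e : R) : 0 < e -> exists2 dl : R, 0 < dl &
  forall A : set odoq, measurable A -> (mu A <= dl%:E)%E -> (nu A <= e%:E)%E.
Proof.
move=> e0; have e20 : 0 < e / 2 by rewrite divr_gt0.
have [k [r [r0 h]]] := density_approx e20.
pose S := \sum_(0 <= p < Q k) r p.
have S0 : 0 <= S by exact: sumr_ge0.
have S1 : 0 < S + 1 by lra.
exists (e / 2 / (S + 1)); first by rewrite divr_gt0.
move=> A mA Ad.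
have i1 x : 0 <= (\1_A x : R) <= 1 by rewrite indicE ler0n lern1 leq_b1.
have m1A : measurable_fun [set: odoq] (\1_A : odoq -> R) by exact: measurable_indic.
have [h1 _] := h (\1_A : odoq -> R) 1 m1A i1.
have -> : nu A = (\int[nu]_x (\1_A x)%:E)%E by rewrite integral_indic// setIT.
apply: (le_trans h1); rewrite mul1r.
have -> : (e%:E = (e / 2)%:E + (e / 2)%:E)%E by rewrite -EFinD -splitr.
rewrite leeD2r//.
apply: (@le_trans _ _ (\int[mu]_x ((S + 1)%:E * (\1_A x)%:E))%E).
  apply: ge0_le_integral => //.
  - by move=> x _; rewrite lee_fin mulr_ge0//; case/andP: (i1 x).
  - apply/measurable_EFinP; apply: measurable_funM; last exact: measurable_indic.
    exact: measurable_pos_comp.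
  - apply: measurable_funeM; apply/measurable_EFinP; exact: measurable_indic.
  move=> x _; rewrite -EFinM lee_fin ler_wpM2r//.
  have pk : (pos qq k x < Q k)%N by apply: pos_lt; exact: qq_gt0.
  rewrite /S big_mkord (bigD1 (Ordinal pk))//= -addrA lerDl addr_ge0//.
  exact: sumr_ge0.
rewrite ge0_integralZl_EFin//; last 2 first.
- apply/measurable_EFinP; exact: measurable_indic.
- exact: ltW.
rewrite integral_indic// setIT.
apply: (@le_trans _ _ ((S + 1)%:E * (e / 2 / (S + 1))%:E)%E).
  by apply: lee_wpmul2l => //; rewrite lee_fin ltW.
by rewrite -EFinM lee_fin mulrC divfK// gt_eqF.
Qed.

Context d' (Om : measurableType d') (P : probability Om R) (Y : {RV P >-> R}).
Hypothesis Y_gt0 : forall w, 0 < Y w.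
Local Notation ty := (yty qq ll (vv Y) 1).

(** Under [mu] the integral of [r (pos qq k x) * psi (ty n x)] factors by [integral_cyl_ty]; taking
    [psi = 1] shows that the mean [s] of [r] is close to 1. *)
Lemma dominated_law (psi : R -> R) (M e : R) : (forall y, 0 <= psi y <= M) -> continuous psi ->
  0 < e -> exists n0, forall n, (n0 <= n)%N ->
  `|fine (\int[nu]_x (psi (ty n x))%:E) - fine (\int[P]_w (psi (Y w))%:E)| <= e.
Proof.
move=> psiM cpsi e0; have M0 := M_ge0 psiM.
pose e1 := e / (4 * (M + 1)).
have e10 : 0 < e1 by rewrite divr_gt0// mulr_gt0//; lra.
have Me1 : 4 * (M * e1) <= e.
  have : 4 * ((M + 1) * e1) = e by rewrite /e1; field; rewrite gt_eqF//; lra.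
  lra.
have [k [r [r0 h]]] := density_approx e10.
have e20 : 0 < e / 2 by rewrite divr_gt0.
have /cvgrPdist_le/(_ _ e20)[n1 _ h1] := tmean_cvg Y_gt0 psiM cpsi mu_cyl.
exists (maxn k n1) => n; rewrite geq_max => /andP[kn n1n].
have mty : measurable_fun [set: odoq] (fun x => psi (ty n x)).
  by apply/measurable_EFinP; exact: (measurable_ty (vv Y) psi n).
have [a1 a2] := h (fun x => psi (ty n x)) M mty (fun x => psiM _).
pose s := (\sum_(0 <= p < Q k) r p) / (Q k)%:R.
have s0 : 0 <= s by rewrite divr_ge0// sumr_ge0.
have one : forall x : odoq, 0 <= (cst 1 : odoq -> R) x <= 1 by move=> x; rewrite /= lexx ler01.
have [b1 b2] := h (cst 1) 1 (measurable_cst _) one.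
have one' : forall y : R, 0 <= (cst 1 : R -> R) y <= 1 by move=> x; rewrite /= lexx ler01.
have := integral_cyl_ty (vv Y) mu_cyl one' r0 kn; rewrite -/s => sE.
have int1 (la : probability odoq R) : (\int[la]_(x in [set: odoq]) (cst 1 x)%:E = 1%:E)%E.
  by rewrite (eq_integral (cst 1%:E))// integral_cst// mul1e; exact: probability_setT.
have t1 : tmean (vv Y) mu (cst 1) n = 1 by rewrite /tmean int1.
rewrite t1 mulr1 in sE; rewrite sE int1 mul1r -EFinD lee_fin in b1.
rewrite sE int1 mul1r -EFinD lee_fin in b2.
rewrite (integral_cyl_ty (vv Y) mu_cyl psiM r0 kn) -/s in a1 a2.
have tb := tmean_bound (vv Y) mu n psiM.
have := h1 n n1n; rewrite /=.
have nuE : (\int[nu]_x (psi (ty n x))%:E = (tmean (vv Y) nu psi n)%:E)%E by exact: (tmeanE _ _ _ psiM).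
rewrite nuE -EFinD lee_fin in a1; rewrite nuE -EFinD lee_fin in a2.
rewrite nuE /=; set E := fine _; set z := tmean _ nu _ _ in a1 a2 *.
set t := tmean _ mu _ _ in a1 a2 tb *; move=> h3.
have /andP[tb0 tbM] := tb.
have c1 : s * t <= t + M * e1 by nra.
have c2 : t <= s * t + M * e1 by nra.
move: h3; rewrite !ler_norml => /andP[h3 h4]; apply/andP; split; lra.
Qed.

End domination.

Section bounded_integrals.
Context d (T : measurableType d) (R : realType) (mu : probability T R).
Implicit Types (G H : T -> R).

Lemma bounded_integralE G K : measurable_fun setT G -> (forall z, 0 <= G z <= K) ->
  (\int[mu]_z (G z)%:E)%E = (fine (\int[mu]_z (G z)%:E))%:E.
Proof.
move=> mG h; rewrite fineK// ge0_fin_numE; last first.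
  by apply: integral_ge0 => z _; rewrite lee_fin; case/andP: (h z).
apply: (@le_lt_trans _ _ (\int[mu]_z (cst K%:E z))%E).
  apply: ge0_le_integral => //.
  - by move=> z _; rewrite lee_fin; case/andP: (h z).
  - exact/measurable_EFinP.
  - by move=> z _; rewrite lee_fin; case/andP: (h z).
by rewrite integral_cst// [X in (_ * X)%E]probability_setT mule1 ltry.
Qed.

Lemma integral_le_shift G H (B : set T) (K e b : R) :
  measurable_fun setT G -> measurable_fun setT H ->
  (forall z, 0 <= G z <= K) -> (forall z, 0 <= H z <= K) ->
  measurable B -> (mu B <= b%:E)%E -> 0 <= e -> (forall z, ~ B z -> G z <= H z + e) ->
  fine (\int[mu]_z (G z)%:E) <= fine (\int[mu]_z (H z)%:E) + (e + K * b).
Proof.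
move=> mG mH hG hH mB Bb e0 h.
have K0 : 0 <= K by case/andP: (hG point) => /le_trans; apply.
rewrite -lee_fin EFinD -(bounded_integralE mG hG) -(bounded_integralE mH hH) EFinD.
have mB1 : measurable_fun setT (fun z => (K * \1_B z)%:E).
  by apply/measurable_EFinP; apply: measurable_funM => //; exact: measurable_indic.
have mHe : measurable_fun setT (EFin \o H) by exact/measurable_EFinP.
apply: (@le_trans _ _ (\int[mu]_z ((H z)%:E + (e%:E + (K * \1_B z)%:E)))%E).
  apply: ge0_le_integral => //.
  - by move=> z _; rewrite lee_fin; case/andP: (hG z).
  - exact/measurable_EFinP.
  - by apply: emeasurable_funD => //; apply: emeasurable_funD.
  move=> z _; rewrite -!EFinD lee_fin indicE.
  have /andP[_ GK] := hG z; have /andP[H0 _] := hH z.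
  case: (boolP (z \in B)) => [_|/negP nB]; first by rewrite mulr1; lra.
  by rewrite mulr0 addr0; apply: h => Bz; apply: nB; rewrite inE.
rewrite ge0_integralD//; last 3 first.
- by move=> z _; rewrite lee_fin; case/andP: (hH z).
- by move=> z _; rewrite -EFinD lee_fin addr_ge0// mulr_ge0.
- exact: emeasurable_funD.
rewrite leeD2l// ge0_integralD//; last by move=> z _; rewrite lee_fin mulr_ge0.
apply: leeD; first by rewrite integral_cst// [X in (_ * X)%E]probability_setT mule1.
under eq_integral => z _ do rewrite EFinM.
rewrite ge0_integralZl_EFin//; last by apply/measurable_EFinP; exact: measurable_indic.
by rewrite integral_indic// setIT EFinM lee_wpmul2l.
Qed.

Lemma integral_close G H (B : set T) (K e b : R) :
  measurable_fun setT G -> measurable_fun setT H ->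
  (forall z, 0 <= G z <= K) -> (forall z, 0 <= H z <= K) ->
  measurable B -> (mu B <= b%:E)%E -> 0 <= e -> (forall z, ~ B z -> `|G z - H z| <= e) ->
  `|fine (\int[mu]_z (G z)%:E) - fine (\int[mu]_z (H z)%:E)| <= e + K * b.
Proof.
move=> mG mH hG hH mB Bb e0 h.
have h1 : fine (\int[mu]_z (G z)%:E) <= fine (\int[mu]_z (H z)%:E) + (e + K * b).
  apply: (integral_le_shift mG mH hG hH mB Bb e0) => z /h.
  by rewrite ler_norml => /andP[_]; lra.
have h2 : fine (\int[mu]_z (H z)%:E) <= fine (\int[mu]_z (G z)%:E) + (e + K * b).
  apply: (integral_le_shift mH mG hH hG mB Bb e0) => z /h.
  by rewrite ler_norml => /andP[+ _]; lra.
rewrite ler_norml; apply/andP; split; lra.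
Qed.

End bounded_integrals.

Section distributional_limit.
Context (R : realType) (d' : measure_display) (Om : measurableType d')
  (P : probability Om R) (Y : {RV P >-> R}).
Hypothesis Y_gt0 : forall w, 0 < Y w.
Context (mu : probability odoq R).
Hypothesis mu_cyl : forall k p, (p < Q k)%N -> mu [set x | pos qq k x = p] = ((Q k)%:R^-1)%:E.
Local Notation v := (vv Y).
Local Notation ty := (yty qq ll v 1).
Local Notation T := (@tow_map _ odoq (tau qq) (phi v)).
Local Notation m := (@tow_measure _ odoq R mu (phi v) (dm_phi v)).
Implicit Types (z : odoq * nat).

Lemma sf_small (e : R) : 0 < e -> exists2 M, 1 < M & sf Y M <= e.
Proof.
move=> e0; pose A n := [set w | n%:R + 2 <= Y w].
have [n hn] : exists n, (P (A n) <= e%:E)%E.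
  apply: vanishing_sets => //.
  - by move=> n; exact: measurable_sf_set.
  - by move=> i j ij w; apply: le_trans; rewrite lerD2r ler_nat.
  apply/seteqP; split => // w Aw.
  have /= := Aw (Num.truncn (Y w)).+1 I; have := truncnS_gt (Y w).
  rewrite /A/=; lra.
exists (n%:R + 2); last by rewrite -lee_fin -sfE.
by have : 0 <= n%:R :> R by []; lra.
Qed.

Lemma measurable_tow_iter k : measurable_fun [set: odoq * nat] (iter k T).
Proof.
elim: k => [|k IH]; first exact: measurable_id.
apply: (measurableT_comp (f := T)) => //; apply: measurable_tow_map; last exact: dm_phi.
exact: (measurable_tau qq_gt0).
Qed.

Lemma measurable_ergodic_sum (f : odoq * nat -> \bar R) n : measurable_fun setT f ->
  measurable_fun setT (ergodic_sum T f n).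
Proof.
move=> mf; apply: emeasurable_sum => k.
by apply: (measurableT_comp mf); exact: measurable_tow_iter.
Qed.

Lemma tow_measure_fst0 (A : set odoq) : measurable A -> mu A = 0%E -> m (fst @^-1` A) = 0%E.
Proof.
move=> mA A0; rewrite [LHS]tow_measureE eseries0// => j _ _.
rewrite /lev; apply/eqP; rewrite eq_le measure_ge0 andbT -[leRHS]A0.
apply: le_measure; rewrite ?inE//.
by apply: measurableI => //; exact: (dm_phi v [set i | (j < i)%N]).
Qed.

Lemma measurable_above : measurable [set z : odoq * nat | (phi v z.1 <= z.2)%N].
Proof.
apply: measurable_sections => j; exact: (dm_phi v [set i | (i <= j)%N]).
Qed.

Lemma measurable_levels J : measurable [set z : odoq * nat | (J <= z.2)%N].
Proof.
apply: measurable_sections => j.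
by have [jJ|jJ] := leqP J j; [rewrite (_ : [set x | _] = setT)|rewrite (_ : [set x | _] = set0)];
  rewrite //; apply/seteqP; split => // x /=; rewrite ?jJ// leqNgt jJ.
Qed.

Lemma tow_measure_above0 : m [set z | (phi v z.1 <= z.2)%N] = 0%E.
Proof.
rewrite [LHS]tow_measureE eseries0// => j _ _; rewrite /lev.
rewrite (_ : _ `&` _ = set0) ?measure0//; apply/seteqP; split => // x [/= h1].
by rewrite leqNgt h1.
Qed.

Context (Qm : probability (odoq * nat)%type R).
Hypothesis Qm_dom : Qm `<< m.

Lemma Qm_null (B : set (odoq * nat)) : measurable B -> m B = 0%E -> Qm B = 0%E.
Proof.
move=> mB B0; apply/(measure0_null_setP _ mB); apply: Qm_dom.
exact/(measure0_null_setP m mB).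
Qed.

Let fst_mfun : {mfun (odoq * nat)%type >-> odoq} :=
  HB.pack (fst : odoq * nat -> odoq) (isMeasurableFun.Build _ _ _ _ _ (@measurable_fst _ _ odoq nat)).

(** The law of the base point under [Qm]. Only this marginal matters in the limit, since the
    approximating type depends on the base point alone. *)
Let nu : probability odoq R := distribution Qm fst_mfun.

Let nuE (A : set odoq) : nu A = Qm (fst @^-1` A). Proof. by []. Qed.

Lemma nu_dom : nu `<< mu.
Proof.
move=> A A0 C mC CA; rewrite [LHS]nuE; apply: Qm_null; last exact: tow_measure_fst0 (A0 C mC CA).
rewrite -[X in measurable X]setTI; exact: measurable_fst.
Qed.

Lemma fst_preimage_measurable (A : set odoq) : measurable A ->
  measurable ((fst : odoq * nat -> odoq) @^-1` A).
Proof. by move=> mA; rewrite -[X in measurable X]setTI; exact: measurable_fst. Qed.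

(** Outside the set [B] of small [Qm]-measure, made of exceptional base points, large types, great
    heights and points above their column, the ratio is within [rho] of [c] times the type. Uniform
    continuity replaces one by the other, and [dominated_law] gives the limit. *)
Lemma ratio_distr_cvg (f : odoq * nat -> \bar R) (c K : R) (g : \bar R -> R) :
  measurable_fun setT f -> (forall z, 0 <= f z)%E -> (\int[m]_z f z = c%:E)%E ->
  (forall y, 0 <= g y <= K) -> continuous (fun y : R => g y%:E) ->
  (forall n, measurable_fun setT (fun z => g (ergodic_sum T f n z * ((aa (n%:R : R))^-1)%:E)%E)) ->
  fine (\int[Qm]_z (g (ergodic_sum T f n z * ((aa (n%:R : R))^-1)%:E)%E)%:E) @[n --> \oo] -->
  fine (\int[P]_w (g (c * Y w)%:E)%:E).
Proof.
move=> mf f0 fc gK cg mgF.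
have c0 : 0 <= c by rewrite -lee_fin -fc; exact: integral_ge0.
have K0 : 0 <= K by case/andP: (gK 0%E) => /le_trans; apply.
pose psi (y : R) := g (c * y)%:E.
have psiK y : 0 <= psi y <= K by exact: gK.
have cpsi : continuous psi.
  move=> y; apply: (@continuous_comp _ _ _ (fun y => c * y) (fun y => g y%:E)); last exact: cg.
  exact: mulrl_continuous.
apply/cvgrPdist_le => e e0.
pose e1 := e / (2 * (3 * K + 2)).
have K3 : 0 < 3 * K + 2 by lra.
have e10 : 0 < e1 by rewrite divr_gt0// mulr_gt0.
have e1E : 2 * (e1 + K * (3 * e1)) <= e.
  have : 2 * ((3 * K + 2) * e1) = e by rewrite /e1; field; rewrite gt_eqF.
  lra.
have [dl dl0 hdl] := small_dominated nu_dom e10.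
have [M M1 hM] := sf_small dl0.
have M0 : 0 < M by lra.
have cM0 : 0 <= c * M by rewrite mulr_ge0// ltW.
have [rho rho0 hrho] := uniform_on_segment 0 (c * M) cg e10.
have [J hJ] : exists J, (Qm [set z | (J <= z.2)%N] <= e1%:E)%E.
  apply: vanishing_sets => //.
  - exact: measurable_levels.
  - by move=> i j ij z /=; exact: leq_trans.
  - by apply/seteqP; split => // z Az; have := Az z.2.+1 I; rewrite /= ltnn.
have [n1 h1] := ratio_close (vv_ge Y) mu_cyl J mf f0 fc M0 rho0 dl0.
have e20 : 0 < e / 2 by rewrite divr_gt0.
have [n2 h2] := dominated_law mu_cyl nu_dom Y_gt0 psiK cpsi e20.
have [n3 hn3] := @kk_unbounded R n2.
exists (maxn n1 n3) => // n /=; rewrite geq_max => /andP[n1n /hn3[_ n2n]].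
have [E [mE Edl hE]] := h1 n n1n.
set k := (kk (n%:R : R)).+2 in hE.
have n2k : (n2 <= k)%N by rewrite /k !leqW.
have := h2 k n2k.
have mty : measurable_fun [set: odoq] (fun x => psi (ty k x)).
  by apply/measurable_EFinP; exact: (measurable_ty v psi k).
have -> : (\int[nu]_x (psi (ty k x))%:E = \int[Qm]_z (psi (ty k z.1))%:E)%E.
  rewrite /nu /distribution ge0_integral_pushforward//.
  - exact/measurable_EFinP.
  - by move=> x _; rewrite lee_fin; case/andP: (psiK (ty k x)).
pose A : set odoq := [set x | M <= ty k x].
have mA : measurable A by exact: (dm_yty qq_gt0 ll v 1 k [set y | M <= y]).
pose B : set (odoq * nat) := (fst @^-1` E) `|` ((fst @^-1` A) `|`
   ([set z | (J <= z.2)%N] `|` [set z | (phi v z.1 <= z.2)%N])).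
have mJ := measurable_levels J.
have mab := measurable_above.
have mfE := fst_preimage_measurable mE; have mfA := fst_preimage_measurable mA.
have mB : measurable B by do 3 (apply: measurableU => //).
have QB : (Qm B <= (3 * e1)%:E)%E.
  have QE : (Qm (fst @^-1` E) <= e1%:E)%E by rewrite -nuE; exact: hdl.
  have QA : (Qm (fst @^-1` A) <= e1%:E)%E.
    rewrite -nuE; apply: hdl => //.
    by apply: (le_trans (ty_tail_law Y mu_cyl k M1)); rewrite lee_fin.
  have Qab : (Qm [set z | (phi v z.1 <= z.2)%N] <= 0)%E.
    by rewrite (Qm_null mab)//; exact: tow_measure_above0.
  apply: (le_trans (measureU2 _ _ _)) => //; first by do 2 (apply: measurableU => //).
  rewrite (_ : 3 * e1 = e1 + (e1 + (e1 + 0)))%R; last ring.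
  rewrite EFinD; apply: leeD => //.
  apply: (le_trans (measureU2 _ _ _)) => //; first by apply: measurableU.
  rewrite EFinD; apply: leeD => //.
  apply: (le_trans (measureU2 _ _ _)) => //.
  by rewrite EFinD; apply: leeD.
have mH : measurable_fun [set: odoq * nat] (fun z => psi (ty k z.1)).
  by apply: (measurableT_comp mty); exact: measurable_fst.
have cl z : ~ B z -> `|g (ergodic_sum T f n z * ((aa (n%:R : R))^-1)%:E)%E - psi (ty k z.1)| <= e1.
  case: z => x j nB; have nE : ~ E x by move=> h; apply: nB; left.
  have jphi : (j < phi v x)%N.
    by rewrite ltnNge; apply/negP => h; apply: nB; right; right; right.
  have jJ : (j <= J)%N.
    by rewrite leqNgt; apply/negP => h; apply: nB; right; right; left; exact: ltnW.
  have yM : ty k x <= M.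
    by rewrite leNgt; apply/negP => h; apply: nB; right; left; exact: ltW.
  have := hE x j nE jphi jJ yM; rewrite /=.
  case: (ergodic_sum _ _ _ _ * _)%E => [r| |]; rewrite ?leye_eq ?leeNy_eq ?andbF// !lee_fin.
  move=> /andP[r1 r2]; rewrite /psi distrC; apply: hrho.
    rewrite mulr_ge0//=; last exact: ltW (ty_gt0 (vv_ge Y) _ _).
    by rewrite ler_wpM2l.
  by rewrite ler_norml; apply/andP; split; lra.
have := integral_close (mgF n) mH (fun z => gK _) (fun z => psiK _) mB QB (ltW e10) cl.
rewrite -/psi; set I1 := fine _; set I2 := fine _; set I3 := fine _ => h3 h4.
rewrite (_ : I3 - I1 = - (I1 - I2) - (I2 - I3)); last by ring.
apply: (le_trans (ler_normB _ _)); rewrite normrN; lra.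
Qed.

End distributional_limit.

(** * Test functions on [0, +oo] and conclusion *)

Lemma measurable_ext_comp d (T : measurableType d) (R : realType) (F : T -> \bar R)
    (g : \bar R -> R) :
  measurable_fun setT F -> continuous (fun y : R => g y%:E) -> g -oo%E = g +oo%E ->
  measurable_fun setT (fun z => g (F z)).
Proof.
move=> mF cg goo; pose D := [set z | F z \is a fin_num].
have mD : measurable D.
  by rewrite -[X in measurable X]setTI; apply: emeasurable_fin_num.
have -> : (fun z => g (F z)) =
    (fun z => g (fine (F z))%:E * \1_D z + g +oo%E * \1_(~` D) z).
  apply/funext => z; rewrite indicC !indicE.
  have DE : (z \in D) = (F z \is a fin_num) by apply/idP/idP; rewrite inE.
  rewrite DE; case: (F z) => [r| |] /=; rewrite ?mulr1 ?mulr0 ?add0r ?addr0//.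
have mg : measurable_fun setT (fun z => g (fine (F z))%:E).
  apply: (measurableT_comp (f := fun y : R => g y%:E)); first exact: continuous_measurable_fun.
  by apply: measurableT_comp => //; exact: measurable_fine.
apply: measurable_funD; apply: measurable_funM => //; apply: measurable_indic => //.
exact: measurableC.
Qed.

Lemma within_ge0_continuous (R : realType) (g : \bar R -> R) :
  {within [set y : \bar R | (0 <= y)%E], continuous g} ->
  continuous (fun y : R => g `|y%:E|%E).
Proof.
move=> /subspace_continuousP cg y; apply/cvgrPdist_lt => e e0.
have /cvgrPdist_lt/(_ _ e0) := cg `|y%:E|%E (abse_ge0 _).
rewrite near_withinE => h.
have cy : (fun x : R => `|x%:E|%E) x @[x --> y] --> `|y%:E|%E.
  apply: cvg_EFin; first by near=> x.
  exact: norm_continuous.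
have H : \forall x \near y, (0 <= `|x%:E|)%E -> `|g `|y%:E|%E - g `|x%:E|%E| < e := cy _ h.
near=> x; apply: (near H x) => //; exact: abse_ge0.
Unshelve. all: by end_near. Qed.

Lemma integral_shift d (T : measurableType d) (R : realType) (mu : probability T R)
    (f : T -> R) (K b : R) : measurable_fun setT f -> (forall z, 0 <= f z <= K) ->
  (\int[mu]_z (f z - b)%:E)%E = (fine (\int[mu]_z (f z)%:E) - b)%:E.
Proof.
move=> mf fK; rewrite EFinB -(bounded_integralE mu mf fK).
have i1 : mu.-integrable setT (EFin \o f).
  apply: measurable_bounded_integrable => //.
    by rewrite (le_lt_trans (probability_le1 _ measurableT))// ltry.
  exists K; split; first exact: num_real.
  move=> x Kx z _ /=; have /andP[f0 fk] := fK z; rewrite ger0_norm//.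
  exact: (le_trans fk (ltW Kx)).
have i2 : mu.-integrable setT (EFin \o cst b) by exact: finite_measure_integrable_cst.
under eq_integral => z _ do rewrite EFinB.
rewrite (integralB measurableT i1 i2); congr (_ - _)%E.
by rewrite (_ : EFin \o cst b = cst b%:E)// integral_cst// [X in (_ * X)%E]probability_setT mule1.
Qed.

Theorem theorem3 (R : realType) (d' : measure_display) (Om : measurableType d')
    (P : probability Om R) (Y : {RV P >-> R}) (Y_gt0 : forall w, 0 < Y w) :
  exists (d : measure_display) (X : measurableType d)
         (m : {sigma_finite_measure set X -> \bar R}) (T : X -> X)
         (a : nat -> R) (Omega : set X),
    [/\ measure_preserving m T, conservative m T & ergodic m T] /\
    distributionally_stable m T P Y /\
    distr_return_sequence m T P Y a /\
    regularly_varying1_seq a /\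
    measurable Omega /\ m Omega = 1%E /\
    (exists2 N : nat, (1 <= N)%N & forall n, (N <= n)%N ->
       forall x : R, 1 < x ->
         (m (Omega `&` [set w | (x * a n)%:E
                          <= ergodic_sum T (EFin \o \1_Omega) n w])
          <= 2%:E * P [set w | (x <= Y w)%R])%E).
Proof.
have [mu mu_cyl] := odometer_probability R qq_gt0.
pose v := vv Y.
have mt := measurable_tau qq_gt0.
have mut (A : set odoq) : measurable A -> mu ((tau qq : odoq -> odoq) @^-1` A) = mu A.
  exact: (tau_preserving qq_gt0 mu_cyl).
have erg (A : set odoq) : measurable A -> (tau qq : odoq -> odoq) @^-1` A = A ->
    mu A = 0%E \/ mu (~` A) = 0%E.
  exact: (tau_ergodic qq_gt0 mu_cyl).
have mphi := dm_phi v; have phi0 := phi_gt0 v.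
pose m := @tow_measure _ odoq R mu (phi v) mphi.
pose T := @tow_map _ odoq (tau qq) (phi v).
pose a n : R := aa n%:R.
pose Omega : set (odoq * nat) := [set u | u.2 = 0%N].
have mOmega : measurable Omega.
  apply: measurable_sections => -[|j].
    by rewrite (_ : [set x | _] = setT)//; apply/seteqP; split.
  by rewrite (_ : [set x | _] = set0)//; apply/seteqP; split.
have drs : distr_return_sequence m T P Y a.
  split=> [n n0|f intf f0]; first by rewrite /a mulr_gt0 ?beta_gt0 ?ltr0n.
  pose c := fine (\int[m]_u f u).
  have fc : (\int[m]_u f u = c%:E)%E by rewrite /c fineK//; exact: integrable_fin_num.
  have mf : measurable_fun setT f by exact: measurable_int intf.
  have c0 : 0 <= c by rewrite -lee_fin -fc; exact: integral_ge0.
  move=> Qm Qdom g [M0 [_ gM]] cg.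
  have {gM} : forall y : \bar R, (0 <= y)%E -> `|g y| <= M0 + 1.
    by move=> y y0; apply: (gM (M0 + 1)) => //; rewrite ltrDl.
  set M := M0 + 1 => gM.
  (* On [0, +oo] this is [g + M]. The absolute value makes it continuous on the whole line with
     equal values at both infinities, and the shift makes it nonnegative. *)
  pose g1 (y : \bar R) := g `|y|%E + M.
  have g1M y : 0 <= g1 y <= 2 * M.
    have := gM `|y|%E (abse_ge0 _); rewrite ler_norml => /andP[h1 h2].
    by apply/andP; split; rewrite /g1; lra.
  have cg1 : continuous (fun y : R => g1 y%:E).
    move=> y; apply: cvgD; last exact: cvg_cst.
    exact: (within_ge0_continuous cg).
  pose F n u := (ergodic_sum T f n u * ((a n)^-1)%:E)%E.
  have mF n : measurable_fun setT (F n).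
    apply: emeasurable_funM => //; exact: measurable_ergodic_sum.
  have mg1 n : measurable_fun setT (fun u => g1 (F n u)).
    exact: (measurable_ext_comp (mF n) cg1).
  have F0 n u : (0 < n)%N -> (0 <= F n u)%E.
    move=> n0; apply: mule_ge0; first by apply: sume_ge0 => i _.
    by rewrite lee_fin invr_ge0 ltW// /a mulr_gt0 ?beta_gt0 ?ltr0n.
  have lim := @ratio_distr_cvg R d' Om P Y Y_gt0 mu mu_cyl Qm Qdom f c (2 * M) g1 mf f0 fc g1M cg1 mg1.
  have mgY : measurable_fun setT (fun w => g1 (c * Y w)%:E).
    apply: (measurable_ext_comp _ cg1) => //; apply/measurable_EFinP.
    by apply: measurable_funM => //; exact: measurable_funPT.
  have -> : ('E_P[fun w => g ((Y w)%:E * \int[m]_u f u)] =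
      (fine (\int[P]_w (g1 (c * Y w)%:E)%:E) - M)%:E)%E.
    rewrite unlock -(integral_shift P M mgY (fun w => g1M _)); apply: eq_integral => w _.
    rewrite /g1 addrK fc -EFinM mulrC /= ger0_norm// mulr_ge0// ltW//; exact: Y_gt0.
  apply: (@cvg_trans _ ((fine (\int[Qm]_u (g1 (F n u))%:E) - M)%:E @[n --> \oo])).
    apply: near_eq_cvg; near=> n.
    rewrite -(integral_shift Qm M (mg1 n) (fun u => g1M _)); apply: eq_integral => u _.
    by rewrite /g1 addrK gee0_abs//; apply: F0; near: n; exact: nbhs_infty_gt.
  apply: cvg_EFin; first by near=> n.
  by apply: cvgB; [exact: lim|exact: cvg_cst].
exists _, (odoq * nat)%type, m, T, a, Omega.
split; first by split; [exact: tow_preserving|exact: tow_conservative|exact: tow_ergodic].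
split; first by exists a.
split => //.
split; first by exists aa => //; exact: aa_regular.
split => //.
have baseE (A : set (odoq * nat)) : measurable A -> m (Omega `&` A) = mu [set x | A (x, 0%N)].
  move=> mA; rewrite [LHS](@tow_measure_base _ _ _ mu (phi v) mphi phi0 (Omega `&` A)).
  - by congr (mu _); apply/seteqP; split => x /=; [case|].
  - exact: measurableI.
  - by move=> x j [].
split.
  transitivity (m (Omega `&` setT)); first by rewrite setIT.
  by rewrite baseE//; exact: probability_setT.
have [n0 h] := tail_window (vv_ge Y).
exists n0.+1 => // n nn x x1.
have mOf : measurable_fun setT (EFin \o \1_Omega : odoq * nat -> \bar R).
  by apply/measurable_EFinP; exact: measurable_indic.
pose S : set (odoq * nat) := [set w | (x * a n)%:E <= ergodic_sum T (EFin \o \1_Omega) n w]%E.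
have mS : measurable S.
  rewrite -[S]setTI; apply: emeasurable_fun_c_infty => //.
  exact: measurable_ergodic_sum.
rewrite [X in (X <= _)%E](baseE S mS).
have [N [k [Nk Nx hN]]] := h n (ltnW nn) x x1.
apply: (@le_trans _ _ (2 * sf Y x)%:E); last by rewrite EFinM sfE.
have law : (mu [set u | (x <= yty qq ll v 1 k.+1 u)%R] <= (sf Y x)%:E)%E by exact: ty_tail_law.
apply: le_trans (window_measure mu_cyl Nk law (sf_ge0 Y x) (vv_zone x1)).
apply: le_measure; rewrite ?inE.
- exact: measurable_section mS.
- exact: measurable_window.
(* If the [N] points met only types below [x], they would take longer than [n], and there would be
   fewer than [N <= x * a n] visits to the base. *)
move=> u /= hu; apply: contrapT => nh.
have nt : (n < @tow_time _ odoq (tau qq) (phi v) N u)%N.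
  apply: hN => i iN; rewrite leNgt; apply/negP => hi; apply: nh; exists i => //; exact: ltW.
have := base_visits_lt R phi0 nt; rewrite -/T => /(le_lt_trans hu).
rewrite lte_fin ltNge => /negP; apply.
exact: Nx.
Unshelve. all: by end_near. Qed.
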